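(* Let $\mathcal Z$ be a conformal parametrization of a minimal surface, defined on $\mathbb D_\epsilon$, which has no umbilical points on $\mathbb D_\epsilon^\star$ and for which the origin is an umbilic point. If $\widetilde{\mathcal Z}:\mathbb D_\epsilon^\star\to\mathbb R^3$ is a minimal end such that $(\mathcal Z,\widetilde{\mathcal Z})$ is Ribaucour integrable (on $\mathbb D_\epsilon^\star$), then $\widetilde{\mathcal Z}$ is a complete planar non-embedded end.
   Context: $\mathbb D_\epsilon\subset\mathbb C$ is the open disk of radius $\epsilon$ centered at $0$ and $\mathbb D_\epsilon^\star=\mathbb D_\epsilon\setminus\{0\}$. A minimal end is a conformal minimal immersion of $\mathbb D_\epsilon^\star$ which does not extend smoothly to the origin (as a possibly branched minimal surface). It is complete if curves in $\mathbb D_\epsilon^\star$ tending to $0$ have infinite length; embedded if it is injective on a sufficiently small punctured disk; planar if it has finite total curvature (so its Gauss map extends to $0$) and the coordinate function in the direction of the limiting normal has a finite limit at the origin. A pair of minimal immersions $(\mathcal Z,\widetilde{\mathcal Z})$ with Gauss maps $\mathcal N,\widetilde{\mathcal N}$ is Ribaucour integrable if $\mathcal N\neq\widetilde{\mathcal N}$ everywhere, there is a smooth $\tau$ with $\mathcal Z+\tau\mathcal N=\widetilde{\mathcal Z}+\tau\widetilde{\mathcal N}$, and $\Re\int_\gamma\frac{d\widetilde{\mathcal G}}{\widetilde{\mathcal G}-\mathcal G}=0$ for every loop $\gamma$, with $\mathcal G=\Pi\circ\mathcal N$, $\widetilde{\mathcal G}=\Pi\circ\widetilde{\mathcal N}$,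 $\Pi$ stereographic projection (equivalently the smooth 1-form $\frac{\langle d\widetilde{\mathcal N},\mathcal N\rangle}{1-\langle\mathcal N,\widetilde{\mathcal N}\rangle}$ is exact). For minimal surfaces it is understood, as in the classical theory, that the pair is given by smooth functions $\rho,\phi$ ($\tau=-\phi/\rho$) satisfying, for some real constant $c\ne0$, $d\rho=\langle\nabla^m\phi,d\mathcal N\rangle$, $\mathrm{Hess}(\phi)=c\rho\,I^m+(\rho-c\phi)II^m$, $|\nabla^m\phi|^2=-\rho^2+2c\rho\phi$, with $\widetilde{\mathcal Z}=\mathcal Z-\frac1{c\rho}(\nabla^m\phi+\rho\mathcal N)$ and $\widetilde{\mathcal N}=\mathcal N-\frac1{c\phi}(\nabla^m\phi+\rho\mathcal N)$, where $\nabla^m,\mathrm{Hess}$ refer to the first fundamental form $I^m$ of $\mathcal Z$ and $II^m=-\langle d\mathcal Z,d\mathcal N\rangle$. *)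

(* Defs.v *)
From HB Require Import structures.
From mathcomp Require Import all_boot all_order all_algebra.
From mathcomp Require Import all_classical all_reals all_analysis.
Set Implicit Arguments.
Unset Strict Implicit.
Unset Printing Implicit Defensive.
Import Order.TTheory GRing.Theory Num.Theory.
Import numFieldNormedType.Exports.
Local Open Scope classical_set_scope.
Local Open Scope ring_scope.

(* The parameter plane C is R * R, z = x + iy being (x, y), and R^3 is
   'rV[R]_3. The library norms on both are sup norms, which is harmless for
   limits and derivatives; Euclidean lengths are written explicitly.
   All maps are total, and only their values on the open set U matter. *)

Section Euclidean.
Variable R : realType.

Definition dot (u v : 'rV[R]_3) : R := \sum_(i < 3) u 0 i * v 0 i.

(* Index arithmetic in 'I_3 is modulo 3. *)
Definition cross (u v : 'rV[R]_3) : 'rV[R]_3 :=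
  \row_(i < 3) (u 0 (i + 1) * v 0 (i + 2%:R) - u 0 (i + 2%:R) * v 0 (i + 1)).

Definition enorm (u : 'rV[R]_3) : R := Num.sqrt (dot u u).

Definition pdot (v w : R * R) : R := v.1 * w.1 + v.2 * w.2.

Definition disk (r : R) : set (R * R) := [set p | pdot p p < r ^+ 2].

Definition pdisk (r : R) : set (R * R) := disk r `\ (0 : R * R).

Definition e (i : 'I_2) : R * R := ((i == 0)%:R, (i == 1)%:R).

End Euclidean.

Section Smooth.
Variables (R : realType) (W : normedModType R).

Fixpoint Ck (k : nat) (U : set (R * R)) (f : R * R -> W) : Prop :=
  (forall p, U p -> {for p, continuous f}) /\
  if k is k'.+1 then
    forall i : 'I_2,
      (forall p, U p -> derivable f p (e R i)) /\ Ck k' U (fun p => 'D_(e R i) f p)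
  else True.

Definition smooth (U : set (R * R)) (f : R * R -> W) : Prop :=
  forall k, Ck k U f.

End Smooth.

Section Surfaces.
Variable R : realType.
Implicit Types (U : set (R * R)) (Z Zt : R * R -> 'rV[R]_3) (f : R * R -> R)
  (p v w : R * R).

Definition gauss_map Z p : 'rV[R]_3 :=
  let n := cross ('D_(e R 0) Z p) ('D_(e R 1) Z p) in (enorm n)^-1 *: n.

Definition first_form Z p v w : R := dot ('D_v Z p) ('D_w Z p).

Definition second_form Z p v w : R := - dot ('D_v Z p) ('D_w (gauss_map Z) p).

Definition gI Z p : 'M[R]_2 := \matrix_(i, j) first_form Z p (e R i) (e R j).

Definition gII Z p : 'M[R]_2 := \matrix_(i, j) second_form Z p (e R i) (e R j).

Definition mean_curvature Z p : R := 2^-1 * \tr (invmx (gI Z p) *m gII Z p).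

Definition gauss_curvature Z p : R := \det (gII Z p) / \det (gI Z p).

Definition umbilic Z p : Prop :=
  exists l : R, forall v w, second_form Z p v w = l * first_form Z p v w.

(* Levi-Civita calculus of the first fundamental form of Z. The gradient is
   represented by its image in R^3 under dZ. *)
Definition christoffel Z p (k i j : 'I_2) : R :=
  2^-1 * \sum_l invmx (gI Z p) k l *
    ('D_(e R i) (fun q => gI Z q j l) p + 'D_(e R j) (fun q => gI Z q i l) p
     - 'D_(e R l) (fun q => gI Z q i j) p).

Definition grad Z f p : 'rV[R]_3 :=
  \sum_k (\sum_l invmx (gI Z p) k l * 'D_(e R l) f p) *: 'D_(e R k) Z p.

Definition hess Z f p : 'M[R]_2 :=
  \matrix_(i, j) ('D_(e R i) (fun q => 'D_(e R j) f q) p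
                  - \sum_k christoffel Z p k i j * 'D_(e R k) f p).

Definition conformal_immersion U Z : Prop :=
  smooth U Z /\
  forall p, U p -> exists2 l : R, 0 < l &
    forall v w, first_form Z p v w = l * pdot v w.

Definition conformal_minimal_immersion U Z : Prop :=
  conformal_immersion U Z /\ forall p, U p -> mean_curvature Z p = 0.

(* At a branch point dZ vanishes and the mean curvature is meaningless, so
   minimality is expressed by harmonicity. *)
Definition branched_minimal U Z : Prop :=
  [/\ smooth U Z,
      forall p, U p -> exists2 l : R, 0 <= l &
        forall v w, first_form Z p v w = l * pdot v w
    & forall p, U p -> \sum_i 'D_(e R i) (fun q => 'D_(e R i) Z q) p = 0].

Definition minimal_end (eps : R) Z : Prop :=
  conformal_minimal_immersion (pdisk eps) Z /\
  ~ exists F, branched_minimal (disk eps) F /\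
              forall p, pdisk eps p -> F p = Z p.

(* Supremum of the Euclidean lengths of inscribed polygons. *)
Definition curve_length (A : set R) (c : R -> 'rV[R]_3) : \bar R :=
  ereal_sup [set s | exists (n : nat) (t : nat -> R),
    [/\ {homo t : i j / (i <= j)%N >-> i <= j},
        forall i, A (t i)
      & s = (\sum_(0 <= i < n) enorm (c (t i.+1) - c (t i)))%:E]].

Definition complete_end (eps : R) Z : Prop :=
  forall g : R -> R * R,
    {within `[0, 1[%classic, continuous g} ->
    (forall t, t \in `[0, 1[ -> pdisk eps (g t)) ->
    g t @[t --> (1 : R)^'-] --> (0 : R * R) ->
    curve_length `[0, 1[%classic (Z \o g) = +oo%E.

Definition embedded_end (eps : R) Z : Prop :=
  exists r : R, [/\ 0 < r, r <= eps & set_inj (pdisk r) Z].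

(* A property of the germ of the end at 0: nothing is assumed about Z near
   the outer boundary of the disk, so the integral is taken over a possibly
   smaller disk. *)
Definition finite_total_curvature (eps : R) Z : Prop :=
  exists r : R, [/\ 0 < r, r <= eps &
    (\int[(@lebesgue_measure R \x @lebesgue_measure R)%E]_(p in pdisk r)
       (`|gauss_curvature Z p| * Num.sqrt (\det (gI Z p)))%:E < +oo)%E].

Definition planar_end (eps : R) Z : Prop :=
  finite_total_curvature eps Z /\
  exists (n : 'rV[R]_3) (h : R),
    gauss_map Z p @[p --> (0 : R * R)^'] --> n /\
    dot (Z p) n @[p --> (0 : R * R)^'] --> h.

(* The 1-form <dNt, N> / (1 - <N, Nt>), for N != Nt, is exact. Where the
   stereographic projections G, Gt of N, Nt are finite, it is equal to
   d log (1 + |Gt|^2) - 2 Re (dGt / (Gt - G)); unlike the last form it is smooth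
   also at the poles. *)
Definition period_condition U (N Nt : R * R -> 'rV[R]_3) : Prop :=
  exists h : R * R -> R, smooth U h /\
    forall p, U p -> forall v,
      'D_v h p = dot ('D_v Nt p) (N p) / (1 - dot (N p) (Nt p)).

Definition ribaucour_data U Z Zt (tau : R * R -> R) : Prop :=
  exists (c : R) (rho phi : R * R -> R),
  [/\ c != 0, smooth U rho, smooth U phi &
    forall p, U p ->
      let N := gauss_map Z in
      let V := grad Z phi p + rho p *: N p in
      [/\ rho p != 0, phi p != 0 & tau p = - (phi p / rho p)] /\
      [/\ forall v, 'D_v rho p = dot (grad Z phi p) ('D_v N p),
          hess Z phi p = (c * rho p) *: gI Z p + (rho p - c * phi p) *: gII Z p,
          dot (grad Z phi p) (grad Z phi p)
            = - rho p ^+ 2 + 2 * c * rho p * phi p,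
          Zt p = Z p - (c * rho p)^-1 *: V
        & gauss_map Zt p = N p - (c * phi p)^-1 *: V]].

Definition ribaucour_integrable U Z Zt : Prop :=
  let N := gauss_map Z in
  let Nt := gauss_map Zt in
  [/\ forall p, U p -> N p <> Nt p,
      period_condition U N Nt
    & exists tau : R * R -> R,
        [/\ smooth U tau,
            forall p, U p -> Z p + tau p *: N p = Zt p + tau p *: Nt p
          & ribaucour_data U Z Zt tau]].

End Surfaces.

(* Main.v *)
(** In terms of [W = grad phi + rho N], the Ribaucour data form the linear system
    [dW = c (rho dZ + phi dN)], [d rho = W.dN], [d phi = W.dZ], with [W.W = 2 c rho phi].
    Hence [(W, rho, phi)] has a nonzero limit at the origin.

    If [rho] does not tend to [0], then [x = Zt - Z = - W / (c rho)] has a limit and solves a Riccati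
    system with smooth coefficients, whose right-hand side stays differentiable at the origin because
    the origin is umbilic; by bootstrapping [Zt] extends to a branched minimal surface, which is excluded.

    So [rho] and [W] tend to [0], and [y = - W / (2 phi)] tends to [0], satisfies
    [dy = - (c/2) dN - (y.y) dZ + 2 (y.dZ) y], and gives [Zt = Z + y / (y.y)] and [Nt = N + (2/c) y].
    Therefore [y = - (c/2) (N - N(0))] up to order [2 k + 1], where [k >= 2] is the order of vanishing at
    the umbilic point of the holomorphic derivative [h_x - i h_y] of the height [h = Z.N(0)].
    Completeness and planarity follow: [|Zt|] tends to infinity, and the Jacobian of [Nt] is bounded.

    The inversion of [Zt] about [Z(0)] is, in suitable coordinates of the tangent plane at [Z(0)],
    of the form [z ^ k + O(|z| ^ (k+1))] with derivatives [O(|z| ^ k)].  The height along its fiber over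
    [s^k exp(i k t)] is a [2 pi]-periodic continuous function of [t], and shifting [t] by [2 pi / k]
    permutes the fiber, so two points of a fiber have the same height: [Zt] is not injective. *)

From HB Require Import structures.
Require Import Defs.
From mathcomp Require Import all_boot all_order all_algebra.
From mathcomp Require Import all_classical all_reals all_analysis.
From mathcomp Require Import ring lra.
Set Implicit Arguments.
Unset Strict Implicit.
Unset Printing Implicit Defensive.
Import Order.TTheory GRing.Theory Num.Theory.
Import numFieldNormedType.Exports.
Local Open Scope classical_set_scope.
Local Open Scope ring_scope.

(** * Calculus in the plane *)

(** The nonzero limit of [(W, rho, phi)] rests on a Gronwall estimate: the logarithm of
    [rho^2 + phi^2 + W.W] has bounded gradient on the punctured disk, so this quantity stays between
    two positive constants. Orders of vanishing are gained by integrating gradients; a bound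
    [O(|p|^m)] cannot be differentiated, so bounds on derivatives are carried along separately. The
    precision [2k + 1] is forced by planarity: the height of [Zt] contains [y.N(0) / (y.y)], whose
    denominator has exact order [2k]. The leading part of [y.N(0)] is read off from [N] lying on the
    unit sphere, and the limit height is [Z(0).N(0) + 1/c]. The inversion of [Zt] is not
    holomorphic, only asymptotic to [z^k], so its fibers come from a contraction, which needs the
    derivative bounds; an intermediate value argument handles the one remaining real coordinate.
    That [k] is finite comes from [Zt] being an immersion: a flat height would make [N] constant
    nearby, and where [dN = 0] the Riccati equation for [x] gives [dZt = 0]. *)

Section Derivatives.
Variable R : realType.
Implicit Types (V W : normedModType R).

(** Reduces directional derivatives to one real variable, where the mean value theorem and Fermat's
    rule at an extremum are available. *)
Lemma is_derive_line V W (f : V -> W) p v (t : R) df :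
  is_derive (p + t *: v) v f df -> is_derive t 1 (fun s : R => f (p + s *: v)) df.
Proof.
have E : (fun h : R => h^-1 *: (f (p + (h *: (1 : R) + t) *: v) - f (p + t *: v))) =
         (fun h : R => h^-1 *: (f (h *: v + (p + t *: v)) - f (p + t *: v))).
  apply/funext => h; congr (_ *: (f _ - _)).
  by rewrite [_ *: 1]mulr1 scalerDl addrCA.
move=> [d e]; split.
  by rewrite /derivable E.
by rewrite -e /derive E.
Qed.

Lemma is_derive_addf V W (f g : V -> W) p v df dg :
  is_derive p v f df -> is_derive p v g dg ->
  is_derive p v (fun q => f q + g q) (df + dg).
Proof. by move=> F G; exact: (is_deriveD F G). Qed.

Lemma is_derive_subf V W (f g : V -> W) p v df dg :
  is_derive p v f df -> is_derive p v g dg ->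
  is_derive p v (fun q => f q - g q) (df - dg).
Proof. by move=> F G; exact: (is_deriveB F G). Qed.

Lemma is_derive_oppf V W (f : V -> W) p v df :
  is_derive p v f df -> is_derive p v (fun q => - f q) (- df).
Proof. by move=> F; exact: (is_deriveN F). Qed.

Lemma is_derive_mulf V (f g : V -> R) p v df dg :
  is_derive p v f df -> is_derive p v g dg ->
  is_derive p v (fun q => f q * g q) (df * g p + f p * dg).
Proof.
move=> F G; apply: is_derive_eq (is_deriveM F G) _.
by rewrite [_ *: dg]/GRing.scale [_ *: df]/GRing.scale /= addrC [df * _]mulrC.
Qed.

Lemma is_derive_invf V (f : V -> R) p v df : f p != 0 ->
  is_derive p v f df -> is_derive p v (fun q => (f q)^-1) (- df / f p ^+ 2).
Proof.
move=> f0 [F <-]; split; first exact: derivableV.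
have := deriveV f0 F; rewrite /= => ->.
by rewrite [_ *: _]/GRing.scale /= !mulNr mulrC.
Qed.

Lemma is_derive_unique V W (f : V -> W) p v df df' :
  is_derive p v f df -> is_derive p v f df' -> df = df'.
Proof. by move=> [_ <-] [_ <-]. Qed.

Lemma is_derive_coord V m (f : V -> 'rV[R]_m) p v df :
  is_derive p v f df <-> forall i, is_derive p v (fun q => f q 0 i) (df 0 i).
Proof.
split=> [[F <-] i|H].
  split; first by move/derivable_mxP : F.
  by rewrite (derive_mx F) mxE.
have F : derivable f p v.
  by apply/derivable_mxP => a i; rewrite (ord1 a); case: (H i).
split=> //; rewrite derive_mx //; apply/rowP => i; rewrite mxE.
by case: (H i).
Qed.

Lemma is_derive_scalef V m (a : V -> R) (f : V -> 'rV[R]_m) p v da df :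
  is_derive p v a da -> is_derive p v f df ->
  is_derive p v (fun q => a q *: f q) (da *: f p + a p *: df).
Proof.
move=> A /is_derive_coord F; apply/is_derive_coord => i; rewrite !mxE.
under eq_fun do rewrite mxE.
exact: is_derive_mulf.
Qed.

Lemma is_derive_dot V (f g : V -> 'rV[R]_3) p v df dg :
  is_derive p v f df -> is_derive p v g dg ->
  is_derive p v (fun q => dot (f q) (g q)) (dot df (g p) + dot (f p) dg).
Proof.
move=> /is_derive_coord F /is_derive_coord G; rewrite /dot.
under eq_fun do rewrite !big_ord_recl big_ord0 addr0.
rewrite !big_ord_recl !big_ord0 !addr0.
set d := (X in is_derive _ _ _ X).
have -> : d = (df 0 ord0 * g p 0 ord0 + f p 0 ord0 * dg 0 ord0) +
   ((df 0 (lift ord0 ord0) * g p 0 (lift ord0 ord0) +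
     f p 0 (lift ord0 ord0) * dg 0 (lift ord0 ord0)) +
    (df 0 (lift ord0 (lift ord0 ord0)) * g p 0 (lift ord0 (lift ord0 ord0)) +
     f p 0 (lift ord0 (lift ord0 ord0)) * dg 0 (lift ord0 (lift ord0 ord0)))).
  by rewrite /d; ring.
by do 2?apply: is_derive_addf; exact: is_derive_mulf.
Qed.

Lemma is_derive_cst0 V W (w : W) (p v : V) : is_derive p v (fun=> w) 0.
Proof. exact: is_derive_cst. Qed.

Lemma mvt_line V (f : V -> R) p v (a b : R) : a < b ->
  (forall t, a <= t <= b -> derivable f (p + t *: v) v) ->
  exists2 c, a < c < b & f (p + b *: v) - f (p + a *: v) = 'D_v f (p + c *: v) * (b - a).
Proof.
move=> ab F.
have L t : a <= t <= b ->
    is_derive t 1 (fun s : R => f (p + s *: v)) ('D_v f (p + t *: v)).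
  by move=> /F d; apply: is_derive_line; exact: DeriveDef.
have [c|x|c cab e] := @MVT R (fun s => f (p + s *: v)) (fun s => 'D_v f (p + s *: v)) a b ab.
- by rewrite in_itv /= => /andP[h1 h2]; apply: L; rewrite !ltW.
- apply: derivable_within_continuous => t; rewrite in_itv /= => tab.
  by case: (L t tab).
- by exists c => //; move: cab; rewrite in_itv.
Qed.

Lemma mvt_le V (f : V -> R) p v (a b K : R) : a <= b ->
  (forall t, a <= t <= b -> derivable f (p + t *: v) v) ->
  (forall t, a <= t <= b -> `|'D_v f (p + t *: v)| <= K) ->
  `|f (p + b *: v) - f (p + a *: v)| <= K * (b - a).
Proof.
rewrite le_eqVlt => /predU1P[<-|ab] F B; first by rewrite !subrr normr0 mulr0.
have [c /andP[ac cb] ->] := mvt_line ab F.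
rewrite normrM (gtr0_norm (_ : 0 < b - a)) ?subr_gt0 //.
apply: ler_wpM2r; first by rewrite subr_ge0 ltW.
have h : a <= c <= b by rewrite (ltW ac) (ltW cb).
exact: (B c h).
Qed.

End Derivatives.

(** * Lipschitz bounds from partial derivatives on squares and punctured squares *)

Section Squares.
Variable R : realType.
Implicit Types (p q z : R * R) (f : R * R -> R).

Lemma half_lt (x : R) : 0 < x -> x / 2 < x.
Proof. by move=> x0; rewrite ltr_pdivrMr // ltr_pMr // ltr1n. Qed.

Lemma normpE p : `|p| = Num.max `|p.1| `|p.2|.
Proof. by []. Qed.

Lemma normp1_le p : `|p.1| <= `|p|.
Proof. by rewrite normpE le_max lexx. Qed.

Lemma normp2_le p : `|p.2| <= `|p|.
Proof. by rewrite normpE le_max lexx orbT. Qed.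

Lemma normp_le p (r : R) : (`|p| <= r) = (`|p.1| <= r) && (`|p.2| <= r).
Proof. by rewrite normpE ge_max. Qed.

Lemma normp_lt p (r : R) : (`|p| < r) = (`|p.1| < r) && (`|p.2| < r).
Proof. by rewrite normpE gt_max. Qed.

Lemma horiz_line (y t : R) : (0, y) + t *: e R 0 = (t, y).
Proof.
rewrite [LHS]surjective_pairing /=; congr pair; last by rewrite [_ *: _]mulr0 addr0.
by rewrite add0r [LHS]mulr1.
Qed.

Lemma vert_line (x t : R) : (x, 0) + t *: e R 1 = (x, t).
Proof.
rewrite [LHS]surjective_pairing /=; congr pair; first by rewrite [_ *: _]mulr0 addr0.
by rewrite add0r [LHS]mulr1.
Qed.

Lemma horiz_le f (y a b K : R) :
  (forall t, Num.min a b <= t <= Num.max a b ->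
     derivable f (t, y) (e R 0) /\ `|'D_(e R 0) f (t, y)| <= K) ->
  `|f (b, y) - f (a, y)| <= K * `|b - a|.
Proof.
wlog ab : a b / a <= b => [W H|].
  have [/W|/ltW/W] := leP a b; first exact.
  by rewrite distrC (distrC a); apply; rewrite minC maxC.
have E := horiz_line y.
rewrite min_l // max_r // => H; rewrite -(E b) -(E a) (ger0_norm (_ : 0 <= b - a)) ?subr_ge0 //.
by apply: (@mvt_le R _ f (0, y) (e R 0)) => // t /H; rewrite E => -[].
Qed.

Lemma vert_le f (x a b K : R) :
  (forall t, Num.min a b <= t <= Num.max a b ->
     derivable f (x, t) (e R 1) /\ `|'D_(e R 1) f (x, t)| <= K) ->
  `|f (x, b) - f (x, a)| <= K * `|b - a|.
Proof.
wlog ab : a b / a <= b => [W H|].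
  have [/W|/ltW/W] := leP a b; first exact.
  by rewrite distrC (distrC a); apply; rewrite minC maxC.
have E := vert_line x.
rewrite min_l // max_r // => H; rewrite -(E b) -(E a) (ger0_norm (_ : 0 <= b - a)) ?subr_ge0 //.
by apply: (@mvt_le R _ f (x, 0) (e R 1)) => // t /H; rewrite E => -[].
Qed.

Lemma norm_e_le (i : 'I_2) : `|e R i| <= 1.
Proof. by rewrite normp_le /= /e; do 2!case: (_ == _); rewrite /= ?normr0 ?normr1 ?lexx ?ler01. Qed.

Lemma sqr_normp_le p : `|p| ^+ 2 <= pdot p p.
Proof.
by rewrite normpE /pdot -!expr2; case: (leP `|p.1| `|p.2|) => _;
  rewrite real_normK ?num_real // ?lerDl ?lerDr sqr_ge0.
Qed.

(** Two points of a square are joined inside it by a horizontal and a vertical segment, each costing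
    [K] times a coordinate difference; hence the factor 2. Only the two partial derivatives
    enter. *)
Lemma square_lip f z (r K : R) :
  (forall p, `|p - z| <= r -> forall i,
     derivable f p (e R i) /\ `|'D_(e R i) f p| <= K) ->
  forall p q, `|p - z| <= r -> `|q - z| <= r ->
  `|f p - f q| <= 2 * K * `|p - q|.
Proof.
move=> H [x y] [a b]; rewrite !normp_le /= => /andP[px py] /andP[qx qy].
have K0 : 0 <= K.
  have zr : `|z - z| <= r by rewrite subrr normr0; exact: le_trans px.
  by case: (H z zr 0) => _; exact: le_trans.
have mm s t u w : `|s - w| <= r -> `|t - w| <= r ->
    Num.min s t <= u <= Num.max s t -> `|u - w| <= r.
  rewrite !ler_norml ge_min le_max => /andP[h1 h2] /andP[h3 h4].
  by move=> /andP[/orP[] h5 /orP[] h6]; apply/andP; split; lra.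
have h1 : `|f (x, y) - f (a, y)| <= K * `|x - a|.
  apply: horiz_le => t tt; apply: H; rewrite normp_le /= py andbT.
  by apply: (mm a x t z.1).
have h2 : `|f (a, y) - f (a, b)| <= K * `|y - b|.
  apply: vert_le => t tt; apply: H; rewrite normp_le /= qx /=.
  by apply: (mm b y t z.2).
have d1 := normp1_le ((x, y) - (a, b)); have d2 := normp2_le ((x, y) - (a, b)).
rewrite /= in d1 d2.
have -> : f (x, y) - f (a, b) = (f (x, y) - f (a, y)) + (f (a, y) - f (a, b)) by ring.
apply: le_trans (ler_normD _ _) _.
have k1 := ler_wpM2l K0 d1; have k2 := ler_wpM2l K0 d2.
lra.
Qed.

(** Each point is joined to the corner [(r, r)] by axis-parallel segments that miss the origin: two
    of them from the closed upper half, three from the lower half by way of [(x, - r)] and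
    [(r, - r)]. Each segment has length at most [2 r], so a path costs at most [6 K r], and a pair
    of points [12 K r]. *)
Lemma punctured_square_lip f (r K : R) :
  (forall p, p != 0 -> `|p| <= r -> forall i,
     derivable f p (e R i) /\ `|'D_(e R i) f p| <= K) ->
  forall p q, p != 0 -> q != 0 -> `|p| <= r -> `|q| <= r ->
  `|f p - f q| <= 12 * K * r.
Proof.
move=> H p q p0 q0 pr qr.
have r0 : 0 < r by apply: lt_le_trans pr; rewrite normr_gt0.
have K0 : 0 <= K by case: (H p p0 pr 0) => _; exact: le_trans.
have nz1 (x y : R) : y != 0 -> (x, y) != 0 :> R * R.
  by apply: contra => /eqP[_ ->].
have nz0 (x y : R) : x != 0 -> (x, y) != 0 :> R * R.
  by apply: contra => /eqP[-> _].
have rr : `|r| <= r by rewrite ger0_norm // ltW.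
have b2 (s t : R) : `|s| <= r -> `|t| <= r -> `|s - t| <= 2 * r.
  by move=> *; apply: le_trans (ler_normB _ _) _; lra.
have mm s t u : `|s| <= r -> `|t| <= r ->
    Num.min s t <= u <= Num.max s t -> `|u| <= r.
  rewrite !ler_norml ge_min le_max => /andP[h1 h2] /andP[h3 h4].
  by move=> /andP[/orP[] h5 /orP[] h6]; apply/andP; split; lra.
(* The disjunction says that the vertical segment from [(x, a)] to [(x, b)] misses the origin. *)
have V (x a b : R) : `|x| <= r -> `|a| <= r -> `|b| <= r ->
    (x != 0) || (0 < Num.min a b) || (Num.max a b < 0) ->
    `|f (x, b) - f (x, a)| <= 2 * K * r.
  move=> xr ar br xab; apply: le_trans (_ : K * `|b - a| <= _).
    apply: vert_le => t tab; apply: H; last by rewrite normp_le xr /= (mm a b).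
    case/orP: xab => [/orP[/nz0 //|m]|m]; apply: nz1.
      by rewrite gt_eqF // (lt_le_trans m) //; case/andP: tab.
    by rewrite lt_eqF // (le_lt_trans _ m) //; case/andP: tab.
  by have := ler_wpM2l K0 (b2 _ _ br ar); lra.
have Hz (y a b : R) : `|y| <= r -> `|a| <= r -> `|b| <= r -> y != 0 ->
    `|f (b, y) - f (a, y)| <= 2 * K * r.
  move=> yr ar br y0; apply: le_trans (_ : K * `|b - a| <= _).
    apply: horiz_le => t tab; apply: H; first exact: nz1.
    by rewrite normp_le /= yr andbT (mm a b).
  by have := ler_wpM2l K0 (b2 _ _ br ar); lra.
suff C x y : (x, y) != 0 :> R * R -> `|x| <= r -> `|y| <= r ->
    `|f (x, y) - f (r, r)| <= 6 * K * r.
  case: p p0 pr => [x y] p0; case: q q0 qr => [a b] q0.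
  rewrite !normp_le /= => /andP[qx qy] /andP[px py].
  have -> : f (x, y) - f (a, b) = (f (x, y) - f (r, r)) - (f (a, b) - f (r, r)) by ring.
  apply: le_trans (ler_normB _ _) _.
  have := C x y p0 px py; have := C a b q0 qx qy; lra.
have r' : `|- r| <= r by rewrite normrN.
have rn : r != 0 by rewrite gt_eqF.
move=> xy0 xr yr; have [y0|y0] := leP 0 y.
  have h1 : `|f (x, y) - f (x, r)| <= 2 * K * r.
    apply: V => //; have [x0|//] := eqVneq x 0; rewrite lt_min r0.
    have -> // : 0 < y.
    by rewrite lt_neqAle y0 andbT eq_sym; apply: contra xy0 => /eqP ->; rewrite x0.
  have h2 := Hz r r x rr rr xr rn.
  have -> : f (x, y) - f (r, r) = (f (x, y) - f (x, r)) + (f (x, r) - f (r, r)) by ring.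
  apply: le_trans (ler_normD _ _) _.
  have : 0 <= K * r by rewrite mulr_ge0 // ltW.
  by lra.
have h1 : `|f (x, y) - f (x, - r)| <= 2 * K * r.
  by apply: V => //; rewrite gt_max y0 oppr_lt0 r0 !orbT.
have h2 : `|f (x, - r) - f (r, - r)| <= 2 * K * r.
  by apply: Hz => //; rewrite oppr_eq0.
have h3 : `|f (r, - r) - f (r, r)| <= K * (2 * r).
  apply: le_trans (_ : K * `|- r - r| <= _); last by rewrite ler_wpM2l // b2.
  apply: vert_le => t tt; apply: H; first exact: nz0.
  by rewrite normp_le /= rr (mm r (- r)).
have -> : f (x, y) - f (r, r) = (f (x, y) - f (x, - r)) +
  (f (x, - r) - f (r, - r)) + (f (r, - r) - f (r, r)) by ring.
apply: le_trans (ler_normD _ _) _.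
have := ler_normD (f (x, y) - f (x, - r)) (f (x, - r) - f (r, - r)).
by lra.
Qed.

End Squares.

(** * Closure properties of [Ck] and symmetry of second derivatives *)

Section SmoothFunctions.
Variable R : realType.
Implicit Types (U : set (R * R)) (p q v w : R * R).

Lemma Ck_cont (W : normedModType R) k U (f : R * R -> W) p :
  Ck k U f -> U p -> {for p, continuous f}.
Proof. by case: k => [|k] [c _]; exact: c. Qed.

Lemma Ck_deriv (W : normedModType R) k U (f : R * R -> W) (i : 'I_2) :
  Ck k.+1 U f -> Ck k U (fun p => 'D_(e R i) f p).
Proof. by move=> [_ /(_ i)[]]. Qed.

Lemma Ck_is_derive (W : normedModType R) k U (f : R * R -> W) p (i : 'I_2) :
  Ck k.+1 U f -> U p -> is_derive p (e R i) f ('D_(e R i) f p).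
Proof. by move=> [_ /(_ i)[d _]] /d; exact: derivableP. Qed.

Lemma CkW (W : normedModType R) k U (f : R * R -> W) : Ck k.+1 U f -> Ck k U f.
Proof.
elim: k f => [|k IH] f [c d]; first by split.
split=> // i; have [d1 d2] := d i; split=> //; exact: IH.
Qed.

Lemma Ck_sub (W : normedModType R) k U U' (f : R * R -> W) :
  U' `<=` U -> Ck k U f -> Ck k U' f.
Proof.
move=> UU; elim: k f => [|k IH] f [c d]; first by split=> // p /UU/c.
split=> [p /UU/c //|i]; have [d1 d2] := d i; split=> [p /UU/d1 //|].
exact: IH.
Qed.

Lemma near_open U (W : Type) (f g : R * R -> W) p : open U -> U p ->
  (forall q, U q -> f q = g q) -> \near p, f p = g p.
Proof. by move=> oU Up H; move: oU => /(_ _ Up); apply: filterS => q /H. Qed.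

Lemma near_eq_cont (W : normedModType R) (f g : R * R -> W) p :
  (\near p, f p = g p) -> {for p, continuous f} -> {for p, continuous g}.
Proof.
move=> fg; rewrite /prop_for /continuous_at (nbhs_singleton fg) => fp.
exact: cvg_trans (near_eq_cvg fg) fp.
Qed.

Lemma Ck_ext (W : normedModType R) k U (f g : R * R -> W) : open U ->
  (forall p, U p -> f p = g p) -> Ck k U f -> Ck k U g.
Proof.
move=> oU; elim: k f g => [|k IH] f g fg [c d].
  by split=> // p Up; apply: near_eq_cont (c p Up); exact: near_open Up fg.
split=> [p Up|i].
  by apply: near_eq_cont (c p Up); exact: near_open Up fg.
have [d1 d2] := d i; split=> [p Up|].
  by apply: near_eq_derivable (d1 p Up); exact: near_open Up fg.
apply: IH d2 => p Up; apply: near_eq_derive; exact: near_open Up fg.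
Qed.

(** Allows the partial derivatives to be given by formulas valid on [U] only; openness of [U]
    transfers regularity from the formulas to the total functions ['D_(e R i) f]. The regularity
    proofs by induction on [k] go through this. *)
Lemma CkS (W : normedModType R) k U (f : R * R -> W) (g : 'I_2 -> R * R -> W) : open U ->
  (forall p, U p -> {for p, continuous f}) ->
  (forall i p, U p -> is_derive p (e R i) f (g i p)) ->
  (forall i, Ck k U (g i)) -> Ck k.+1 U f.
Proof.
move=> oU c d G; split=> // i; split=> [p /(d i)[] //|].
by apply: Ck_ext (G i) => // p /(d i)[].
Qed.

Lemma Ck_cst (W : normedModType R) k U (w : W) : open U -> Ck k U (fun=> w).
Proof.
move=> oU; elim: k w => [|k IH] w; first by split=> // p _; exact: cst_continuous.
apply: (@CkS _ _ _ _ (fun=> fun=> 0)) => //; first by move=> p _; exact: cst_continuous.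
Qed.

Lemma CkD (W : normedModType R) k U (f g : R * R -> W) : open U ->
  Ck k U f -> Ck k U g -> Ck k U (fun p => f p + g p).
Proof.
move=> oU; elim: k f g => [|k IH] f g F G.
  by split=> // p Up; apply: continuousD; [exact: Ck_cont F Up|exact: Ck_cont G Up].
apply: (@CkS _ _ _ _ (fun i p => 'D_(e R i) f p + 'D_(e R i) g p)) => //.
- by move=> p Up; apply: continuousD; [exact: Ck_cont F Up|exact: Ck_cont G Up].
- by move=> i p Up; apply: is_derive_addf; [exact: Ck_is_derive F Up|exact: Ck_is_derive G Up].
- by move=> i; apply: IH; exact: Ck_deriv.
Qed.

Lemma CkM k U (f g : R * R -> R) : open U ->
  Ck k U f -> Ck k U g -> Ck k U (fun p => f p * g p).
Proof.
move=> oU; elim: k f g => [|k IH] f g F G.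
  by split=> // p Up; apply: continuousM; [exact: Ck_cont F Up|exact: Ck_cont G Up].
apply: (@CkS _ _ _ _ (fun i p => 'D_(e R i) f p * g p + f p * 'D_(e R i) g p)) => //.
- by move=> p Up; apply: continuousM; [exact: Ck_cont F Up|exact: Ck_cont G Up].
- by move=> i p Up; apply: is_derive_mulf; [exact: Ck_is_derive F Up|exact: Ck_is_derive G Up].
- move=> i; apply: CkD => //; apply: IH; try exact: CkW; exact: Ck_deriv.
Qed.

Lemma CkZl k U (c : R) (f : R * R -> R) : open U -> Ck k U f -> Ck k U (fun p => c * f p).
Proof. by move=> oU F; apply: CkM => //; exact: Ck_cst. Qed.

Lemma CkN k U (f : R * R -> R) : open U -> Ck k U f -> Ck k U (fun p => - f p).
Proof.
move=> oU F; apply: Ck_ext (CkZl (-1) oU F) => // p _; exact: mulN1r.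
Qed.

Lemma CkB k U (f g : R * R -> R) : open U -> Ck k U f -> Ck k U g ->
  Ck k U (fun p => f p - g p).
Proof. by move=> oU F G; apply: CkD => //; exact: CkN. Qed.

Lemma CkV k U (f : R * R -> R) : open U -> (forall p, U p -> f p != 0) ->
  Ck k U f -> Ck k U (fun p => (f p)^-1).
Proof.
move=> oU f0; elim: k => [|k IH] F.
  by split=> // p Up; apply: continuousV; [exact: f0|exact: Ck_cont F Up].
apply: (@CkS _ _ _ _ (fun i p => - ('D_(e R i) f p) * ((f p)^-1 * (f p)^-1))) => //.
- by move=> p Up; apply: continuousV; [exact: f0|exact: Ck_cont F Up].
- move=> i p Up; have := is_derive_invf (f0 p Up) (Ck_is_derive i F Up).
  by rewrite -invfM expr2.
- move=> i; apply: CkM => //; first by apply: CkN => //; exact: Ck_deriv.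
  by apply: CkM => //; apply: IH; exact: CkW.
Qed.

Lemma continuous_coord m (f : R * R -> 'rV[R]_m) p :
  {for p, continuous f} <-> forall j, {for p, continuous (fun q => f q 0 j)}.
Proof.
split=> [c j|c].
  apply: (@continuous_comp _ _ _ f (fun M : 'rV[R]_m => M 0 j)) => //.
  exact: coord_continuous.
apply/cvgrPdist_le => /= d d0; near=> q.
rewrite [leLHS]/Num.Def.normr/= mx_normrE (bigmax_le _ (ltW d0))//= => i _.
rewrite !mxE/= (ord1 i.1).
move: i; near: q; apply: filter_forall => /= i.
exact: ((cvgrPdist_le _ _).1 (c i.2)).
Unshelve. all: by end_near. Qed.

Lemma Ck_coord m k U (f : R * R -> 'rV[R]_m) : open U ->
  Ck k U f <-> forall j, Ck k U (fun p => f p 0 j).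
Proof.
move=> oU; elim: k f => [|k IH] f.
  split=> [[c _] j|F].
    by split=> // p Up; have /continuous_coord := c p Up; exact.
  by split=> // p Up; apply/continuous_coord => j; exact: Ck_cont (F j) Up.
split=> [F j|F].
  apply: (@CkS _ _ _ _ (fun i p => ('D_(e R i) f p) 0 j)) => //.
  - by move=> p Up; have /continuous_coord := Ck_cont F Up; exact.
  - by move=> i p Up; have /is_derive_coord := Ck_is_derive i F Up; exact.
  - by move=> i; have /IH := Ck_deriv i F; exact.
have D i p : U p -> is_derive p (e R i) f (\row_j 'D_(e R i) (fun q => f q 0 j) p).
  move=> Up; apply/is_derive_coord => j; rewrite mxE; exact: Ck_is_derive (F j) Up.
apply: (@CkS _ _ _ _ (fun i p => \row_j 'D_(e R i) (fun q => f q 0 j) p)) => //.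
  by move=> p Up; apply/continuous_coord => j; exact: Ck_cont (F j) Up.
move=> i; apply/IH => j; apply: Ck_ext (Ck_deriv i (F j)) => // p _.
by rewrite mxE.
Qed.

Lemma CkZ m k U (a : R * R -> R) (f : R * R -> 'rV[R]_m) : open U ->
  Ck k U a -> Ck k U f -> Ck k U (fun p => a p *: f p).
Proof.
move=> oU A /(Ck_coord _ _ oU) F; apply/Ck_coord => // j.
by apply: Ck_ext (CkM oU A (F j)) => // p _; rewrite mxE.
Qed.

Lemma Ck_dot k U (f g : R * R -> 'rV[R]_3) : open U ->
  Ck k U f -> Ck k U g -> Ck k U (fun p => dot (f p) (g p)).
Proof.
move=> oU /(Ck_coord _ _ oU) F /(Ck_coord _ _ oU) G.
have H := CkD oU (CkM oU (F ord0) (G ord0)) (CkD oU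
  (CkM oU (F (lift ord0 ord0)) (G (lift ord0 ord0)))
  (CkM oU (F (lift ord0 (lift ord0 ord0))) (G (lift ord0 (lift ord0 ord0))))).
by apply: Ck_ext H => // p _; rewrite /dot !big_ord_recl big_ord0 addr0.
Qed.

Lemma smooth_cont (W : normedModType R) U (f : R * R -> W) p :
  smooth U f -> U p -> {for p, continuous f}.
Proof. by move=> F; exact: Ck_cont (F 0). Qed.

Lemma is_derive_translate (W : normedModType R) (f : R * R -> W) p v w df :
  is_derive (p + w) v f df -> is_derive p v (fun q => f (q + w)) df.
Proof.
have E : (fun h : R => h^-1 *: (f (h *: v + p + w) - f (p + w))) =
         (fun h : R => h^-1 *: (f (h *: v + (p + w)) - f (p + w))).
  by apply/funext => h; rewrite addrA.
move=> [d ed]; split; first by rewrite /derivable E.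
by rewrite -ed /derive E.
Qed.

(** The mean value theorem is applied along [v] to [z |-> f (z + h w) - f z], and then along [w] to
    ['D_v f]. *)
Lemma second_difference (f : R * R -> R) p v w (h : R) : 0 < h ->
  (forall s t, 0 <= s <= h -> 0 <= t <= h ->
    let q := p + s *: v + t *: w in
    derivable f q v /\ derivable (fun z => 'D_v f z) q w) ->
  exists s t, [/\ 0 < s < h, 0 < t < h &
    f (p + h *: v + h *: w) - f (p + h *: v) - (f (p + h *: w) - f p)
    = 'D_w (fun z => 'D_v f z) (p + s *: v + t *: w) * h * h].
Proof.
move=> h0 H; pose g z := f (z + h *: w) - f z.
have I0 : 0 <= (0 : R) <= h by rewrite lexx ltW.
have Ih : 0 <= h <= h by rewrite lexx ltW.
have dg s : 0 <= s <= h -> is_derive (p + s *: v) v g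
    ('D_v f (p + s *: v + h *: w) - 'D_v f (p + s *: v)).
  move=> sI; apply: is_derive_subf.
    apply: is_derive_translate; apply: derivableP.
    exact: (H s h sI Ih).1.
  by apply: derivableP; have [] := H s 0 sI I0; rewrite scale0r addr0.
have [s /andP[s0 sh] e1] := mvt_line h0 (fun s sI => @ex_derive _ _ _ _ _ _ _ (dg s sI)).
have sI : 0 <= s <= h by rewrite !ltW.
have [t tI e2] := @mvt_line _ _ (fun z => 'D_v f z) (p + s *: v) w 0 h h0
  (fun t tI => (H s t sI tI).2).
exists s, t; split=> //; first by rewrite s0.
move: e1; rewrite {1 2}/g scale0r addr0 !subr0 => ->.
rewrite (@derive_val _ _ _ _ _ _ _ (dg s sI)); congr (_ * _).
by move: e2; rewrite scale0r addr0 subr0.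
Qed.

Lemma Ck_continuous_near (f : R * R -> R) p (d : R) : 0 < d ->
  {for p, continuous f} -> exists2 r, 0 < r & forall q, `|q - p| < r -> `|f q - f p| < d.
Proof.
move=> d0 /cvgrPdist_lt /(_ d d0) /nbhs_ballP[r /= r0 H]; exists r => // q qr.
rewrite distrC; apply: H; rewrite -ball_normE /= distrC; exact: qr.
Qed.

Lemma open_square U p : open U -> U p ->
  exists2 r : R, 0 < r & forall q, `|q - p| < r -> U q.
Proof.
move=> oU Up; have /nbhs_ballP[r /= r0 H] := oU _ Up; exists r => // q qr.
by apply: H; rewrite -ball_normE /= distrC; exact: qr.
Qed.

(** The second difference is symmetric in its two directions, so both mixed derivatives take a
    common value at points arbitrarily close to [p]; continuity of both at [p] concludes. *)
Lemma derive_comm U (f : R * R -> R) p (i j : 'I_2) : open U -> Ck 2 U f -> U p ->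
  'D_(e R i) (fun q => 'D_(e R j) f q) p = 'D_(e R j) (fun q => 'D_(e R i) f q) p.
Proof.
move=> oU F Up; apply/eqP; rewrite -subr_eq0 -normr_le0 leNgt; apply/negP.
set A := 'D_(e R i) _ _; set B := 'D_(e R j) _ _ => AB.
have d0 : 0 < `|A - B| / 2 by rewrite divr_gt0.
have [r1 r10 H1] := Ck_continuous_near d0 (Ck_cont (Ck_deriv i (Ck_deriv j F)) Up).
have [r2 r20 H2] := Ck_continuous_near d0 (Ck_cont (Ck_deriv j (Ck_deriv i F)) Up).
have [r3 r30 H3] := open_square oU Up.
(* The sampled points are within [2 h] of [p], which is less than each of the three radii. *)
pose h := Num.min r1 (Num.min r2 r3) / 3.
have m0 : 0 < Num.min r1 (Num.min r2 r3) by rewrite !lt_min r10 r20.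
have h0 : 0 < h by rewrite divr_gt0.
have near s t (k l : 'I_2) : 0 <= s <= h -> 0 <= t <= h ->
    `|p + s *: e R k + t *: e R l - p| < Num.min r1 (Num.min r2 r3).
  move=> /andP[s0 sh] /andP[t0 th].
  have -> : p + s *: e R k + t *: e R l - p = s *: e R k + t *: e R l.
    by rewrite addrAC [p + _]addrC addrK.
  apply: le_lt_trans (ler_normD _ _) _; rewrite !normrZ !ger0_norm //.
  have := ler_wpM2l s0 (norm_e_le R k); have := ler_wpM2l t0 (norm_e_le R l).
  rewrite !mulr1; move: sh th h0; rewrite /h; set m := Num.min _ _ => *; lra.
have nU q : `|q - p| < Num.min r1 (Num.min r2 r3) -> [/\ `|q - p| < r1, `|q - p| < r2 & U q].
  by rewrite !lt_min => /and3P[h1 h2 h3]; split=> //; exact: H3.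
have D (k l : 'I_2) s t : 0 <= s <= h -> 0 <= t <= h ->
    let q := p + s *: e R k + t *: e R l in
    derivable f q (e R k) /\ derivable (fun z => 'D_(e R k) f z) q (e R l).
  move=> sI tI q; have [_ _ Uq] := nU _ (near s t k l sI tI); split.
    by case: (Ck_is_derive k F Uq).
  by case: (Ck_is_derive l (Ck_deriv k F) Uq).
have [s [t [sI tI E1]]] := second_difference h0 (D j i).
have [s' [t' [sI' tI' E2]]] := second_difference h0 (D i j).
have W x : 0 < x < h -> 0 <= x <= h by move=> /andP[? ?]; rewrite !ltW.
have [n1 _ _] := nU _ (near _ _ j i (W _ sI) (W _ tI)).
have [_ n2 _] := nU _ (near _ _ i j (W _ sI') (W _ tI')).
have c1 := H1 _ n1; have c2 := H2 _ n2.
have hn : h != 0 by rewrite gt_eqF.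
have sw : p + h *: e R j + h *: e R i = p + h *: e R i + h *: e R j by rewrite addrAC.
rewrite sw in E1.
move: E1 E2 c1 c2; rewrite -/A -/B.
move: ('D_(e R i) (fun z => 'D_(e R j) f z) _) ('D_(e R j) (fun z => 'D_(e R i) f z) _).
move: (f (p + h *: e R j)) (f (p + h *: e R i)) (f p) (f _) AB {d0 H1 H2}.
move: A B => A B u1 u2 u3 u4 AB X Y E1 E2 c1 c2.
have XY : X = Y.
  by apply: (mulIf hn); apply: (mulIf hn); rewrite -E1 -E2; ring.
rewrite XY in c1.
have : `|A - B| <= `|Y - B| + `|Y - A|.
  have -> : A - B = (Y - B) - (Y - A) by ring.
  exact: ler_normB.
by lra.
Qed.

End SmoothFunctions.

(** Locked, so that the limit behind a partial derivative is not unfolded in iterated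
    derivatives. *)
HB.lock Definition pd (R : realType) (W : normedModType R) (i : 'I_2)
  (f : R * R -> W) (p : R * R) : W := 'D_(e R i) f p.

Section PartialDerivatives.
Variable R : realType.
Implicit Types (U : set (R * R)) (p : R * R).

Lemma pdE (W : normedModType R) i (f : R * R -> W) p : 'D_(e R i) f p = pd i f p.
Proof. by rewrite pd.unlock. Qed.

Lemma pd_fun (W : normedModType R) i (f : R * R -> W) : (fun p => 'D_(e R i) f p) = pd i f.
Proof. by apply/funext => p; rewrite pdE. Qed.

Lemma is_derive_pd (W : normedModType R) i (f : R * R -> W) p a :
  is_derive p (e R i) f a -> pd i f p = a.
Proof. by move=> [_ <-]; rewrite pdE. Qed.

Lemma Ck_pd (W : normedModType R) k U (f : R * R -> W) i : Ck k.+1 U f -> Ck k U (pd i f).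
Proof. by move=> /(Ck_deriv i); rewrite pd_fun. Qed.

Lemma smooth_pd (W : normedModType R) U (f : R * R -> W) i : smooth U f -> smooth U (pd i f).
Proof. by move=> F k; exact: Ck_pd (F k.+1). Qed.

Lemma Ck_is_pd (W : normedModType R) k U (f : R * R -> W) i p :
  Ck k.+1 U f -> U p -> is_derive p (e R i) f (pd i f p).
Proof. by rewrite -pdE; exact: Ck_is_derive. Qed.

Lemma smooth_is_pd (W : normedModType R) U (f : R * R -> W) i p :
  smooth U f -> U p -> is_derive p (e R i) f (pd i f p).
Proof. by move=> F; exact: Ck_is_pd (F 1). Qed.

Lemma pd_comm U (f : R * R -> R) p i j : open U -> Ck 2 U f -> U p ->
  pd i (pd j f) p = pd j (pd i f) p.
Proof. by move=> oU F Up; rewrite -!pd_fun; exact: (derive_comm i j oU F Up). Qed.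

Lemma I2_ind (P : 'I_2 -> Prop) : P 0 -> P 1 -> forall i, P i.
Proof.
move=> P0 P1 -[[|[|//]] i2].
  by have -> : Ordinal i2 = 0 by exact: val_inj.
by have -> : Ordinal i2 = 1 by exact: val_inj.
Qed.

(** Serves to differentiate an identity that holds on an open set only. The structure equations of
    the surface arise in this way from orthogonality relations. *)
Lemma is_derive_local (V W : normedModType R) (A : set V) (f g : V -> W) (p v : V) a b :
  open A -> A p -> (forall q, A q -> f q = g q) ->
  is_derive p v f a -> is_derive p v g b -> a = b.
Proof.
move=> oA Ap fg [_ <-] [_ <-]; apply: near_eq_derive.
by apply: filterS (open_nbhs_nbhs (conj oA Ap)) => q /fg.
Qed.

Lemma pd_local (W : normedModType R) U (f g : R * R -> W) p i :
  open U -> U p -> (forall q, U q -> f q = g q) -> pd i f p = pd i g p.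
Proof.
move=> oU Up fg; rewrite -!pdE; apply: near_eq_derive.
by apply: filterS (open_nbhs_nbhs (conj oU Up)) => q /fg.
Qed.

Lemma pd_coord m k U (f : R * R -> 'rV[R]_m) p i j : Ck k.+1 U f -> U p ->
  (pd i f p) 0 j = pd i (fun q => f q 0 j) p.
Proof.
by move=> F Up; have /is_derive_coord/(_ j)/is_derive_pd := Ck_is_pd i F Up.
Qed.

Lemma pd_comm_vec U m (f : R * R -> 'rV[R]_m) p i j : open U ->
  Ck 2 U f -> U p -> pd i (pd j f) p = pd j (pd i f) p.
Proof.
move=> oU F Up; have Fc l : Ck 2 U (fun q => f q 0 l) by move: F => /(Ck_coord 2 f oU).
have E a b l : pd a (pd b f) p 0 l = pd a (pd b (fun z => f z 0 l)) p.
  rewrite (pd_coord a l (Ck_pd b F) Up); apply: pd_local oU Up _ => q Uq.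
  exact: pd_coord F Uq.
apply/rowP => l; apply: etrans (E i j l) (etrans _ (esym (E j i l))).
exact: pd_comm oU (Fc l) Up.
Qed.

End PartialDerivatives.

(** * Conformal surfaces *)

Section EuclideanAlgebra.
Variable R : realType.
Implicit Types (u v w : 'rV[R]_3).

Lemma sum2E (V : nmodType) (F : 'I_2 -> V) : \sum_i F i = F 0 + F 1.
Proof.
rewrite !big_ord_recl big_ord0 addr0; congr (F _ + F _); exact: val_inj.
Qed.

Lemma dotE u v : dot u v = u 0 0 * v 0 0 + u 0 1 * v 0 1 + u 0 2%:R * v 0 2%:R.
Proof.
rewrite /dot !big_ord_recl big_ord0 addr0 addrA.
by congr (u _ _ * v _ _ + u _ _ * v _ _ + u _ _ * v _ _); exact: val_inj.
Qed.

Lemma cross_coord u v (j : 'I_3) :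
  cross u v 0 j = u 0 (j + 1) * v 0 (j + 2%:R) - u 0 (j + 2%:R) * v 0 (j + 1).
Proof. by rewrite mxE. Qed.

Lemma crossE u v :
  [/\ cross u v 0 0 = u 0 1 * v 0 2%:R - u 0 2%:R * v 0 1,
      cross u v 0 1 = u 0 2%:R * v 0 0 - u 0 0 * v 0 2%:R &
      cross u v 0 2%:R = u 0 0 * v 0 1 - u 0 1 * v 0 0].
Proof.
split; rewrite /cross !mxE;
  by congr (u _ _ * v _ _ - u _ _ * v _ _); exact: val_inj.
Qed.

Lemma dotC u v : dot u v = dot v u.
Proof. by rewrite !dotE; ring. Qed.

Lemma dotDl u v w : dot (u + v) w = dot u w + dot v w.
Proof. by rewrite !dotE !mxE; ring. Qed.

Lemma dotZl (a : R) u v : dot (a *: u) v = a * dot u v.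
Proof. by rewrite !dotE !mxE; ring. Qed.

Lemma dotNl u v : dot (- u) v = - dot u v.
Proof. by rewrite !dotE !mxE; ring. Qed.

Lemma dotBl u v w : dot (u - v) w = dot u w - dot v w.
Proof. by rewrite dotDl dotNl. Qed.

Lemma dotDr u v w : dot w (u + v) = dot w u + dot w v.
Proof. by rewrite dotC dotDl !(dotC w). Qed.

Lemma dotZr (a : R) u v : dot v (a *: u) = a * dot v u.
Proof. by rewrite dotC dotZl dotC. Qed.

Lemma dotNr u v : dot v (- u) = - dot v u.
Proof. by rewrite dotC dotNl dotC. Qed.

Lemma dotBr u v w : dot w (u - v) = dot w u - dot w v.
Proof. by rewrite dotDr dotNr. Qed.

Lemma dot0l u : dot 0 u = 0.
Proof. by rewrite dotE !mxE; ring. Qed.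

Lemma dot0r u : dot u 0 = 0.
Proof. by rewrite dotC dot0l. Qed.

Definition dot_lin := (dotDl, dotDr, dotBl, dotBr, dotZl, dotZr, dotNl, dotNr, dot0l, dot0r).

Lemma dot_ge0 u : 0 <= dot u u.
Proof. by rewrite dotE -!expr2; rewrite !addr_ge0 ?sqr_ge0. Qed.

Lemma rV3_eq0 u : u 0 0 = 0 -> u 0 1 = 0 -> u 0 2%:R = 0 -> u = 0.
Proof.
move=> u0 u1 u2; apply/rowP => -[[|[|[|//]]] i3]; rewrite !mxE.
- by rewrite -[RHS]u0; congr (u _ _); exact: val_inj.
- by rewrite -[RHS]u1; congr (u _ _); exact: val_inj.
- by rewrite -[RHS]u2; congr (u _ _); exact: val_inj.
Qed.

Lemma dot_eq0 u : (dot u u == 0) = (u == 0).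
Proof.
apply/eqP/eqP => [|->]; last by rewrite dot0l.
rewrite dotE -!expr2 => /eqP; rewrite !paddr_eq0 ?addr_ge0 ?sqr_ge0 // !sqrf_eq0.
by move=> /andP[/andP[/eqP h0 /eqP h1] /eqP h2]; exact: rV3_eq0.
Qed.

Lemma dot_gt0 u : (0 < dot u u) = (u != 0).
Proof. by rewrite lt_neqAle dot_ge0 andbT eq_sym dot_eq0. Qed.

Lemma coord_norm_le m (u : 'rV[R]_m) i : `|u 0 i| <= `|u|.
Proof.
by rewrite [leRHS]/Num.Def.normr/= mx_normrE; exact: (le_bigmax _ (fun ij => `|u ij.1 ij.2|) (0, i)).
Qed.

Lemma norm_dot_le u v : `|dot u v| <= 3 * (`|u| * `|v|).
Proof.
have H i : `|u 0 i * v 0 i| <= `|u| * `|v|.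
  by rewrite normrM ler_pM ?coord_norm_le.
rewrite dotE; apply: le_trans (ler_normD _ _) _.
have := ler_normD (u 0 0 * v 0 0) (u 0 1 * v 0 1).
have := H 0; have := H 1; have := H 2%:R; lra.
Qed.

Lemma norm_le_coord u (c : R) : 0 <= c -> (forall i, `|u 0 i| <= c) -> `|u| <= c.
Proof.
move=> c0 H; rewrite [leLHS]/Num.Def.normr/= mx_normrE.
by apply: bigmax_le => // -[i j] _ /=; rewrite (ord1 i).
Qed.

Lemma sqr_norm_le_dot u : `|u| ^+ 2 <= dot u u.
Proof.
have H i : `|u 0 i| <= Num.sqrt (dot u u).
  have P := dot_ge0 u.
  rewrite -(ler_pXn2r (_ : (0 < 2)%N)) ?nnegrE ?sqrtr_ge0 //.
  rewrite sqr_sqrtr // real_normK ?num_real // /dot (bigD1 i) //= -expr2 lerDl.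
  by apply: sumr_ge0 => j _; rewrite -expr2 sqr_ge0.
have := norm_le_coord (sqrtr_ge0 _) H.
by rewrite -(ler_pXn2r (_ : (0 < 2)%N)) ?nnegrE ?sqrtr_ge0 // sqr_sqrtr // dot_ge0.
Qed.

Lemma dot_le_sqr_norm u : dot u u <= 3 * `|u| ^+ 2.
Proof. by rewrite expr2; apply: le_trans (norm_dot_le u u); exact: ler_norm. Qed.

Lemma cross_dotl u v : dot (cross u v) u = 0.
Proof. by rewrite dotE; have [-> -> ->] := crossE u v; ring. Qed.

Lemma cross_dotr u v : dot (cross u v) v = 0.
Proof. by rewrite dotE; have [-> -> ->] := crossE u v; ring. Qed.

Lemma cross_dot u v : dot (cross u v) (cross u v) = dot u u * dot v v - dot u v ^+ 2.
Proof. by rewrite !dotE; have [-> -> ->] := crossE u v; ring. Qed.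

Definition conformal_frame (X1 X2 n : 'rV[R]_3) (l : R) : Prop :=
  [/\ 0 < l, dot X1 X1 = l, dot X2 X2 = l & dot X1 X2 = 0] /\
  [/\ dot n n = 1, dot n X1 = 0 & dot n X2 = 0].

(** The matrix [M] with rows [X1], [X2], [n] satisfies [M M^T = diag(l, l, 1)]. A one-sided inverse
    of a square matrix is two-sided, so [M^T diag(1/l, 1/l, 1) M = 1], which is the
    decomposition. *)
Lemma frame_decomp X1 X2 n l v : conformal_frame X1 X2 n l ->
  v = (dot v X1 / l) *: X1 + (dot v X2 / l) *: X2 + dot v n *: n.
Proof.
move=> [[l0 h11 h22 h12] [hnn hn1 hn2]].
pose M : 'M[R]_3 := \matrix_(i, j) (if i == 0 then X1 0 j else if i == 1 then X2 0 j else n 0 j).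
pose d : 'rV[R]_3 := \row_i (if i == 2%:R then 1 else l).
have ln : l != 0 by rewrite gt_eqF.
have dotM (u w : 'rV[R]_3) : \sum_j u 0 j * w 0 j = dot u w by [].
have MM : M *m M^T = diag_mx d.
  apply/matrixP => i j; rewrite !mxE; under eq_bigr do rewrite !mxE.
  case: i => [[|[|[|//]]] i3]; case: j => [[|[|[|//]]] j3]; rewrite /= ?dotM ?mulr1n ?mulr0n;
    first [done|by rewrite dotC].
pose d' : 'rV[R]_3 := \row_i (d 0 i)^-1.
have dd : diag_mx d' *m diag_mx d = 1%:M.
  rewrite mulmx_diag; apply/matrixP => i j; rewrite !mxE.
  have [_|_] := eqVneq i j; last by rewrite !mulr0n.
  by rewrite mulVf //; case: ifP => // _; exact: oner_neq0.
have I1 : (diag_mx d' *m M) *m M^T = 1%:M by rewrite -mulmxA MM dd.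
have I2 := mulmx1C I1.
have /rowP E : v = (v *m M^T) *m (diag_mx d' *m M) by rewrite -mulmxA I2 mulmx1.
have vM i : (v *m M^T) 0 i = if i == 0 then dot v X1 else if i == 1 then dot v X2 else dot v n.
  rewrite mxE; under eq_bigr do rewrite !mxE.
  by case: i => [[|[|[|//]]] i3] /=; rewrite dotM.
apply/rowP => j; rewrite E !mxE !big_ord_recl big_ord0 !vM !mul_diag_mx !mxE /=.
by rewrite invr1; ring.
Qed.

Lemma frame_ext X1 X2 n l v w : conformal_frame X1 X2 n l ->
  dot v X1 = dot w X1 -> dot v X2 = dot w X2 -> dot v n = dot w n -> v = w.
Proof.
by move=> F h1 h2 h3; rewrite (frame_decomp v F) h1 h2 h3 -(frame_decomp w F).
Qed.

End EuclideanAlgebra.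
Lemma det2E (R : realType) (A : 'M[R]_2) : \det A = A 0 0 * A 1 1 - A 0 1 * A 1 0.
Proof.
rewrite (expand_det_row _ 0) sum2E /cofactor !det_mx11 !mxE /= expr0 expr1 mul1r mulN1r mulrN.
by congr (_ * A _ _ - _ * A _ _); exact: val_inj.
Qed.

Opaque dot cross.

(** Locked so that the normal is handled through its frame relations and not through the cross
    product. *)
HB.lock Definition gauss (R : realType) (Z : R * R -> 'rV[R]_3) p : 'rV[R]_3 := gauss_map Z p.

Lemma gauss_fun (R : realType) (Z : R * R -> 'rV[R]_3) : gauss_map Z = gauss Z.
Proof. by apply/funext => p; rewrite gauss.unlock. Qed.

(** * Structure equations of a conformal, and of a minimal, immersion *)

Section ConformalSurfaces.
Variable R : realType.
Variables (U : set (R * R)) (Z : R * R -> 'rV[R]_3).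
Hypotheses (oU : open U) (cZ : conformal_immersion U Z).
Local Notation N := (gauss Z).

Lemma pdotE (i j : 'I_2) : pdot (e R i) (e R j) = (i == j)%:R.
Proof.
rewrite /pdot /e /=; case: i => [[|[|//]] i2]; case: j => [[|[|//]] j2] /=;
  by rewrite ?mulr0 ?mulr1 ?addr0 ?add0r.
Qed.
Opaque e.

Definition confactor p : R := dot (pd 0 Z p) (pd 0 Z p).

Lemma conformal_dot p : U p -> 0 < confactor p /\
  forall i j, dot (pd i Z p) (pd j Z p) = confactor p *+ (i == j).
Proof.
move=> Up; have [l l0 H] := cZ.2 p Up; rewrite /confactor.
have E i j : dot (pd i Z p) (pd j Z p) = l *+ (i == j).
  by have := H (e R i) (e R j); rewrite /first_form pdotE mulr_natr !pdE.
by rewrite (E 0 0) mulr1n; split=> // i j; exact: E.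
Qed.

(** By Lagrange's identity the cross product of two orthogonal vectors of squared length [l] has
    length [l]. *)
Lemma gauss_mapE p : U p ->
  N p = (confactor p)^-1 *: cross (pd 0 Z p) (pd 1 Z p).
Proof.
move=> Up; rewrite gauss.unlock /gauss_map /enorm !pdE cross_dot; congr (_^-1 *: _).
have [l0 H] := conformal_dot Up.
by rewrite !H /= !mulr1n mulr0n expr0n subr0 -expr2 sqrtr_sqr gtr0_norm.
Qed.

Lemma gauss_frame p : U p ->
  conformal_frame (pd 0 Z p) (pd 1 Z p) (N p) (confactor p).
Proof.
move=> Up; have [l0 H] := conformal_dot Up.
have ln : confactor p != 0 by rewrite gt_eqF.
split; first by split; rewrite // H ?mulr1n ?mulr0n.
rewrite gauss_mapE // !dot_lin cross_dotl cross_dotr !mulr0; split=> //.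
by rewrite cross_dot !H /= !mulr1n mulr0n; field.
Qed.

Lemma gauss_dot0 p i : U p -> dot (N p) (pd i Z p) = 0.
Proof.
by move=> /gauss_frame[_ [_ h0 h1]]; elim/I2_ind: i.
Qed.

Lemma gauss_unit p : U p -> dot (N p) (N p) = 1.
Proof. by move=> /gauss_frame[_ []]. Qed.

Lemma tangent_ext p v w : U p ->
  (forall i, dot v (pd i Z p) = dot w (pd i Z p)) ->
  dot v (N p) = dot w (N p) -> v = w.
Proof. by move=> Up H; exact: frame_ext (gauss_frame Up) (H 0) (H 1). Qed.

Let sZ : smooth U Z := cZ.1.

Lemma smooth_confactor : smooth U confactor.
Proof. by move=> k; apply: Ck_dot => //; exact: smooth_pd. Qed.

Lemma confactor_neq0 p : U p -> confactor p != 0.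
Proof. by move=> /conformal_dot[/gt_eqF ->]. Qed.

Lemma smooth_gauss : smooth U N.
Proof.
move=> k; apply: (@Ck_ext _ _ _ _
   (fun p => (confactor p)^-1 *: cross (pd 0 Z p) (pd 1 Z p))) => //.
  by move=> p Up; rewrite gauss_mapE.
apply: CkZ => //; first by apply: CkV => //; [exact: confactor_neq0|exact: smooth_confactor].
have C i j : Ck k U (fun p => (pd i Z p) 0 j).
  by have /Ck_coord -/(_ oU) := smooth_pd i sZ k; exact.
apply/Ck_coord => // j; apply: (@Ck_ext _ _ _ _ (fun p =>
  pd 0 Z p 0 (j + 1) * pd 1 Z p 0 (j + 2%:R) -
  pd 0 Z p 0 (j + 2%:R) * pd 1 Z p 0 (j + 1))) => //.
  by move=> p Up; rewrite cross_coord.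
by apply: CkB => //; exact: CkM.
Qed.

Lemma dZ_is_derive i p : U p -> is_derive p (e R i) Z (pd i Z p).
Proof. exact: smooth_is_pd. Qed.

Lemma ddZ_is_derive i j p : U p ->
  is_derive p (e R i) (pd j Z) (pd i (pd j Z) p).
Proof. by move=> Up; apply: smooth_is_pd Up; exact: smooth_pd. Qed.

Lemma dN_is_derive i p : U p -> is_derive p (e R i) N (pd i N p).
Proof. exact: smooth_is_pd smooth_gauss. Qed.

Lemma ddZC i j p : U p -> pd i (pd j Z) p = pd j (pd i Z) p.
Proof. by move=> Up; apply: pd_comm_vec => //. Qed.

Lemma dgauss_normal i p : U p -> dot (pd i N p) (N p) = 0.
Proof.
move=> Up; have := is_derive_local oU Up gauss_unit
  (is_derive_dot (dN_is_derive i Up) (dN_is_derive i Up)) (is_derive_cst0 (1 : R) p (e R i)).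
by rewrite [X in _ + X]dotC -mulr2n => /eqP; rewrite mulrn_eq0 => /eqP.
Qed.

(** Obtained by differentiating [N . d_j Z = 0]. Symmetry of second derivatives then makes [dN . dZ]
    a symmetric form. *)
Lemma dgauss_dot i j p : U p ->
  dot (pd i N p) (pd j Z p) = - dot (N p) (pd i (pd j Z) p).
Proof.
move=> Up; have := is_derive_local oU Up (fun q => @gauss_dot0 q j)
  (is_derive_dot (dN_is_derive i Up) (ddZ_is_derive i j Up)) (is_derive_cst0 (0 : R) p (e R i)).
by move/eqP; rewrite addr_eq0 => /eqP.
Qed.

Lemma dgauss_dotC i j p : U p ->
  dot (pd i N p) (pd j Z p) = dot (pd j N p) (pd i Z p).
Proof. by move=> Up; rewrite !dgauss_dot // ddZC. Qed.

Lemma dconfactor i j k p : U p ->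
  dot (pd k (pd i Z) p) (pd j Z p) + dot (pd i Z p) (pd k (pd j Z) p)
  = pd k confactor p *+ (i == j).
Proof.
move=> Up; apply: (is_derive_local oU Up (fun q Uq => (conformal_dot Uq).2 i j)
   (is_derive_dot (ddZ_is_derive k i Up) (ddZ_is_derive k j Up))).
have [_|_] := eqVneq i j; last exact: is_derive_cst0.
exact: smooth_is_pd smooth_confactor Up.
Qed.

Lemma gIE p : U p -> gI Z p = (confactor p)%:M.
Proof.
by move=> Up; apply/matrixP => i j; rewrite !mxE /first_form !pdE (conformal_dot Up).2.
Qed.

Lemma invgIE p : U p -> invmx (gI Z p) = ((confactor p)^-1)%:M.
Proof. by move=> Up; rewrite gIE // invmx_scalar. Qed.

Lemma gradE f p : U p -> grad Z f p =
  (confactor p)^-1 *: (pd 0 f p *: pd 0 Z p + pd 1 f p *: pd 1 Z p).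
Proof.
move=> Up; rewrite /grad invgIE // !sum2E !pdE !mxE /= !mulr1n !mulr0n.
by rewrite !mul0r addr0 add0r scalerDr !scalerA.
Qed.

Lemma grad_dot f i p : U p -> dot (grad Z f p) (pd i Z p) = pd i f p.
Proof.
move=> Up; have ln := confactor_neq0 Up; have [_ H] := conformal_dot Up.
rewrite gradE // !dot_lin !H; elim/I2_ind: i; by rewrite /= mulr1n mulr0n; field.
Qed.

Lemma grad_normal f p : U p -> dot (grad Z f p) (N p) = 0.
Proof.
move=> Up; rewrite gradE // !dot_lin !(dotC (pd _ Z p)) !gauss_dot0 //; ring.
Qed.

Lemma smooth_grad f : smooth U f -> smooth U (grad Z f).
Proof.
move=> sf k; apply: (@Ck_ext _ _ _ _ (fun p => (confactor p)^-1 *: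
  (pd 0 f p *: pd 0 Z p + pd 1 f p *: pd 1 Z p))) => //.
  by move=> p Up; rewrite gradE.
apply: CkZ => //; first by apply: CkV => //; [exact: confactor_neq0|exact: smooth_confactor].
by apply: CkD => //; apply: CkZ => //; exact: smooth_pd.
Qed.

(** With [g_ij = d_i Z . d_j Z] the three derivatives of the metric give six terms, four of which
    cancel; the other two are both [d_i d_j Z . d_k Z]. *)
Lemma christoffelE p k i j : U p ->
  christoffel Z p k i j = dot (pd i (pd j Z) p) (pd k Z p) / confactor p.
Proof.
move=> Up; have ln := confactor_neq0 Up.
have D (a b l : 'I_2) : 'D_(e R l) (fun q => gI Z q a b) p =
    dot (pd l (pd a Z) p) (pd b Z p) + dot (pd a Z p) (pd l (pd b Z) p).
  rewrite (_ : (fun q => gI Z q a b) = fun q => dot (pd a Z q) (pd b Z q)); last first.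
    by apply/funext => q; rewrite mxE /first_form !pdE.
  by have [_ ->] := is_derive_dot (ddZ_is_derive l a Up) (ddZ_is_derive l b Up).
rewrite /christoffel invgIE // (bigD1 k) //= big1 ?addr0 => [|l lk]; last first.
  by rewrite mxE eq_sym (negbTE lk) mulr0n mul0r.
rewrite mxE eqxx mulr1n !D (ddZC k j Up) (ddZC k i Up) (ddZC j i Up).
by rewrite (dotC (pd j Z p)) (dotC (pd i Z p)) -?[dot (pd k Z p) _]dotC; field.
Qed.

(** Differentiating [grad f . d_j Z = d_j f] leaves the extra term [grad f . d_i d_j Z], which is
    the Christoffel correction because [grad f] is tangent. The intrinsic Hessian thus becomes a
    derivative taken in the ambient space. *)
Lemma hessE f p i j : smooth U f -> U p ->
  hess Z f p i j = dot (pd i (grad Z f) p) (pd j Z p).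
Proof.
move=> sf Up; rewrite /hess mxE pdE pd_fun.
have := is_derive_local oU Up (fun q Uq => @grad_dot f j q Uq)
  (is_derive_dot (smooth_is_pd i (smooth_grad sf) Up) (ddZ_is_derive i j Up))
  (smooth_is_pd i (smooth_pd j sf) Up).
move=> <-; rewrite gradE // sum2E !pdE !christoffelE // !dot_lin.
by rewrite !(dotC _ (pd i (pd j Z) p)); ring.
Qed.

Hypothesis mZ : forall p, U p -> mean_curvature Z p = 0.

Lemma minimal_trace p : U p ->
  dot (pd 0 N p) (pd 0 Z p) + dot (pd 1 N p) (pd 1 Z p) = 0.
Proof.
move=> Up; have := mZ Up; have ln := confactor_neq0 Up.
rewrite /mean_curvature invgIE // mul_scalar_mx /mxtrace sum2E !mxE /second_form gauss_fun !pdE.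
rewrite !(dotC (pd _ Z p)) => /eqP.
rewrite mulf_eq0 invr_eq0 pnatr_eq0 /= -mulrDr mulf_eq0 invr_eq0 (negbTE ln) /=.
by rewrite -opprD oppr_eq0 => /eqP.
Qed.

(** The normal component of the Laplacian is the trace of the second form. The tangential components
    vanish by the derivatives of [|d_0 Z|^2 = |d_1 Z|^2] and [d_0 Z . d_1 Z = 0]. *)
Lemma minimal_harmonic p : U p ->
  pd 0 (pd 0 Z) p + pd 1 (pd 1 Z) p = 0.
Proof.
move=> Up; apply: (tangent_ext Up) => [j|]; last first.
  rewrite dotDl dot0l !(dotC _ (N p)).
  by have := minimal_trace Up; rewrite !dgauss_dot // => h; lra.
have H k : dot (pd k (pd 0 Z) p) (pd 0 Z p) =
           dot (pd k (pd 1 Z) p) (pd 1 Z p).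
  have := dconfactor 0 0 k Up; have := dconfactor 1 1 k Up.
  rewrite !(dotC (pd _ Z p)) eqxx; lra.
have H' k : dot (pd k (pd 0 Z) p) (pd 1 Z p) =
          - dot (pd k (pd 1 Z) p) (pd 0 Z p).
  have := dconfactor 0 1 k Up; rewrite /= mulr0n (dotC (pd 0 Z p)); lra.
rewrite dotDl dot0l; elim/I2_ind: j.
  have := H 0; have := H' 1; rewrite (ddZC 1 0 Up); lra.
have := H' 0; have := H 1; rewrite (ddZC 1 0 Up); lra.
Qed.

End ConformalSurfaces.

(** * The Ribaucour system *)

Section RibaucourSystem.
Variable R : realType.
Implicit Types (U : set (R * R)) (Z Zt : R * R -> 'rV[R]_3).

Lemma pdot_continuous : continuous (fun p : R * R => pdot p p).
Proof.
move=> p; rewrite /pdot; apply: cvgD; apply: cvgM;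
  by [exact: cvg_fst|exact: cvg_snd].
Qed.

Lemma disk_open (r : R) : open (disk r).
Proof.
have -> : disk r = (fun p : R * R => pdot p p) @^-1` [set t | t < r ^+ 2] by [].
apply: open_comp; last exact: open_lt.
by move=> p _; exact: pdot_continuous.
Qed.

Lemma pdisk_open (r : R) : open (pdisk r).
Proof.
rewrite /pdisk setDE; apply: openI; first exact: disk_open.
rewrite openC; apply: accessible_closed_set1; apply: hausdorff_accessible.
exact: norm_hausdorff.
Qed.

Lemma pdiskP (r : R) p : pdisk r p <-> disk r p /\ p != 0.
Proof. by split=> [[h /eqP k]|[h /eqP k]]. Qed.

Lemma small_disk (r : R) (p : R * R) : 0 < r -> `|p| < r / 2 -> disk r p.
Proof.
move=> r0; rewrite normp_lt /disk /= /pdot !ltr_norml => /andP[/andP[h1 h2] /andP[h3 h4]].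
nra.
Qed.

Definition ribaucour_system U Z Zt (c : R) (W : R * R -> 'rV[R]_3) (rho phi : R * R -> R) :=
  c != 0 /\ forall p, U p ->
  [/\ rho p != 0, phi p != 0, dot (W p) (W p) = 2 * c * rho p * phi p,
      Zt p = Z p - (c * rho p)^-1 *: W p &
      gauss_map Zt p = gauss Z p - (c * phi p)^-1 *: W p] /\
  forall i,
    [/\ is_derive p (e R i) W
          (c *: (rho p *: pd i Z p + phi p *: pd i (gauss Z) p)),
        is_derive p (e R i) rho (dot (W p) (pd i (gauss Z) p)) &
        is_derive p (e R i) phi (dot (W p) (pd i Z p))].

(** The tangential part of [dW] is the Hessian of [phi] plus [rho dN]; in the Hessian equation the
    term [rho II] equals [- rho dZ.dN] and cancels the latter, leaving [c rho dZ + c phi dN]. The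
    normal part is [d rho - grad phi . dN], which is zero. *)
Lemma ribaucour_data_system U Z Zt tau : open U -> conformal_immersion U Z ->
  ribaucour_data U Z Zt tau -> exists c W rho phi, ribaucour_system U Z Zt c W rho phi.
Proof.
move=> oU cZ [c [rho [phi [c0 srho sphi H]]]].
exists c, (fun p => grad Z phi p + rho p *: gauss Z p), rho, phi; split=> // p Up.
have [[r0 p0 _] [drho hs gg eZ eN]] := H p Up.
rewrite gauss_fun in drho eZ eN *.
have gn := grad_normal cZ phi Up.
have nn := gauss_unit cZ Up.
split.
  split=> //; rewrite !dot_lin gg nn (dotC (gauss Z p)) gn; ring.
move=> i.
have drho' : is_derive p (e R i) rho (dot (grad Z phi p) (pd i (gauss Z) p)).
  by rewrite -pdE -drho pdE; exact: smooth_is_pd.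
have dN := dN_is_derive oU cZ i Up.
have dg := smooth_is_pd i (smooth_grad oU cZ sphi) Up.
have dNn : dot (gauss Z p) (pd i (gauss Z) p) = 0.
  by rewrite dotC; exact: (dgauss_normal oU cZ).
split; last 1 first.
- rewrite dotDl dotZl (gauss_dot0 cZ) // mulr0 addr0 (grad_dot cZ) //.
  exact: smooth_is_pd.
- apply: is_derive_eq (is_derive_addf dg (is_derive_scalef drho' dN)) _.
  apply: (tangent_ext cZ Up) => [j|]; last first.
    have := is_derive_local oU Up (fun q => @grad_normal _ _ _ cZ phi q)
      (is_derive_dot dg dN) (is_derive_cst0 (0 : R) p (e R i)).
    rewrite !dot_lin nn (dgauss_normal oU cZ) // (dotC (pd i Z p)) (gauss_dot0 cZ) //.
    by lra.
  have := hessE oU cZ i j sphi Up; rewrite hs !mxE /first_form /second_form gauss_fun !pdE.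
  rewrite !dot_lin (gauss_dot0 cZ) // => <-.
  rewrite (dotC (pd i Z p) (pd j (gauss Z) p)) (dgauss_dotC oU cZ j i) //.
  by ring.
- by rewrite dotDl dotZl dNn mulr0 addr0.
Qed.

End RibaucourSystem.

(** * Orders of growth at a puncture *)

Section PuncturedOrder.
Variable R : realType.
Implicit Types (W V : normedModType R) (p q : R * R).

Local Notation o := (0 : R * R).

Lemma dnbhs0P (P : R * R -> Prop) : (\forall p \near o^', P p) <->
  exists2 r : R, 0 < r & forall p, p != 0 -> `|p| < r -> P p.
Proof.
split=> [/nbhs_ballP[r /= r0 H]|[r r0 H]].
  by exists r => // p p0 pr; apply: H => //; rewrite -ball_normE /= sub0r normrN.
apply/nbhs_ballP; exists r => //= p; rewrite -ball_normE /= sub0r normrN => pr p0.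
exact: H.
Qed.

Lemma near_dnbhs0 (P : R * R -> Prop) : (\forall p \near o, P p) -> \forall p \near o^', P p.
Proof. by move=> H; apply: nbhs_dnbhs. Qed.

Lemma dnbhs0_normlt (r : R) : 0 < r -> \forall p \near o^', `|p| < r.
Proof. by move=> r0; apply/dnbhs0P; exists r. Qed.

Lemma dnbhs0_neq : \forall p \near o^', p != 0.
Proof. by apply/dnbhs0P; exists 1. Qed.

Lemma dnbhs0_normlt1 : \forall p \near o^', `|p| <= 1.
Proof. by apply/dnbhs0P; exists 1 => // p _ /ltW. Qed.

Lemma dnbhs0_ex (P : R * R -> Prop) : (\forall p \near o^', P p) -> exists2 p, p != 0 & P p.
Proof.
move=> /dnbhs0P[r r0 H].
have z0 : ((r / 2, 0) : R * R) != 0 by apply/eqP => -[]/eqP; rewrite mulf_eq0 invr_eq0 pnatr_eq0 gt_eqF.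
exists (r / 2, 0) => //; apply: H => //.
by rewrite normp_lt /= normr0 r0 andbT gtr0_norm ?divr_gt0 // half_lt.
Qed.

Global Instance dnbhs0_proper : ProperFilter o^'.
Proof.
by split=> [|]; [move=> /dnbhs0_ex[]|exact: dnbhs_filter].
Qed.

(* Landau's [f p = O(|p|^m)] as [p] tends to [0] in the punctured plane *)
Definition ordO W (m : nat) (f : R * R -> W) : Prop :=
  exists C : R, \forall p \near o^', `|f p| <= C * `|p| ^+ m.

Lemma ordOP W m (f : R * R -> W) : ordO m f ->
  exists2 C : R, 0 <= C & \forall p \near o^', `|f p| <= C * `|p| ^+ m.
Proof.
move=> [C H]; exists `|C| => //; apply: filterS H => p h; apply: le_trans h _.
by rewrite ler_wpM2r ?exprn_ge0 ?ler_norm.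
Qed.

Lemma ordO_near W m (f g : R * R -> W) :
  (\forall p \near o^', f p = g p) -> ordO m f -> ordO m g.
Proof. by move=> fg [C H]; exists C; apply: filterS2 fg H => p ->. Qed.

Lemma ordO_ext W m (f g : R * R -> W) : f =1 g -> ordO m f -> ordO m g.
Proof. by move=> /funext ->. Qed.

Lemma ordO_le W V m (f : R * R -> W) (g : R * R -> V) (c : R) :
  (\forall p \near o^', `|g p| <= c * `|f p|) -> 0 <= c -> ordO m f -> ordO m g.
Proof.
move=> fg c0 [C H]; exists (c * C); apply: filterS2 fg H => p h1 h2.
by apply: le_trans h1 _; rewrite -mulrA ler_wpM2l.
Qed.

Lemma ordOW W n m (f : R * R -> W) : (m <= n)%N -> ordO n f -> ordO m f.
Proof.
move=> mn /ordOP[C C0 H]; exists C; apply: filterS2 H dnbhs0_normlt1 => p h h1.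
apply: le_trans h _; rewrite ler_wpM2l //.
by rewrite -(subnK mn) exprD ler_piMl ?exprn_ge0 // exprn_ile1.
Qed.

Lemma ordOD W m (f g : R * R -> W) : ordO m f -> ordO m g -> ordO m (fun p => f p + g p).
Proof.
move=> [C H] [D G]; exists (C + D); apply: filterS2 H G => p h1 h2.
by apply: le_trans (ler_normD _ _) _; rewrite mulrDl lerD.
Qed.

Lemma ordON W m (f : R * R -> W) : ordO m f -> ordO m (fun p => - f p).
Proof. by move=> [C H]; exists C; apply: filterS H => p; rewrite normrN. Qed.

Lemma ordOB W m (f g : R * R -> W) : ordO m f -> ordO m g -> ordO m (fun p => f p - g p).
Proof. by move=> F G; apply: ordOD => //; exact: ordON. Qed.

Lemma ordOZ W m n (a : R * R -> R) (f : R * R -> W) : ordO m a -> ordO n f ->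
  ordO (m + n) (fun p => a p *: f p).
Proof.
move=> [C H] [D G]; exists (C * D); apply: filterS2 H G => p h1 h2.
by rewrite normrZ exprD mulrACA ler_pM.
Qed.

Lemma ordOM m n (a f : R * R -> R) : ordO m a -> ordO n f ->
  ordO (m + n) (fun p => a p * f p).
Proof. exact: ordOZ. Qed.

Lemma ordO_dot m n (f g : R * R -> 'rV[R]_3) : ordO m f -> ordO n g ->
  ordO (m + n) (fun p => dot (f p) (g p)).
Proof.
move=> [C H] [D G]; exists (3 * (C * D)); apply: filterS2 H G => p h1 h2.
apply: le_trans (norm_dot_le _ _) _.
by rewrite exprD -mulrA mulrACA ler_pM2l // ler_pM.
Qed.

Lemma ordO_cst W (w : W) : ordO 0 (fun=> w).
Proof. by exists `|w|; apply: nearW => p; rewrite expr0 mulr1. Qed.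

Lemma ordOZc W m (c : R) (f : R * R -> W) : ordO m f -> ordO m (fun p => c *: f p).
Proof. by move=> F; rewrite -[m]add0n; apply: ordOZ F; exact: ordO_cst. Qed.

Lemma ordOMc m (c : R) (f : R * R -> R) : ordO m f -> ordO m (fun p => c * f p).
Proof. exact: ordOZc. Qed.

Lemma cvg_ordO0 W (f : R * R -> W) (l : W) : f p @[p --> o^'] --> l -> ordO 0 f.
Proof.
move=> /cvgrPdist_lt/(_ 1 ltr01) H; exists (`|l| + 1); apply: filterS H => p h.
rewrite expr0 mulr1 -lerBlDl; apply: le_trans (ltW h).
by rewrite distrC lerB_dist.
Qed.

Lemma continuous_cvg_dnbhs W (f : R * R -> W) : {for o, continuous f} ->
  f p @[p --> o^'] --> f o.
Proof. by move=> c; apply: cvg_trans c; apply: cvg_app; exact: nbhs_dnbhs. Qed.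

Lemma continuous_ordO0 W (f : R * R -> W) : {for o, continuous f} -> ordO 0 f.
Proof. by move=> /continuous_cvg_dnbhs/cvg_ordO0. Qed.

Lemma ordO_cvg0 W m (f : R * R -> W) : ordO m.+1 f -> f p @[p --> o^'] --> (0 : W).
Proof.
move=> /(ordOW (ltn0Sn m))/ordOP[C C0 H]; apply/cvgr0Pnorm_lt => d d0.
have D0 : 0 < d / (C + 1) by rewrite divr_gt0 // ltr_wpDl.
apply: filterS2 H (dnbhs0_normlt D0) => p h1 h2; apply: le_lt_trans h1 _.
rewrite expr1; apply: le_lt_trans (_ : (C + 1) * `|p| < _).
  by rewrite ler_wpM2r // lerDl.
by rewrite mulrC -ltr_pdivlMr // ltr_wpDl.
Qed.

Lemma cvg_subordO W m (f : R * R -> W) l : ordO m.+1 (fun p => f p - l) ->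
  f p @[p --> o^'] --> l.
Proof. by move=> /ordO_cvg0/cvg_sub0; apply; exact: cvg_cst. Qed.

Lemma ordO_coord n m (f : R * R -> 'rV[R]_n) :
  ordO m f <-> forall j, ordO m (fun p => f p 0 j).
Proof.
split=> [F j|F].
  apply: (ordO_le (c := 1)) F => //; apply: nearW => p; rewrite mul1r.
  by exact: coord_norm_le.
pose C j := sval (cid (F j)); exists (\sum_j `|C j|).
near=> p; rewrite [leLHS]/Num.Def.normr/= mx_normrE.
apply: bigmax_le => [|[i j] _ /=].
  by rewrite mulr_ge0 ?exprn_ge0 // sumr_ge0.
rewrite (ord1 i); apply: (@le_trans _ _ (C j * `|p| ^+ m)).
  move: j {i}; near: p; apply: filter_forall => j.
  exact: (svalP (cid (F j))).
rewrite ler_wpM2r ?exprn_ge0 // (bigD1 j) //=.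
by apply: le_trans (ler_norm _) _; rewrite lerDl sumr_ge0.
Unshelve. all: by end_near. Qed.

(** On the punctured square of radius [|p|] the oscillation of [f] is at most [12 C |p|^(m+1)];
    comparison with points tending to the origin, where [f] tends to 0, removes the additive
    constant. *)
Lemma ordO_integrate m (f : R * R -> R) (g : 'I_2 -> R * R -> R) :
  (\forall p \near o^', forall i, is_derive p (e R i) f (g i p)) ->
  (forall i, ordO m (g i)) -> f p @[p --> o^'] --> (0 : R) -> ordO m.+1 f.
Proof.
move=> D G F; have [C0 C00 H0] := ordOP (G 0); have [C1 C10 H1] := ordOP (G 1).
pose C := C0 + C1; have C_ge0 : 0 <= C by rewrite addr_ge0.
have /dnbhs0P[r r0 H] : \forall p \near o^', forall i,
    derivable f p (e R i) /\ `|'D_(e R i) f p| <= C * `|p| ^+ m.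
  apply: filterS3 D H0 H1 => p Dp h0 h1 i.
  have [d ->] := Dp i; split=> //; rewrite /C mulrDl.
  have a0 : 0 <= C0 * `|p| ^+ m by rewrite mulr_ge0 ?exprn_ge0.
  have a1 : 0 <= C1 * `|p| ^+ m by rewrite mulr_ge0 ?exprn_ge0.
  by move: i {Dp d}; apply: I2_ind; [move: h0|move: h1]; lra.
exists (12 * C); apply/dnbhs0P; exists r => // p p0 pr.
apply/ler_addgt0Pr => d d0; move/cvgr0Pnorm_lt : F => /(_ d d0)/dnbhs0P[s s0 Hs].
have pp : 0 < `|p| by rewrite normr_gt0.
(* The comparison point [(t, 0)] lies in the square of [p] and is close enough to the origin for
   [|f| < d] there. *)
pose t := Num.min `|p| (s / 2); have t0 : 0 < t by rewrite lt_min pp divr_gt0.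
have nt : `|((t, 0) : R * R)| = t.
  by rewrite normpE /= normr0 max_l ?ger0_norm // ltW.
have q0 : ((t, 0) : R * R) != 0 by rewrite -normr_gt0 nt.
have qp : `|((t, 0) : R * R)| <= `|p| by rewrite nt ge_min lexx.
have K := @punctured_square_lip R f `|p| (C * `|p| ^+ m) _ p (t, 0) p0 q0 (lexx _) qp.
have {K} : `|f p - f (t, 0)| <= 12 * (C * `|p| ^+ m) * `|p|.
  apply: K => z z0 zp i; have [d1 d2] := H z z0 (le_lt_trans zp pr) i; split=> //.
  by apply: le_trans d2 _; rewrite ler_wpM2l // lerXn2r ?nnegrE.
have : `|f (t, 0)| < d.
  apply: Hs => //; rewrite nt; apply: le_lt_trans (_ : t <= s / 2) _.
    by rewrite ge_min lexx orbT.
  exact: half_lt.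
have -> : f p = (f p - f (t, 0)) + f (t, 0) by rewrite subrK.
have := ler_normD (f p - f (t, 0)) (f (t, 0)); rewrite exprSr subrK; lra.
Qed.

Lemma ordO_integrate_vec n m (f : R * R -> 'rV[R]_n) (g : 'I_2 -> R * R -> 'rV[R]_n) :
  (\forall p \near o^', forall i, is_derive p (e R i) f (g i p)) ->
  (forall i, ordO m (g i)) -> f p @[p --> o^'] --> (0 : 'rV[R]_n) -> ordO m.+1 f.
Proof.
move=> D G F; apply/ordO_coord => j.
apply: (@ordO_integrate _ _ (fun i p => g i p 0 j)).
- by apply: filterS D => p Dp i; have /is_derive_coord := Dp i; exact.
- by move=> i; have /ordO_coord := G i; exact.
- apply/cvgr0Pnorm_lt => d d0; move/cvgr0Pnorm_lt : F => /(_ d d0).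
  apply: filterS => p; apply: le_lt_trans.
  by exact: coord_norm_le.
Qed.

(** Bounded gradient gives [f p - 12 C |p| <= f q + 12 C |q|] for all [p], [q]. The supremum of the
    left sides lies below every right side, so it is the limit, with error at most [12 C |p|]. *)
Lemma punctured_limit (f : R * R -> R) (g : 'I_2 -> R * R -> R) :
  (\forall p \near o^', forall i, is_derive p (e R i) f (g i p)) ->
  (forall i, ordO 0 (g i)) -> exists l, ordO 1 (fun p => f p - l).
Proof.
move=> D G; have [C0 C00 H0] := ordOP (G 0); have [C1 C10 H1] := ordOP (G 1).
pose C := C0 + C1; have C_ge0 : 0 <= C by rewrite addr_ge0.
have /dnbhs0P[r r0 H] : \forall p \near o^', forall i,
    derivable f p (e R i) /\ `|'D_(e R i) f p| <= C.
  apply: filterS3 D H0 H1 => p Dp; rewrite expr0 !mulr1 => h0 h1 i.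
  have [d ->] := Dp i; split=> //; rewrite /C.
  by move: i {Dp d}; apply: I2_ind; [move: h0|move: h1]; lra.
have L p q : p != 0 -> q != 0 -> `|p| < r -> `|q| < r ->
    f p - 12 * C * `|p| <= f q + 12 * C * `|q|.
  move=> p0 q0 pr qr; pose m := Num.max `|p| `|q|.
  have := @punctured_square_lip R f m C _ p q p0 q0.
  have mr (z : R * R) : `|z| <= m -> `|z| < r by move=> zm; apply: le_lt_trans zm _; rewrite gt_max pr.
  move=> /(_ (fun z z0 zm i => H z z0 (mr z zm) i)).
  have pm : `|p| <= m by rewrite le_max lexx.
  have qm : `|q| <= m by rewrite le_max lexx orbT.
  move=> /(_ pm qm).
  have : m <= `|p| + `|q| by rewrite ge_max lerDl lerDr !normr_ge0.
  move=> /(ler_wpM2l C_ge0); have := ler_norm (f p - f q); nra.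
pose A := [set x | exists2 p, p != 0 /\ `|p| < r & x = f p - 12 * C * `|p|].
have z0 : ((r / 2, 0) : R * R) != 0 by apply/eqP => -[]/eqP; rewrite mulf_eq0 invr_eq0 pnatr_eq0 gt_eqF.
have zr : `|((r / 2, 0) : R * R)| < r.
  by rewrite normp_lt /= normr0 r0 andbT gtr0_norm ?divr_gt0 // half_lt.
have A0 : A !=set0 by exists (f (r / 2, 0) - 12 * C * `|((r / 2, 0) : R * R)|); exists (r / 2, 0).
have hA : has_sup A.
  split=> //; exists (f (r / 2, 0) + 12 * C * `|((r / 2, 0) : R * R)|).
  by move=> _ [p [p0 pr] ->]; exact: L.
exists (sup A), (12 * C); apply/dnbhs0P; exists r => // p p0 pr; rewrite expr1 ler_distl.
apply/andP; split.
  rewrite lerBlDr; apply: ge_sup => // _ [q [q0 qr] ->]; exact: L.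
rewrite -lerBlDr; apply: sup_upper_bound => //; by exists p.
Qed.

Lemma punctured_limit_vec n (f : R * R -> 'rV[R]_n) (g : 'I_2 -> R * R -> 'rV[R]_n) :
  (\forall p \near o^', forall i, is_derive p (e R i) f (g i p)) ->
  (forall i, ordO 0 (g i)) -> exists l, ordO 1 (fun p => f p - l).
Proof.
move=> D G; have H j : exists l, ordO 1 (fun p => f p 0 j - l).
  apply: (@punctured_limit _ (fun i p => g i p 0 j)).
    by apply: filterS D => p Dp i; have /is_derive_coord := Dp i; exact.
  by move=> i; have /ordO_coord := G i; exact.
exists (\row_j sval (cid (H j))); apply/ordO_coord => j.
by apply: ordO_ext (svalP (cid (H j))) => p; rewrite !mxE.
Qed.

Lemma smooth_subordO U n (f : R * R -> 'rV[R]_n) : open U -> U o -> smooth U f ->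
  ordO 1 (fun p => f p - f o).
Proof.
move=> oU Uo sf; apply: (@ordO_integrate_vec _ _ _ (fun i => pd i f)).
- apply: near_dnbhs0; apply: filterS (oU _ Uo) => p Up i.
  by rewrite -[pd i f p]subr0; apply: is_derive_subf; exact: smooth_is_pd.
- by move=> i; apply: continuous_ordO0; exact: smooth_cont (smooth_pd i sf) Uo.
- rewrite -(subrr (f o)); apply: cvgB; last exact: cvg_cst.
  exact: continuous_cvg_dnbhs (smooth_cont sf Uo).
Qed.

End PuncturedOrder.

(** * Limits at the origin and removable singularities *)

Section RibaucourLimits.
Variable R : realType.
Local Notation o := (0 : R * R).

Lemma is_derive_of_line (V W : normedModType R) (f : V -> W) p v df :
  is_derive (0 : R) 1 (fun s : R => f (p + s *: v)) df -> is_derive p v f df.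
Proof.
have E : (fun h : R => h^-1 *: (f (p + (h *: (1 : R) + 0) *: v) - f (p + 0 *: v))) =
         (fun h : R => h^-1 *: (f (h *: v + p) - f p)).
  apply/funext => h; rewrite scale0r !addr0; congr (_ *: (f _ - _)).
  by rewrite [_ *: 1]mulr1 addrC.
move=> [d ed]; split; first by move: d; rewrite /derivable E.
by move: ed; rewrite /derive E.
Qed.

Lemma is_derive_lnf (V : normedModType R) (f : V -> R) p v df : 0 < f p ->
  is_derive p v f df -> is_derive p v (fun q => ln (f q)) (df / f p).
Proof.
move=> f0 F; apply: is_derive_of_line; rewrite mulrC.
have F' : is_derive (0 : R) 1 (fun s : R => f (p + s *: v)) df.
  by apply: is_derive_line; rewrite scale0r addr0.
have L : is_derive (f (p + 0 *: v)) 1 (@ln R) (f p)^-1.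
  by rewrite scale0r addr0; exact: is_derive1_ln.
exact: (is_derive1_comp L F').
Qed.

Variables (eps : R) (Z Zt : R * R -> 'rV[R]_3) (c : R).
Variables (W : R * R -> 'rV[R]_3) (rho phi : R * R -> R).
Hypothesis e0 : 0 < eps.
Hypothesis cZ : conformal_immersion (disk eps) Z.
Hypothesis S : ribaucour_system (pdisk eps) Z Zt c W rho phi.
Local Notation N := (gauss Z).

Lemma disk0 : disk eps o.
Proof. by rewrite /disk /= /pdot mulr0 addr0 exprn_gt0. Qed.

Lemma near_pdisk : \forall p \near o^', pdisk eps p.
Proof.
apply/dnbhs0P; exists (eps / 2); first by rewrite divr_gt0.
by move=> p p0 pr; apply/pdiskP; split=> //; exact: small_disk.
Qed.

Lemma pdisk_disk p : pdisk eps p -> disk eps p.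
Proof. by case. Qed.

Lemma ordO0_pd m (f : R * R -> 'rV[R]_m) i : smooth (disk eps) f -> ordO 0 (pd i f).
Proof.
move=> sf; apply: continuous_ordO0; exact: smooth_cont (smooth_pd i sf) disk0.
Qed.

(** The system is linear with bounded coefficients, so the energy [E = rho^2 + phi^2 + W.W]
    satisfies [|dE| <= const E]. Hence [ln E] has bounded gradient and a limit at the origin, and
    [E] is bounded above and away from 0. *)
Lemma system_bounded : [/\ ordO 0 W, ordO 0 rho, ordO 0 phi &
  exists2 d : R, 0 < d & \forall p \near o^', d <= rho p ^+ 2 + phi p ^+ 2 + dot (W p) (W p)].
Proof.
have [c0 Sp] := S.
pose E p := rho p ^+ 2 + phi p ^+ 2 + dot (W p) (W p).
have E0 p : pdisk eps p -> 0 < E p.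
  move=> /Sp[[r0 _ _ _ _] _]; rewrite /E -addrA ltr_pwDl ?addr_ge0 ?sqr_ge0 ?dot_ge0 //.
  by rewrite exprn_even_gt0.
pose dE i p := (rho p * dot (W p) (pd i N p) + phi p * dot (W p) (pd i Z p)
   + c * (rho p * dot (W p) (pd i Z p) + phi p * dot (W p) (pd i N p))) *+ 2.
have DE i p : pdisk eps p -> is_derive p (e R i) E (dE i p).
  move=> Up; have [_ /(_ i)[dW drho dphi]] := Sp p Up; rewrite /E.
  apply: is_derive_eq (is_derive_addf (is_derive_addf (is_derive_mulf drho drho)
    (is_derive_mulf dphi dphi)) (is_derive_dot dW dW)) _.
  rewrite /dE !dot_lin !(dotC _ (W p)) mulr2n; ring.
have [l Hl] : exists l, ordO 1 (fun p => ln (E p) - l).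
  apply: (@punctured_limit _ _ (fun i p => dE i p / E p)) => [|i].
    by apply: filterS near_pdisk => p Up i; apply: is_derive_lnf; [exact: E0|exact: DE].
  have [B B0 HB] := ordOP (ordO0_pd i (smooth_gauss (@disk_open _ eps) cZ)).
  have [B' B0' HB'] := ordOP (ordO0_pd i cZ.1).
  exists (3 * (B + B') * (1 + `|c|)); apply: filterS3 near_pdisk HB HB' => p Up.
  rewrite expr0 !mulr1 => hN hZ; rewrite normrM normfV (gtr0_norm (E0 p Up)).
  rewrite ler_pdivrMr ?E0 //.
  have w2 := sqr_norm_le_dot (W p).
  (* Each term of [dE] is controlled by [2 |a| |W| <= a^2 + |W|^2 <= E]; the factor 3 bounds a dot
     product by sup norms. *)
  have key (a : R) (v : 'rV[R]_3) b : `|v| <= b -> 0 <= b -> a ^+ 2 + `|W p| ^+ 2 <= E p ->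
      `|a * dot (W p) v| <= 3 * b * E p / 2.
    move=> vb b0 aE; rewrite normrM.
    have h1 := norm_dot_le (W p) v.
    have h2 : `|W p| * `|v| <= `|W p| * b by rewrite ler_wpM2l.
    apply: le_trans (_ : `|a| * (3 * (`|W p| * b)) <= _).
      by rewrite ler_wpM2l // (le_trans h1) // ler_pM2l.
    have h3 : 2 * (`|a| * `|W p|) <= E p.
      apply: le_trans aE; rewrite -[a ^+ 2](real_normK (num_real a)).
      by have := sqr_ge0 (`|a| - `|W p|); rewrite sqrrB; lra.
    by have := ler_wpM2l b0 h3; lra.
  have rE : rho p ^+ 2 + `|W p| ^+ 2 <= E p by rewrite /E; have := sqr_ge0 (phi p); lra.
  have pE : phi p ^+ 2 + `|W p| ^+ 2 <= E p by rewrite /E; have := sqr_ge0 (rho p); lra.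
  have k1 := key _ _ _ hN B0 rE; have k2 := key _ _ _ hZ B0' pE.
  have k3 := key _ _ _ hZ B0' rE; have k4 := key _ _ _ hN B0 pE.
  rewrite /dE normrMn.
  set a1 := rho p * dot _ _ in k1 *; set a2 := phi p * dot _ _ in k2 *.
  set a3 := rho p * dot _ _ in k3 *; set a4 := phi p * dot _ _ in k4 *.
  have h1 := ler_normD (a1 + a2) (c * (a3 + a4)); have h2 := ler_normD a1 a2.
  have h3 := ler_normD a3 a4; rewrite (normrM c) in h1.
  have h4 := ler_wpM2l (normr_ge0 c) (le_trans h3 (lerD k3 k4)).
  rewrite mulr2n; lra.
have /dnbhs0P[s s0 Hs] : \forall p \near o^', `|ln (E p) - l| < 1.
  by have /cvgr0Pnorm_lt/(_ 1 ltr01) := ordO_cvg0 Hl.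
have /dnbhs0P[r r0 Hr] := near_pdisk.
have EB : \forall p \near o^', expR (l - 1) <= E p <= expR (l + 1).
  apply/dnbhs0P; exists (Num.min r s); first by rewrite lt_min r0.
  move=> p p0; rewrite lt_min => /andP[pr ps]; have := Hs p p0 ps.
  rewrite ltr_distl => /andP[h1 h2].
  rewrite -[E p]lnK ?posrE ?E0 //; last exact: Hr.
  by rewrite !ler_expR !ltW.
pose M := expR (l + 1).
have bd (a : R) p : a ^+ 2 <= E p -> E p <= M -> `|a| <= M + 1.
  move=> h1 h2; rewrite -(real_normK (num_real a)) in h1.
  have := normr_ge0 a; have := expR_gt0 (l + 1); rewrite -/M; nra.
split; last first.
- by exists (expR (l - 1)); [exact: expR_gt0|apply: filterS EB => p /andP[]].
- exists (M + 1); apply: filterS EB => p /andP[_ h]; rewrite expr0 mulr1.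
  apply: bd h; rewrite /E; have := sqr_ge0 (rho p); have := dot_ge0 (W p); lra.
- exists (M + 1); apply: filterS EB => p /andP[_ h]; rewrite expr0 mulr1.
  apply: bd h; rewrite /E; have := sqr_ge0 (phi p); have := dot_ge0 (W p); lra.
exists (M + 1); apply: filterS EB => p /andP[_ h]; rewrite expr0 mulr1.
rewrite -(ger0_norm (normr_ge0 (W p))); apply: bd h; rewrite /E.
have := sqr_norm_le_dot (W p); have := sqr_ge0 (phi p); have := sqr_ge0 (rho p); lra.
Qed.

Lemma system_limits : exists W0 rho0 phi0,
  [/\ ordO 1 (fun p => W p - W0), ordO 1 (fun p => rho p - rho0),
      ordO 1 (fun p => phi p - phi0), dot W0 W0 = 2 * c * rho0 * phi0 &
      rho0 != 0 \/ phi0 != 0].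
Proof.
have [bW br bp [d d0 Ed]] := system_bounded.
have [c0 Sp] := S.
have bN i := ordO0_pd i (smooth_gauss (@disk_open _ eps) cZ).
have bZ i := ordO0_pd i cZ.1.
have [W0 HW] : exists W0, ordO 1 (fun p => W p - W0).
  apply: (@punctured_limit_vec _ _ _ (fun i p => c *: (rho p *: pd i Z p + phi p *: pd i N p))).
    by apply: filterS near_pdisk => p /Sp[_ H] i; case: (H i).
  move=> i; apply: ordOZc; apply: ordOD.
    exact: (@ordOZ _ _ 0 0 _ _ br (bZ i)).
  exact: (@ordOZ _ _ 0 0 _ _ bp (bN i)).
have [r0 Hr] : exists r0, ordO 1 (fun p => rho p - r0).
  apply: (@punctured_limit _ _ (fun i p => dot (W p) (pd i N p))).
    by apply: filterS near_pdisk => p /Sp[_ H] i; case: (H i).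
  by move=> i; exact: (@ordO_dot _ 0 0 _ _ bW (bN i)).
have [p0 Hp] : exists p0, ordO 1 (fun p => phi p - p0).
  apply: (@punctured_limit _ _ (fun i p => dot (W p) (pd i Z p))).
    by apply: filterS near_pdisk => p /Sp[_ H] i; case: (H i).
  by move=> i; exact: (@ordO_dot _ 0 0 _ _ bW (bZ i)).
have limD : (fun p => dot (W p) (W p)) @ o^' --> dot W0 W0.
  apply: (@cvg_subordO _ _ 0).
  apply: (@ordO_ext _ _ _ (fun p => dot (W p - W0) (W p) + dot W0 (W p - W0))).
    by move=> p; rewrite !dot_lin; ring.
  apply: ordOD; first exact: (@ordO_dot _ 1 0 _ _ HW bW).
  by apply: (@ordO_dot _ 0 1 _ _ _ HW); exact: ordO_cst.
have cr := cvg_subordO Hr; have cp := cvg_subordO Hp.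
have WW : dot W0 W0 = 2 * c * r0 * p0.
  apply: (cvg_unique (@norm_hausdorff _ _) limD).
  have : (fun p => 2 * c * rho p * phi p) @ o^' --> 2 * c * r0 * p0.
    by apply: cvgM cp; apply: cvgM cr; exact: cvg_cst.
  apply: cvg_trans; apply: near_eq_cvg; apply: filterS near_pdisk => p /Sp[[]] *.
  by symmetry.
exists W0, r0, p0; split=> //.
have [r00|] := eqVneq r0 0; last by left.
right; apply/eqP => p00.
have lim : (fun p => rho p ^+ 2 + phi p ^+ 2 + dot (W p) (W p)) @ o^' --> (0 : R).
  have -> : 0 = r0 * r0 + p0 * p0 + dot W0 W0 by rewrite WW r00 p00; ring.
  by apply: cvgD limD; apply: cvgD; exact: cvgM.
move/cvgr0Pnorm_lt : lim => /(_ d d0)/(filterI Ed)/dnbhs0_ex[q _ [h1 h2]].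
by have := le_lt_trans (le_trans h1 (ler_norm _)) h2; rewrite ltxx.
Qed.

End RibaucourLimits.

(** * Partial derivatives at the puncture *)

Section RemovableDerivative.
Variable R : realType.
Local Notation o := (0 : R * R).

Lemma is_derive_ordO2 (W : normedModType R) (f : R * R -> W) v :
  ordO 2 (fun p => f p - f o) -> is_derive o v f 0.
Proof.
move=> /ordOP[C C0 /dnbhs0P[r r0 H]].
have L : (fun h : R => h^-1 *: (f (h *: v + o) - f o)) @ (0 : R)^' --> (0 : W).
  apply/cvgr0Pnorm_lt => d d0.
  have D0 : 0 < C * `|v| ^+ 2 + 1 by rewrite ltr_wpDl // mulr_ge0 // exprn_ge0.
  have v1 : 0 < `|v| + 1 by rewrite ltr_wpDl.
  near=> h; have hn : h != 0 by near: h; exact: nbhs_dnbhs_neq.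
  rewrite addr0 normrZ normfV.
  have h0 : 0 < `|h| by rewrite normr_gt0.
  rewrite mulrC ltr_pdivrMr //.
  have [v0|vn] := eqVneq v 0.
    by rewrite v0 scaler0 subrr normr0 mulr_gt0.
  have hv : `|h *: v| < r.
    rewrite normrZ; apply: le_lt_trans (_ : `|h| * (`|v| + 1) < _).
      by rewrite ler_wpM2l // lerDl.
    rewrite -ltr_pdivlMr //; near: h; apply: dnbhs0_lt; exact: divr_gt0.
  apply: le_lt_trans (H _ _ hv) _; first by rewrite scaler_eq0 negb_or hn.
  rewrite normrZ exprMn mulrCA expr2 -mulrA mulrC ltr_pM2r //.
  apply: le_lt_trans (_ : `|h| * (C * `|v| ^+ 2 + 1) < _).
    by rewrite ler_wpM2l // lerDl.
  rewrite -ltr_pdivlMr //; near: h; apply: dnbhs0_lt; exact: divr_gt0.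
split; first by apply/cvg_ex; exists 0.
exact: (cvg_lim (@norm_hausdorff _ _) L).
Unshelve. all: by end_near. Qed.

Lemma is_derive_fst p i : is_derive p (e R i) (fun q : R * R => q.1) (i == 0)%:R.
Proof.
have L : (fun h : R => h^-1 *: ((h *: e R i + p).1 - p.1)) @ (0 : R)^' --> ((i == 0)%:R : R).
  apply: cvg_trans (@cvg_cst _ ((i == 0)%:R : R) _ (0 : R)^' _).
  apply: near_eq_cvg; near=> h.
  have hn : h != 0 by near: h; exact: nbhs_dnbhs_neq.
  by rewrite /= addrK scalerA mulVf // scale1r.
split; first by apply/cvg_ex; exists (i == 0)%:R.
exact: (cvg_lim (@norm_hausdorff _ _) L).
Unshelve. all: by end_near. Qed.

Lemma is_derive_snd p i : is_derive p (e R i) (fun q : R * R => q.2) (i == 1)%:R.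
Proof.
have L : (fun h : R => h^-1 *: ((h *: e R i + p).2 - p.2)) @ (0 : R)^' --> ((i == 1)%:R : R).
  apply: cvg_trans (@cvg_cst _ ((i == 1)%:R : R) _ (0 : R)^' _).
  apply: near_eq_cvg; near=> h.
  have hn : h != 0 by near: h; exact: nbhs_dnbhs_neq.
  by rewrite /= addrK scalerA mulVf // scale1r.
split; first by apply/cvg_ex; exists (i == 1)%:R.
exact: (cvg_lim (@norm_hausdorff _ _) L).
Unshelve. all: by end_near. Qed.

(** After subtracting the linear function with slopes [l], the gradient is [O(|p|)]; integration
    makes the difference [O(|p|^2)], so its derivative at the origin is 0. *)
Lemma is_derive_removable (f : R * R -> R) (g : 'I_2 -> R * R -> R) (l : 'I_2 -> R) :
  (\forall p \near o^', forall i, is_derive p (e R i) f (g i p)) ->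
  (forall i, ordO 1 (fun p => g i p - l i)) -> ordO 1 (fun p => f p - f o) ->
  forall i, is_derive o (e R i) f (l i).
Proof.
move=> D G F i; pose k p := f p - (l 0 * p.1 + l 1 * p.2).
have lin q j : is_derive q (e R j) (fun q : R * R => l 0 * q.1 + l 1 * q.2) (l j).
  have H := is_derive_addf (is_derive_mulf (is_derive_cst0 (l 0) q (e R j)) (is_derive_fst q j))
    (is_derive_mulf (is_derive_cst0 (l 1) q (e R j)) (is_derive_snd q j)).
  by apply: is_derive_eq H _; elim/I2_ind: j {D G F}; rewrite /=; ring.
have ko : k o = f o by rewrite /k /= !mulr0 addr0 subr0.
have K2 : ordO 2 (fun p => k p - k o).
  apply: (@ordO_integrate _ _ _ (fun j p => g j p - l j)) => //.
    apply: filterS D => p Dp j; rewrite -[g j p - l j]subr0.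
    by apply: is_derive_subf; apply: is_derive_subf.
  apply: (@ordO_cvg0 _ _ 0); rewrite ko.
  apply: (@ordO_ext _ _ _ (fun p => (f p - f o) - (l 0 * p.1 + l 1 * p.2))).
    by move=> p; rewrite /k; ring.
  apply: ordOB => //; apply: ordOD; apply: ordOMc; exists 1; apply: nearW => p;
    by rewrite expr1 mul1r ?normp1_le ?normp2_le.
have := is_derive_addf (is_derive_ordO2 (e R i) K2) (lin o i).
rewrite add0r; congr (is_derive _ _ _ _); apply/funext => q.
by rewrite /k subrK.
Qed.

Lemma is_derive_removable_vec m (f : R * R -> 'rV[R]_m) (g : 'I_2 -> R * R -> 'rV[R]_m)
  (l : 'I_2 -> 'rV[R]_m) :
  (\forall p \near o^', forall i, is_derive p (e R i) f (g i p)) ->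
  (forall i, ordO 1 (fun p => g i p - l i)) -> ordO 1 (fun p => f p - f o) ->
  forall i, is_derive o (e R i) f (l i).
Proof.
move=> D G F i; apply/is_derive_coord => j.
apply: (@is_derive_removable _ (fun i p => g i p 0 j) (fun i => l i 0 j)).
- by apply: filterS D => p Dp k; have /is_derive_coord := Dp k; exact.
- move=> k; have /ordO_coord/(_ j) := G k; apply: ordO_ext => p; by rewrite !mxE.
- have /ordO_coord/(_ j) := F; apply: ordO_ext => p; by rewrite !mxE.
Qed.

End RemovableDerivative.

(** * The two Riccati forms of the system *)

Section RiccatiForms.
Variable R : realType.
Variables (eps : R) (Z Zt : R * R -> 'rV[R]_3) (c : R).
Variables (W : R * R -> 'rV[R]_3) (rho phi : R * R -> R).
Hypothesis S : ribaucour_system (pdisk eps) Z Zt c W rho phi.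
Local Notation N := (gauss Z).

Definition riccati_x p : 'rV[R]_3 := - (c * rho p)^-1 *: W p.

(** Because [W.W = 2 c rho phi], this is the inversion [x / (x.x)] of [riccati_x]; it has no [rho]
    in the denominator, so it survives when [rho] tends to 0. *)
Definition riccati_y p : 'rV[R]_3 := - (2 * phi p)^-1 *: W p.

(** The quadratic relation gives [phi / rho = (c / 2) x.x], which eliminates [rho] and [phi] from
    the quotient rule. *)
Lemma riccati_x_spec p : pdisk eps p ->
  Zt p = Z p + riccati_x p /\ forall i, is_derive p (e R i) riccati_x
    (- pd i Z p - (c / 2) *: (dot (riccati_x p) (riccati_x p) *: pd i N p
       - (2 * dot (riccati_x p) (pd i N p)) *: riccati_x p)).
Proof.
have [c0 H] := S; move=> /H[[r0 p0 WW eZ _] D]; split=> [|i].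
  by rewrite eZ /riccati_x scaleNr.
have [dW drho _] := D i.
have crho : c * rho p != 0 by rewrite mulf_neq0.
have d1 := @is_derive_invf _ _ (fun q => c * rho q) _ _ _ crho (is_derive_mulf (is_derive_cst0 c p (e R i)) drho).
apply: is_derive_eq (is_derive_scalef (is_derive_oppf d1) dW) _.
rewrite /riccati_x !dot_lin WW; set a := dot (W p) _.
apply/rowP => j; rewrite !mxE; field; by rewrite r0 c0.
Qed.

Lemma riccati_y_spec p : pdisk eps p ->
  [/\ riccati_y p != 0,
      Zt p = Z p + (dot (riccati_y p) (riccati_y p))^-1 *: riccati_y p,
      gauss_map Zt p = N p + (2 / c) *: riccati_y p &
      forall i, is_derive p (e R i) riccati_y
    (- (c / 2) *: pd i N p - dot (riccati_y p) (riccati_y p) *: pd i Z p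
       + (2 * dot (riccati_y p) (pd i Z p)) *: riccati_y p)].
Proof.
have [c0 H] := S; move=> /H[[r0 p0 WW eZ eN] D].
have yy : dot (riccati_y p) (riccati_y p) = c * rho p / (2 * phi p).
  by rewrite /riccati_y !dot_lin WW; field.
split.
- by rewrite -dot_eq0 yy !mulf_neq0 ?invr_eq0 ?mulf_neq0 // pnatr_eq0.
- rewrite eZ yy /riccati_y; apply/rowP => j; rewrite !mxE; field.
  by rewrite r0 c0 p0.
- rewrite eN /riccati_y; apply/rowP => j; rewrite !mxE; field.
  by rewrite c0 p0.
move=> i; have [dW _ dphi] := D i.
have p2 : 2 * phi p != 0 by rewrite mulf_neq0 // pnatr_eq0.
have d1 := @is_derive_invf _ _ (fun q => 2 * phi q) _ _ _ p2 (is_derive_mulf (is_derive_cst0 (2 : R) p (e R i)) dphi).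
apply: is_derive_eq (is_derive_scalef (is_derive_oppf d1) dW) _.
rewrite yy /riccati_y !dot_lin; set a := dot (W p) _.
apply/rowP => j; rewrite !mxE; field; by rewrite p0.
Qed.

End RiccatiForms.

(** * Removal of the singularity when [rho] has a nonzero limit *)

Section SmoothExtension.
Variable R : realType.
Local Notation o := (0 : R * R).
Variables (eps : R) (Z Zt : R * R -> 'rV[R]_3) (c : R).
Variables (W : R * R -> 'rV[R]_3) (rho phi : R * R -> R).
Hypothesis e0 : 0 < eps.
Hypothesis mZ : conformal_minimal_immersion (disk eps) Z.
Hypothesis uZ : umbilic Z o.
Hypothesis mZt : conformal_minimal_immersion (pdisk eps) Zt.
Hypothesis S : ribaucour_system (pdisk eps) Z Zt c W rho phi.
Local Notation N := (gauss Z).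
Let cZ : conformal_immersion (disk eps) Z := mZ.1.
Let oD : open (disk eps) := @disk_open R eps.
Let oP : open (pdisk eps) := @pdisk_open R eps.
Let Do : disk eps o := disk0 e0.

(** At an umbilic point the second form is [l] times the first, and zero trace forces [l = 0]. *)
Lemma umbilic_dgauss i : pd i N o = 0.
Proof.
have [l Hl] := uZ.
have E a b : - dot (pd a Z o) (pd b N o) = l * (confactor Z o *+ (a == b)).
  by have := Hl (e R a) (e R b); rewrite /first_form /second_form gauss_fun !pdE (conformal_dot cZ Do).2.
have T := minimal_trace cZ mZ.2 Do.
have ln := confactor_neq0 cZ Do.
have l0 : l = 0.
  apply/eqP; rewrite -(mulrI_eq0 _ (lregP ln)) mulrC; apply/eqP.
  have := E 0 0; have := E 1 1; rewrite !(dotC (pd _ Z o)) eqxx mulr1n; lra.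
apply: (tangent_ext cZ Do) => [j|]; last by rewrite (dgauss_normal oD cZ i Do) dot0l.
by have := E j i; rewrite l0 mul0r dot0l dotC; lra.
Qed.

Variables (W0 : 'rV[R]_3) (rho0 : R).
Hypotheses (hW : ordO 1 (fun p => W p - W0)) (hr : ordO 1 (fun p => rho p - rho0)).
Hypothesis r0 : rho0 != 0.

Local Notation x := (riccati_x c W rho).

Lemma smooth_extension : exists F, branched_minimal (disk eps) F /\
  forall p, pdisk eps p -> F p = Zt p.
Proof.
have [c0 Sp] := S.
have bN i := ordO0_pd e0 i (smooth_gauss oD cZ).
have bZ i := ordO0_pd e0 i cZ.1.
have clim : x @ o^' --> - (c * rho0)^-1 *: W0.
  apply: cvgZ; last exact: cvg_subordO hW.
  apply: cvgN; apply: cvgV; first by rewrite mulf_neq0.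
  by apply: cvgM; [exact: cvg_cst|exact: cvg_subordO hr].
pose rhs (X : 'rV[R]_3) i p := - pd i Z p - (c / 2) *: (dot X X *: pd i N p
       - (2 * dot X (pd i N p)) *: X).
have bx := cvg_ordO0 clim.
have Dx : \forall p \near o^', forall i, is_derive p (e R i) x (rhs (x p) i p).
  by apply: filterS (near_pdisk e0) => p Up; exact: (riccati_x_spec S Up).2.
have [x0 Hx] : exists l, ordO 1 (fun p => x p - l).
  apply: (@punctured_limit_vec _ _ _ (fun i p => rhs (x p) i p) Dx) => i.
  apply: ordOB; first exact: ordON.
  apply: ordOZc; apply: ordOB.
    exact: (@ordOZ _ _ 0 0 _ _ (@ordO_dot _ 0 0 _ _ bx bx) (bN i)).
  by apply: (@ordOZ _ _ 0 0 _ _ _ bx); apply: ordOMc; exact: (@ordO_dot _ 0 0 _ _ bx (bN i)).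
(* [X] is [x] completed by its limit. Its differential equation is then shown to hold at the origin
   as well, which starts the induction on regularity. *)
pose X p := if p == o then x0 else x p.
have Xx p : p != o -> X p = x p by rewrite /X => /negbTE ->.
have Xo : X o = x0 by rewrite /X eqxx.
have nX : \forall p \near o^', X p = x p.
  by apply: filterS (dnbhs0_neq R) => p; exact: Xx.
have HX : ordO 1 (fun p => X p - X o).
  by rewrite Xo; apply: ordO_near Hx; apply: filterS nX => p ->.
have bX : ordO 0 X by apply: ordO_near bx; apply: filterS nX => p ->.
have DXp p i : pdisk eps p -> is_derive p (e R i) X (rhs (X p) i p).
  move=> Up; have pn : p != o by case/pdiskP: Up.
  rewrite Xx //; apply: near_eq_is_derive ((riccati_x_spec S Up).2 i).
  apply: filterS (open_nbhs_nbhs (conj oP Up)) => q /pdiskP[_ qn].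
  by rewrite Xx.
have DX p i : disk eps p -> is_derive p (e R i) X (rhs (X p) i p).
  move=> Up; have [->|pn] := eqVneq p o; last by apply: DXp; apply/pdiskP.
  apply: (@is_derive_removable_vec _ _ _ (fun i p => rhs (X p) i p) (fun i => rhs (X o) i o)) => //.
    by apply: filterS (near_pdisk e0) => q Uq j; exact: DXp.
  (* As [dN] vanishes at the origin, the right-hand side there is [- dZ], and every quadratic term
     carries a factor [dN = O(|p|)]. *)
  move=> j; rewrite /rhs umbilic_dgauss !(scaler0, dot0r, mulr0, scale0r, subr0).
  apply: (@ordO_ext _ _ _ (fun p => - (pd j Z p - pd j Z o) -
      (c / 2) *: (dot (X p) (X p) *: (pd j N p - pd j N o) -
           (2 * dot (X p) (pd j N p - pd j N o)) *: X p))).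
    move=> q; rewrite umbilic_dgauss !subr0; apply/rowP => k; rewrite !mxE; ring.
  have sN := smooth_subordO oD Do (smooth_pd j (smooth_gauss oD cZ)).
  have sZ' := smooth_subordO oD Do (smooth_pd j cZ.1).
  apply: ordOB; first exact: ordON.
  apply: ordOZc; apply: ordOB.
    exact: (@ordOZ _ _ 0 1 _ _ (@ordO_dot _ 0 0 _ _ bX bX) sN).
  by apply: (@ordOZ _ _ 1 0 _ _ _ bX); apply: ordOMc; exact: (@ordO_dot _ 0 1 _ _ bX sN).
have contX p : disk eps p -> {for p, continuous X}.
  move=> Up; have [->|pn] := eqVneq p o.
    have h : X @ o^' --> X o by exact: cvg_subordO HX.
    by apply/continuous_withinNx.
  have Up' : pdisk eps p by apply/pdiskP.
  apply: near_eq_cont (_ : {for p, continuous (fun q => Zt q - Z q)}).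
    apply: filterS (open_nbhs_nbhs (conj oP Up')) => q Uq.
    have /pdiskP[_ qn] := Uq.
    by rewrite (riccati_x_spec S Uq).1 Xx // addrC addKr.
  apply: continuousB; first exact: smooth_cont mZt.1.1 Up'.
  exact: smooth_cont cZ.1 Up.
have sX : smooth (disk eps) X.
  elim=> [|k IH]; first by split.
  apply: (@CkS _ _ _ _ _ (fun i p => rhs (X p) i p)) => // i.
  have sN := smooth_pd i (smooth_gauss oD cZ) k.
  have sZ' := smooth_pd i cZ.1 k.
  have cZl m (a : R) (f : R * R -> 'rV[R]_m) : Ck k (disk eps) f -> Ck k (disk eps) (fun p => a *: f p).
    by move=> F; apply: CkZ => //; exact: Ck_cst.
  have neg m (f : R * R -> 'rV[R]_m) : Ck k (disk eps) f -> Ck k (disk eps) (fun p => - f p).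
    by move=> /(cZl m (-1)); apply: Ck_ext => // p _; rewrite scaleN1r.
  apply: CkD => //; first exact: neg.
  apply: (neg); apply: (cZl); apply: CkD => //; first by apply: CkZ => //; exact: Ck_dot.
  by apply: (neg); apply: CkZ => //; apply: CkZl => //; exact: Ck_dot.
pose F p := Z p + X p.
have FE p : pdisk eps p -> F p = Zt p.
  by move=> Up; have /pdiskP[_ pn] := Up; rewrite /F Xx // (riccati_x_spec S Up).1.
have sF : smooth (disk eps) F by move=> k; exact: CkD oD (cZ.1 k) (sX k).
exists F; split=> //; split=> // p Up.
  have [->|pn] := eqVneq p o; last first.
    have Up' : pdisk eps p by apply/pdiskP.
    have [l l0 Hl] := mZt.1.2 p Up'; exists l; first exact: ltW.
    move=> v w; rewrite -Hl /first_form.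
    by congr dot; apply: near_eq_derive;
      apply: filterS (open_nbhs_nbhs (conj oP Up')) => q /FE.
  (* At the origin [dX = - dZ], so the extension has a branch point there, with conformal factor
     0. *)
  have F0 i : pd i F o = 0.
    have H := is_derive_addf (dZ_is_derive cZ i Do) (DX o i Do).
    rewrite (is_derive_pd H) /rhs umbilic_dgauss !(scaler0, dot0r, mulr0, scale0r, subr0).
    by rewrite addrN.
  (* Conformality is required in all directions [v], not only along the axes; a second-order
     increment makes every directional derivative vanish. *)
  have F2 : ordO 2 (fun p => F p - F o).
    apply: (@ordO_integrate_vec _ _ _ _ (fun i => pd i F)).
    - apply: filterS (near_pdisk e0) => q Uq i; rewrite -[pd i F q]subr0.
      by apply: is_derive_subf; apply: smooth_is_pd sF _; exact: pdisk_disk Uq.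
    - move=> i; have := smooth_subordO oD Do (smooth_pd i sF).
      by apply: ordO_ext => q; rewrite F0 subr0.
    - exact: ordO_cvg0 (smooth_subordO oD Do sF).
  exists 0 => // v w; rewrite mul0r /first_form.
  by have [_ ->] := is_derive_ordO2 v F2; rewrite dot0l.
rewrite sum2E !pdE !pd_fun.
have lap q : pdisk eps q -> pd 0 (pd 0 F) q + pd 1 (pd 1 F) q = 0.
  move=> Uq; rewrite -(minimal_harmonic oP mZt.1 mZt.2 Uq).
  congr (_ + _); apply: pd_local oP Uq _ => z Uz; apply: pd_local oP Uz _ => z' ; exact: FE.
(* Harmonicity passes to the origin by continuity of the second derivatives of [F]. *)
have [->|pn] := eqVneq p o; last by apply: lap; apply/pdiskP.
have s2 i := smooth_cont (smooth_pd i (smooth_pd i sF)) Do.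
have L : (fun q => pd 0 (pd 0 F) q + pd 1 (pd 1 F) q) @ o^' --> pd 0 (pd 0 F) o + pd 1 (pd 1 F) o.
  by apply: cvgD; exact: continuous_cvg_dnbhs (s2 _).
apply: (cvg_unique (@norm_hausdorff _ _) L).
apply: cvg_trans (@cvg_cst _ (0 : 'rV[R]_3) _ o^' _); apply: near_eq_cvg.
by apply: filterS (near_pdisk e0) => q /lap ->.
Qed.

End SmoothExtension.

(** * Holomorphic functions as pairs *)

Section HolomorphicPairs.
Variable R : realType.
Local Notation o := (0 : R * R).
Implicit Types (U : set (R * R)) (P Q A B : R * R -> R).

Definition holomorphic U P Q := [/\ smooth U P, smooth U Q &
  forall p, U p -> pd 0 P p = pd 1 Q p /\ pd 1 P p = - pd 0 Q p].

Lemma smoothD U P Q : open U -> smooth U P -> smooth U Q -> smooth U (fun p => P p + Q p).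
Proof. by move=> oU sP sQ k; exact: CkD oU (sP k) (sQ k). Qed.

Lemma smoothB U P Q : open U -> smooth U P -> smooth U Q -> smooth U (fun p => P p - Q p).
Proof. by move=> oU sP sQ k; exact: CkB oU (sP k) (sQ k). Qed.

Lemma smoothM U P Q : open U -> smooth U P -> smooth U Q -> smooth U (fun p => P p * Q p).
Proof. by move=> oU sP sQ k; exact: CkM oU (sP k) (sQ k). Qed.

(** For a holomorphic pair [pd 0] is the complex derivative, so [iter j (pd 0)] yields the Taylor
    coefficients. *)
Lemma holomorphic_pd U P Q : open U -> holomorphic U P Q -> holomorphic U (pd 0 P) (pd 0 Q).
Proof.
move=> oU [sP sQ CR]; split; try exact: smooth_pd.
move=> p Up; split.
  rewrite -(pd_comm 0 1 oU (sQ 2) Up); apply: pd_local oU Up _ => q Uq; exact: (CR q Uq).1.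
rewrite -(pd_comm 0 1 oU (sP 2) Up).
have -> : pd 0 (pd 1 P) p = pd 0 (fun q => - pd 0 Q q) p.
  by apply: pd_local oU Up _ => q Uq; exact: (CR q Uq).2.
by apply: is_derive_pd; apply: is_derive_oppf; exact: smooth_is_pd (smooth_pd 0 sQ) Up.
Qed.

Lemma holomorphic_mul U P Q A B : open U -> holomorphic U P Q -> holomorphic U A B ->
  holomorphic U (fun p => P p * A p - Q p * B p) (fun p => P p * B p + Q p * A p).
Proof.
move=> oU [sP sQ CR] [sA sB CR']; split.
- by apply: smoothB => //; exact: smoothM.
- by apply: smoothD => //; exact: smoothM.
move=> p Up; have [h1 h2] := CR p Up; have [h3 h4] := CR' p Up.
have d (f g : R * R -> R) i : smooth U f -> smooth U g ->
    is_derive p (e R i) (fun q => f q * g q) (pd i f p * g p + f p * pd i g p).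
  by move=> sf sg; apply: is_derive_mulf; exact: smooth_is_pd.
have dB i := is_derive_pd (is_derive_subf (d _ _ i sP sA) (d _ _ i sQ sB)).
have dD i := is_derive_pd (is_derive_addf (d _ _ i sP sB) (d _ _ i sQ sA)).
by rewrite !dB !dD h1 h2 h3 h4; split; ring.
Qed.

Lemma holomorphic_harmonic U P Q : open U -> holomorphic U P Q -> forall p, U p ->
  pd 0 (pd 0 P) p + pd 1 (pd 1 P) p = 0 /\ pd 0 (pd 0 Q) p + pd 1 (pd 1 Q) p = 0.
Proof.
move=> oU [sP sQ CR] p Up.
have n (f g : R * R -> R) i : smooth U g -> (forall q, U q -> f q = - g q) ->
    pd i f p = - pd i g p.
  move=> sg fg; rewrite (pd_local i oU Up fg); apply: is_derive_pd.
  by apply: is_derive_oppf; exact: smooth_is_pd sg Up.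
split.
  rewrite (n (pd 1 P) _ 1 (smooth_pd 0 sQ) (fun q Uq => (CR q Uq).2)).
  rewrite (pd_comm 1 0 oU (sQ 2) Up).
  have -> : pd 0 (pd 0 P) p = pd 0 (pd 1 Q) p.
    by apply: pd_local oU Up _ => q Uq; exact: (CR q Uq).1.
  by rewrite subrr.
rewrite (n (pd 0 Q) (pd 1 P) 0 (smooth_pd 1 sP)); last first.
  by move=> q Uq; rewrite (CR q Uq).2 opprK.
rewrite -(pd_comm 1 0 oU (sP 2) Up).
have -> : pd 1 (pd 1 Q) p = pd 1 (pd 0 P) p.
  by apply: pd_local oU Up _ => q Uq; rewrite (CR q Uq).1.
by rewrite addNr.
Qed.

(* Real and imaginary parts of [z ^ n] for [z = p.1 + i p.2] *)
Fixpoint zpow (n : nat) (p : R * R) : R * R :=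
  if n is n'.+1 then
    let w := zpow n' p in (p.1 * w.1 - p.2 * w.2, p.1 * w.2 + p.2 * w.1)
  else (1, 0).

(** At [n = 0] the truncated predecessor is harmless, its coefficient [n%:R] being 0. *)
Lemma zpow_derive n p : [/\
  is_derive p (e R 0) (fun q => (zpow n q).1) (n%:R * (zpow n.-1 p).1),
  is_derive p (e R 1) (fun q => (zpow n q).1) (- (n%:R * (zpow n.-1 p).2)),
  is_derive p (e R 0) (fun q => (zpow n q).2) (n%:R * (zpow n.-1 p).2) &
  is_derive p (e R 1) (fun q => (zpow n q).2) (n%:R * (zpow n.-1 p).1)].
Proof.
elim: n => [|n [a0 a1 b0 b1]].
  by rewrite !mul0r oppr0; split; exact: is_derive_cst0.
have x0 := is_derive_fst p 0; have x1 := is_derive_fst p 1.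
have y0 := is_derive_snd p 0; have y1 := is_derive_snd p 1.
have n1 : (n.+1%:R : R) = n%:R + 1 by rewrite -natr1.
have key : n%:R * (p.1 * (zpow n.-1 p).1 - p.2 * (zpow n.-1 p).2) = n%:R * (zpow n p).1 /\
    n%:R * (p.1 * (zpow n.-1 p).2 + p.2 * (zpow n.-1 p).1) = n%:R * (zpow n p).2.
  by case: n {a0 a1 b0 b1 n1} => [|n] //=; rewrite !mul0r.
have [k1 k2] := key; rewrite n1 /=; split.
- apply: is_derive_eq (is_derive_subf (is_derive_mulf x0 a0) (is_derive_mulf y0 b0)) _.
  by rewrite /= [(n%:R + 1) * _]mulrDl -k1; ring.
- apply: is_derive_eq (is_derive_subf (is_derive_mulf x1 a1) (is_derive_mulf y1 b1)) _.
  by rewrite /= [(n%:R + 1) * _]mulrDl -k2; ring.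
- apply: is_derive_eq (is_derive_addf (is_derive_mulf x0 b0) (is_derive_mulf y0 a0)) _.
  by rewrite /= [(n%:R + 1) * _]mulrDl -k2; ring.
- apply: is_derive_eq (is_derive_addf (is_derive_mulf x1 b1) (is_derive_mulf y1 a1)) _.
  by rewrite /= [(n%:R + 1) * _]mulrDl -k1; ring.
Qed.

Lemma ordO_fst : ordO 1 (fun p : R * R => p.1).
Proof. by exists 1; apply: nearW => p; rewrite mul1r expr1 normp1_le. Qed.

Lemma ordO_snd : ordO 1 (fun p : R * R => p.2).
Proof. by exists 1; apply: nearW => p; rewrite mul1r expr1 normp2_le. Qed.

Lemma ordO_zpow n : ordO n (fun p => (zpow n p).1) /\ ordO n (fun p => (zpow n p).2).
Proof.
elim: n => [|n [h1 h2]]; first by split; exact: ordO_cst.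
split=> /=.
  by apply: ordOB; rewrite -add1n; [exact: ordOM ordO_fst h1|exact: ordOM ordO_snd h2].
by apply: ordOD; rewrite -add1n; [exact: ordOM ordO_fst h2|exact: ordOM ordO_snd h1].
Qed.

Lemma zpow_norm n p : (zpow n p).1 ^+ 2 + (zpow n p).2 ^+ 2 = (pdot p p) ^+ n.
Proof.
elim: n => [|n IH]; first by rewrite /= expr1n expr0n addr0 expr0.
by rewrite [RHS]exprS -IH /= /pdot; ring.
Qed.

Lemma smooth_subordO_scalar U P : open U -> U o -> smooth U P -> ordO 1 (fun p => P p - P o).
Proof.
move=> oU Uo sf; apply: (@ordO_integrate _ _ _ (fun i => pd i P)).
- apply: near_dnbhs0; apply: filterS (oU _ Uo) => p Up i.
  by rewrite -[pd i P p]subr0; apply: is_derive_subf; exact: smooth_is_pd.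
- by move=> i; apply: continuous_ordO0; exact: smooth_cont (smooth_pd i sf) Uo.
- rewrite -(subrr (P o)); apply: cvgB; last exact: cvg_cst.
  exact: continuous_cvg_dnbhs (smooth_cont sf Uo).
Qed.

Lemma near_open_dnbhs U : open U -> U o -> \forall p \near o^', U p.
Proof. by move=> oU Uo; apply: near_dnbhs0; exact: oU. Qed.

(* The error terms of the expansion [P + i Q = (a + i b) z ^ k + O(|z| ^ (k+1))] *)
Definition taylor_re k (a b : R) P p := P p - (a * (zpow k p).1 - b * (zpow k p).2).
Definition taylor_im k (a b : R) Q p := Q p - (a * (zpow k p).2 + b * (zpow k p).1).

Lemma taylor_derive k a b P Q U p : holomorphic U P Q -> U p ->
  let s := taylor_re k.-1 (k%:R * a) (k%:R * b) (pd 0 P) p in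
  let t := taylor_im k.-1 (k%:R * a) (k%:R * b) (pd 0 Q) p in
  [/\ is_derive p (e R 0) (taylor_re k a b P) s,
      is_derive p (e R 1) (taylor_re k a b P) (- t),
      is_derive p (e R 0) (taylor_im k a b Q) t &
      is_derive p (e R 1) (taylor_im k a b Q) s].
Proof.
move=> [sP sQ CR] Up s t; have [a0 a1 b0 b1] := zpow_derive k p.
have c i (l : R) f df : is_derive p (e R i) f df -> is_derive p (e R i) (fun q => l * f q) (l * df).
  by move=> F; apply: is_derive_eq (is_derive_mulf (is_derive_cst0 l p (e R i)) F) _; ring.
have [h1 h2] := CR p Up.
split; rewrite /taylor_re /taylor_im.
- apply: is_derive_eq (is_derive_subf (smooth_is_pd 0 sP Up) (is_derive_subf (c _ a _ _ a0) (c _ b _ _ b0))) _.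
  by rewrite /s /taylor_re; ring.
- apply: is_derive_eq (is_derive_subf (smooth_is_pd 1 sP Up) (is_derive_subf (c _ a _ _ a1) (c _ b _ _ b1))) _.
  by rewrite /t /taylor_im h2; ring.
- apply: is_derive_eq (is_derive_subf (smooth_is_pd 0 sQ Up) (is_derive_addf (c _ a _ _ b0) (c _ b _ _ a0))) _.
  by rewrite /t /taylor_im; ring.
- apply: is_derive_eq (is_derive_subf (smooth_is_pd 1 sQ Up) (is_derive_addf (c _ a _ _ b1) (c _ b _ _ a1))) _.
  by rewrite /s /taylor_re -h1; ring.
Qed.

(** Induction on [k]: the statement for the derivative is integrated once. The leading coefficient
    of the derivative is [k.+1] times that of the function, which is the recursion of the
    factorials. *)
Lemma taylor_ordO U k P Q : open U -> U o -> holomorphic U P Q ->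
  (forall j, (j < k)%N -> iter j (pd 0) P o = 0 /\ iter j (pd 0) Q o = 0) ->
  let a := iter k (pd 0) P o / (k`!)%:R in let b := iter k (pd 0) Q o / (k`!)%:R in
  ordO k.+1 (taylor_re k a b P) /\ ordO k.+1 (taylor_im k a b Q).
Proof.
move=> oU Uo; elim: k P Q => [|k IH] P Q hPQ H.
  have [sP sQ _] := hPQ; rewrite /= fact0 !divr1; split.
    by apply: ordO_ext (smooth_subordO_scalar oU Uo sP) => p; rewrite /taylor_re /=; ring.
  by apply: ordO_ext (smooth_subordO_scalar oU Uo sQ) => p; rewrite /taylor_im /=; ring.
have [sP sQ CR] := hPQ.
have [|] := IH _ _ (holomorphic_pd oU hPQ).
  by move=> j jk; rewrite -!iterSr; apply: H.
rewrite -!iterSr; set a' := _ / _; set b' := _ / _ => h1 h2 a b.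
have fk : ((k.+1)`!%:R : R) = k.+1%:R * (k`!)%:R by rewrite factS natrM.
have f0 : (k`!%:R : R) != 0 by rewrite pnatr_eq0 -lt0n fact_gt0.
have kn : (k.+1%:R : R) != 0 by rewrite pnatr_eq0.
have ea : a' = k.+1%:R * a by rewrite /a /a' fk; move: kn; move: (k.+1%:R : R) => K Kn; field; rewrite ?f0 ?Kn.
have eb : b' = k.+1%:R * b by rewrite /b /b' fk; move: kn; move: (k.+1%:R : R) => K Kn; field; rewrite ?f0 ?Kn.
rewrite ea in h1 h2; rewrite eb in h1 h2.
have [P0 Q0] := H 0 isT; rewrite /= in P0 Q0.
have [z1 z2] := ordO_zpow k.+1.
have D p (Up : U p) := taylor_derive k.+1 a b hPQ Up.
have bP : ordO 1 P by apply: ordO_ext (smooth_subordO_scalar oU Uo sP) => p; rewrite P0 subr0.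
have bQ : ordO 1 Q by apply: ordO_ext (smooth_subordO_scalar oU Uo sQ) => p; rewrite Q0 subr0.
have z1' := ordOW (isT : 1 <= k.+1)%N z1; have z2' := ordOW (isT : 1 <= k.+1)%N z2.
split.
  apply: (@ordO_integrate _ _ _ (fun i p => if i == 0 then taylor_re k (k.+1%:R * a) (k.+1%:R * b) (pd 0 P) p
       else - taylor_im k (k.+1%:R * a) (k.+1%:R * b) (pd 0 Q) p)).
  - apply: filterS (near_open_dnbhs oU Uo) => p /D[d0 d1 _ _]; exact: I2_ind.
  - apply: I2_ind => //=; exact: ordON.
  - apply: (@ordO_cvg0 _ _ 0); apply: ordOB => //; apply: ordOB; exact: ordOMc.
apply: (@ordO_integrate _ _ _ (fun i p => if i == 0 then taylor_im k (k.+1%:R * a) (k.+1%:R * b) (pd 0 Q) p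
     else taylor_re k (k.+1%:R * a) (k.+1%:R * b) (pd 0 P) p)).
- apply: filterS (near_open_dnbhs oU Uo) => p /D[_ _ d0 d1]; exact: I2_ind.
- exact: I2_ind.
- apply: (@ordO_cvg0 _ _ 0); apply: ordOB => //; apply: ordOD; exact: ordOMc.
Qed.

End HolomorphicPairs.

(** * Maximum principle and vanishing of flat holomorphic functions *)

Section MaximumPrinciple.
Variable R : realType.
Local Notation o := (0 : R * R).
Implicit Types (U : set (R * R)) (P Q A B : R * R -> R).

(** The first derivative vanishes at [p]. Were the second positive, the first would be positive just
    after [p], and the mean value theorem would produce a value above the maximum. *)
Lemma local_max_pd U (f : R * R -> R) p i : open U -> Ck 2 U f -> U p ->
  (forall q, U q -> f q <= f p) -> pd i (pd i f) p <= 0.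
Proof.
move=> oU F Up M; rewrite leNgt; apply/negP => c0.
have [r r0 Hr] := open_square oU Up.
have inU (t : R) : `|t| < r -> U (p + t *: e R i).
  move=> tr; apply: Hr; rewrite addrC addKr normrZ.
  by apply: le_lt_trans tr; rewrite ler_piMr // norm_e_le.
have dG (t : R) : `|t| < r -> is_derive t 1 (fun s : R => f (p + s *: e R i)) (pd i f (p + t *: e R i)).
  by move=> /inU Ut; apply: is_derive_line; exact: Ck_is_pd F Ut.
have z0 : `|0 : R| < r by rewrite normr0.
have pz : p + 0 *: e R i = p by rewrite scale0r addr0.
have g0 : pd i f p = 0.
  have h : is_derive (0 : R) 1 (fun s : R => f (p + s *: e R i)) 0.
    apply: (@derive1_at_max _ _ (- r) r).
    - by rewrite ge0_cp // ltW.
    - by move=> t; rewrite in_itv /= -ltr_norml => /dG[].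
    - by rewrite in_itv /= oppr_lt0 r0.
    - by move=> t; rewrite in_itv /= -ltr_norml pz => /inU/M.
  by have := is_derive_unique (dG 0 z0) h; rewrite pz.
have d2 : is_derive (0 : R) 1 (fun s : R => pd i f (p + s *: e R i)) (pd i (pd i f) p).
  by apply: is_derive_line; rewrite pz; exact: Ck_is_pd (Ck_pd i F) Up.
have [/cvg_ex[l Hl] el] := d2; have el' : l = pd i (pd i f) p.
  by rewrite -el; apply/esym/(cvg_lim (@norm_hausdorff _ _)).
rewrite el' {l el' el} in Hl.
move/cvgrPdist_lt : Hl => /(_ _ c0)/nbhs_ballP[s /= s0 Hs].
have gpos (t : R) : 0 < t -> t < s -> 0 < pd i f (p + t *: e R i).
  move=> t0 ts; have := Hs t; rewrite -ball_normE /= sub0r normrN gtr0_norm // => /(_ ts).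
  rewrite gt_eqF // => /(_ isT); rewrite addr0 pz g0 subr0 [t *: 1]mulr1.
  rewrite ltr_norml => /andP[_ h1].
  have : 0 < t^-1 * pd i f (p + t *: e R i).
    by move: h1; rewrite [_ *: _]/GRing.scale /=; lra.
  by rewrite pmulr_rgt0 // invr_gt0.
pose h := Num.min r s / 2.
have m0 : 0 < Num.min r s by rewrite lt_min r0.
have [h0 hr hs] : [/\ 0 < h, h < r & h < s].
  have : h < Num.min r s by exact: half_lt.
  by rewrite lt_min => /andP[-> ->]; split=> //; rewrite divr_gt0.
have [|t /andP[t0 th]] := @mvt_line R _ f p (e R i) 0 h h0.
  move=> t /andP[t0 th]; have : `|t| < r by rewrite ger0_norm // (le_lt_trans th).
  by move=> /inU Ut; case: (Ck_is_pd i F Ut).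
rewrite pz pdE subr0 => E.
have : f (p + h *: e R i) <= f p by apply: M; apply: inU; rewrite gtr0_norm.
by rewrite -subr_le0 E leNgt mulr_gt0 // gpos // (lt_trans th).
Qed.

Lemma pdot_ge0 (p : R * R) : 0 <= pdot p p.
Proof. by rewrite /pdot -!expr2 addr_ge0 ?sqr_ge0. Qed.

Lemma smooth_fst U : open U -> smooth U (fun p : R * R => p.1).
Proof.
move=> oU.
have c p : U p -> {for p, continuous (fun p : R * R => p.1)} by move=> _; exact: cvg_fst.
case=> [|k]; first exact: conj c I.
apply: (CkS oU c (fun i p _ => is_derive_fst p i)) => i; exact: Ck_cst.
Qed.

Lemma smooth_snd U : open U -> smooth U (fun p : R * R => p.2).
Proof.
move=> oU.
have c p : U p -> {for p, continuous (fun p : R * R => p.2)} by move=> _; exact: cvg_snd.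
case=> [|k]; first exact: conj c I.
apply: (CkS oU c (fun i p _ => is_derive_snd p i)) => i; exact: Ck_cst.
Qed.

Lemma smooth_pdot U : open U -> smooth U (fun p : R * R => pdot p p).
Proof.
move=> oU; have sx := smooth_fst oU; have sy := smooth_snd oU.
exact: smoothD oU (smoothM oU sx sx) (smoothM oU sy sy).
Qed.

Lemma pd_sqr U (f : R * R -> R) i p : open U -> smooth U f -> U p ->
  pd i (pd i (fun q => f q * f q)) p = 2 * pd i f p ^+ 2 + 2 * (f p * pd i (pd i f) p).
Proof.
move=> oU sf Up.
rewrite (@pd_local _ _ U _ (fun q => pd i f q * f q + f q * pd i f q)) //; last first.
  by move=> q Uq; apply: is_derive_pd; apply: is_derive_mulf; exact: smooth_is_pd.
have d1 := smooth_is_pd i sf Up; have d2 := smooth_is_pd i (smooth_pd i sf) Up.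
rewrite (is_derive_pd (is_derive_addf (is_derive_mulf d2 d1) (is_derive_mulf d1 d2))).
by ring.
Qed.

(** A closed subset of a compact square; [s = 0] gives the closed disk. *)
Lemma compact_annulus (s r : R) : 0 <= r ->
  compact [set p : R * R | s ^+ 2 <= pdot p p <= r ^+ 2].
Proof.
move=> r0; apply: (@subclosed_compact _ _ (`[- r, r] `*` `[- r, r])).
- have -> : [set p : R * R | s ^+ 2 <= pdot p p <= r ^+ 2] =
    (fun p : R * R => pdot p p) @^-1` [set t | s ^+ 2 <= t <= r ^+ 2] by [].
  apply: closed_comp; first by move=> p _; exact: pdot_continuous.
  have -> : [set t | s ^+ 2 <= t <= r ^+ 2] = `[s ^+ 2, r ^+ 2]%classic.
    by apply/seteqP; split=> t; rewrite /= in_itv.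
  exact: interval_closed.
- by apply: compact_setX; exact: segment_compact.
move=> [x y] /andP[_]; rewrite /pdot /= -!expr2 => h.
have b (t u : R) : t ^+ 2 + u ^+ 2 <= r ^+ 2 -> - r <= t <= r.
  move=> tu; rewrite -ler_norml -(ler_pXn2r (_ : (0 < 2)%N)) ?nnegrE //.
  by rewrite real_normK ?num_real //; have := sqr_ge0 u; lra.
split; rewrite /= in_itv /=; first exact: b h.
by apply: (b y x); rewrite addrC.
Qed.

(** The function [A^2 + B^2 + mu |z|^2] has Laplacian at least [4 mu > 0], so its maximum over the
    annulus is not interior, where both second derivatives would be nonpositive. Then [mu] tends to
    0. *)
Lemma holomorphic_max U A B (s r M : R) : open U -> holomorphic U A B -> 0 < s -> s < r ->
  (forall p, s ^+ 2 <= pdot p p <= r ^+ 2 -> U p) ->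
  (forall p, pdot p p = s ^+ 2 \/ pdot p p = r ^+ 2 -> A p ^+ 2 + B p ^+ 2 <= M) ->
  forall p, s ^+ 2 <= pdot p p <= r ^+ 2 -> A p ^+ 2 + B p ^+ 2 <= M.
Proof.
move=> oU hAB s0 sr KU bM p Kp.
have r0 : 0 < r by exact: lt_trans sr.
have [sA sB CR] := hAB.
suff H mu : 0 < mu -> A p ^+ 2 + B p ^+ 2 <= M + mu * r ^+ 2.
  apply/ler_addgt0Pr => d d0; apply: le_trans (H (d / r ^+ 2) _) _.
    by rewrite divr_gt0 // exprn_gt0.
  by rewrite divfK // expf_neq0 // gt_eqF.
move=> mu0; pose g q := A q * A q + B q * B q + mu * pdot q q.
have sg : smooth U g.
  apply: smoothD => //; first by apply: smoothD => //; exact: smoothM.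
  by move=> k; apply: CkZl => //; exact: smooth_pdot.
have [z zK zM] : exists2 z, s ^+ 2 <= pdot z z <= r ^+ 2 &
    forall q, s ^+ 2 <= pdot q q <= r ^+ 2 -> g q <= g z.
  have [||z zK zM] := @compact_EVT_max _ R g _ _ (@compact_annulus s r (ltW r0)).
  - by exists p.
  - apply: continuous_in_subspaceT => q; rewrite inE /= => /KU Uq.
    exact: smooth_cont sg Uq.
  - exists z; first by rewrite inE in zK.
    by move=> q Kq; apply: zM; rewrite inE.
have gp := zM p Kp.
have bd q : pdot q q = s ^+ 2 \/ pdot q q = r ^+ 2 -> g q <= M + mu * r ^+ 2.
  move=> h; rewrite /g -!expr2 lerD //; first exact: bM.
  rewrite ler_wpM2l ?(ltW mu0) //; case: h => -> //.
  by rewrite lerXn2r ?nnegrE ?ltW.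
have gA : A p ^+ 2 + B p ^+ 2 <= g p.
  by rewrite /g -!expr2 lerDl mulr_ge0 ?(ltW mu0) // pdot_ge0.
apply: le_trans gA (le_trans gp _).
have [h|hz] := eqVneq (pdot z z) (s ^+ 2); first by apply: bd; left.
have [h|hz'] := eqVneq (pdot z z) (r ^+ 2); first by apply: bd; right.
exfalso; move: (zK) => /andP[z1 z2].
pose V := [set q : R * R | s ^+ 2 < pdot q q < r ^+ 2] : set (R * R).
have oV : open V.
  have -> : V = (fun p : R * R => pdot p p) @^-1` `]s ^+ 2, r ^+ 2[%classic.
    by apply/seteqP; split=> q; rewrite /V /= in_itv.
  by apply: open_comp; [move=> q _; exact: pdot_continuous|exact: interval_open].
have Vz : V z by rewrite /V /= !lt_neqAle z1 z2 eq_sym hz hz'.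
have VK q : V q -> s ^+ 2 <= pdot q q <= r ^+ 2 by move=> /andP[? ?]; rewrite !ltW.
have VU : V `<=` U by move=> q /VK/KU.
have Uz := VU z Vz.
have L i := @local_max_pd V g z i oV (Ck_sub VU (sg 2)) Vz (fun q Vq => zM q (VK q Vq)).
have E i : pd i (pd i g) z = pd i (pd i (fun q => A q * A q)) z +
    pd i (pd i (fun q => B q * B q)) z + mu * 2.
  have sAA := smoothM oU sA sA; have sBB := smoothM oU sB sB.
  have dp (q : R * R) : is_derive q (e R i) (fun q => mu * pdot q q) (mu * (2 * (if i == 0 then q.1 else q.2))).
    have h := is_derive_addf (is_derive_mulf (is_derive_fst q i) (is_derive_fst q i))
        (is_derive_mulf (is_derive_snd q i) (is_derive_snd q i)).
    apply: is_derive_eq (is_derive_mulf (is_derive_cst0 mu q (e R i)) h) _.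
    by elim/I2_ind: i {h L}; rewrite /=; ring.
  rewrite (@pd_local _ _ U _ (fun q => pd i (fun q => A q * A q) q +
     pd i (fun q => B q * B q) q + mu * (2 * (if i == 0 then q.1 else q.2)))) //; last first.
    move=> q Uq; apply: is_derive_pd; apply: is_derive_addf (dp q).
    by apply: is_derive_addf; exact: smooth_is_pd.
  apply: is_derive_pd; apply: is_derive_addf.
    by apply: is_derive_addf; apply: smooth_is_pd Uz; exact: smooth_pd.
  have d : is_derive z (e R i) (fun q => if i == 0 then q.1 else q.2) 1.
    elim/I2_ind: i {L dp} => /=; [exact: is_derive_fst|exact: is_derive_snd].
  apply: is_derive_eq (is_derive_mulf (is_derive_cst0 mu z (e R i))
     (is_derive_mulf (is_derive_cst0 (2 : R) z (e R i)) d)) _.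
  by ring.
have := L 0; have := L 1; rewrite !E !(pd_sqr _ oU) //.
have [hA hB] := holomorphic_harmonic oU hAB Uz.
have {hA}eA : pd 1 (pd 1 A) z = - pd 0 (pd 0 A) z by lra.
have {hB}eB : pd 1 (pd 1 B) z = - pd 0 (pd 0 B) z by lra.
rewrite eA eB.
have := sqr_ge0 (pd 0 A z); have := sqr_ge0 (pd 1 A z).
have := sqr_ge0 (pd 0 B z); have := sqr_ge0 (pd 1 B z).
by rewrite !mulrN; move: (A z * _) (B z * _) => X Y; lra.
Qed.

Lemma ler_sqr_ge0 (a b : R) : 0 <= a -> a <= b -> a ^+ 2 <= b ^+ 2.
Proof. by move=> a0 ab; rewrite !expr2 ler_pM. Qed.

(** Real and imaginary parts of [1 / z]. *)
Definition zinv (p : R * R) : R * R := (p.1 / pdot p p, - p.2 / pdot p p).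

Lemma pdot_gt0 (p : R * R) : p != 0 -> 0 < pdot p p.
Proof.
case: p => x y h; rewrite /pdot /= -!expr2 lt_neqAle addr_ge0 ?sqr_ge0 // andbT eq_sym.
rewrite paddr_eq0 ?sqr_ge0 // !sqrf_eq0; apply: contra h => /andP[/eqP -> /eqP ->].
exact: eqxx.
Qed.

Lemma holomorphic_zinv (r : R) : holomorphic (pdisk r) (fun p => (zinv p).1) (fun p => (zinv p).2).
Proof.
have oP := @pdisk_open R r.
have n0 p : pdisk r p -> pdot p p != 0 by move=> /pdiskP[_ /pdot_gt0/gt_eqF ->].
have sV : smooth (pdisk r) (fun p : R * R => (pdot p p)^-1).
  by move=> k; apply: CkV => //; exact: smooth_pdot.
have dV (p : R * R) i : pdisk r p -> is_derive p (e R i) (fun q => (pdot q q)^-1)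
    (- (2 * (if i == 0 then p.1 else p.2)) / pdot p p ^+ 2).
  move=> Up; apply: (@is_derive_invf _ _ (fun q => pdot q q)); first exact: n0.
  apply: is_derive_eq (is_derive_addf (is_derive_mulf (is_derive_fst p i) (is_derive_fst p i))
        (is_derive_mulf (is_derive_snd p i) (is_derive_snd p i))) _.
  by elim/I2_ind: i; rewrite /=; ring.
have d1 (p : R * R) i (Up : pdisk r p) := is_derive_mulf (is_derive_fst p i) (dV p i Up).
have d2 (p : R * R) i (Up : pdisk r p) := is_derive_mulf (is_derive_oppf (is_derive_snd p i)) (dV p i Up).
have sn : smooth (pdisk r) (fun p : R * R => - p.2).
  by move=> k; exact: CkN oP (smooth_snd oP k).
split; first exact: smoothM oP (smooth_fst oP) sV.
  exact: smoothM oP sn sV.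
move=> p Up; have nz := n0 p Up.
rewrite !(is_derive_pd (d1 _ _ Up)) !(is_derive_pd (d2 _ _ Up)) /=.
by move: nz; rewrite /pdot; case: p {Up} => x y /= nz; split; field; rewrite -!expr2 in nz *.
Qed.

Lemma zinv_norm (p : R * R) : p != 0 -> (zinv p).1 ^+ 2 + (zinv p).2 ^+ 2 = (pdot p p)^-1.
Proof.
move=> /pdot_gt0/lt0r_neq0; rewrite /zinv /pdot; case: p => x y /= nz; field.
by rewrite -!expr2 in nz *.
Qed.

(* Apply the maximum principle to [f / z^m] for all [m]. *)
Lemma flat_holomorphic (eps : R) P Q : 0 < eps -> holomorphic (disk eps) P Q ->
  (forall k, ordO k P /\ ordO k Q) ->
  forall p, disk (eps / 2) p -> p != 0 -> P p = 0 /\ Q p = 0.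
Proof.
move=> e0 hPQ fl p pd2 pn.
have oD := @disk_open R eps; have oP := @pdisk_open R eps.
pose r := eps / 2; have r0 : 0 < r by rewrite divr_gt0.
have re : r < eps by rewrite /r; lra.
have hPQ' : holomorphic (pdisk eps) P Q.
  have [sP sQ CR] := hPQ; split; try by move=> k; apply: Ck_sub; [|exact: sP||exact: sQ]; move=> q [].
  by move=> q [/CR].
(* [A + i B] is [(P + i Q) / z^m]; the argument uses only its modulus and its holomorphy. *)
have Fm m : exists A B, holomorphic (pdisk eps) A B /\
    forall q : R * R, q != 0 -> A q ^+ 2 + B q ^+ 2 = (P q ^+ 2 + Q q ^+ 2) / pdot q q ^+ m.
  elim: m => [|m [A [B [hAB E]]]].
    by exists P, Q; split=> // q _; rewrite expr0 divr1.
  eexists; eexists; split; first exact: holomorphic_mul oP hAB (holomorphic_zinv eps).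
  move=> q qn; rewrite (exprSr (pdot q q)) invfM [RHS]mulrA -E // -(zinv_norm qn).
  by move: (zinv q) => w; ring.
have [M M0 HM] : exists2 M, 0 < M & forall q, pdot q q <= r ^+ 2 -> P q ^+ 2 + Q q ^+ 2 <= M.
  have [sP sQ _] := hPQ.
  have [|q Kq|z zK zM] := @compact_EVT_max _ R (fun q => P q ^+ 2 + Q q ^+ 2) _ _ (@compact_annulus 0 r (ltW r0)).
  - by exists o; rewrite /= /pdot mulr0 addr0 expr0n lexx sqr_ge0.
  - move: q Kq; apply: continuous_in_subspaceT => q; rewrite inE /= => /andP[_ qr].
    have Uq : disk eps q by rewrite /disk /=; apply: le_lt_trans qr _; rewrite ltrXn2r ?nnegrE // ltW.
    by apply: cvgD; apply: cvgM; [exact: smooth_cont sP Uq|exact: smooth_cont sP Uq|exact: smooth_cont sQ Uq|exact: smooth_cont sQ Uq].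
  exists (P z ^+ 2 + Q z ^+ 2 + 1); first by rewrite ltr_wpDl // addr_ge0 ?sqr_ge0.
  move=> q qr; apply: (@le_trans _ _ (P z ^+ 2 + Q z ^+ 2)); last by rewrite lerDl.
  by apply: zM; rewrite inE /= expr0n qr pdot_ge0.
have pr : pdot p p < r ^+ 2 by [].
have pp := pdot_gt0 pn.
have r20 : 0 < r ^+ 2 by rewrite exprn_gt0.
(* On the outer circle the squared modulus of the quotient is at most [T = M / r^(2m)]. On the inner
   circle of radius [s] flatness of order [m + 1] bounds it by [CC s^2], and [s] is chosen to make
   this at most [T], with [p] inside the annulus. *)
have bound m : P p ^+ 2 + Q p ^+ 2 <= M * (pdot p p / r ^+ 2) ^+ m.
  have [A [B [hAB E]]] := Fm m.
  have [[C C0 HC] [C' C0' HC']] := (ordOP (fl m.+1).1, ordOP (fl m.+1).2).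
  have /dnbhs0P[s1 s10 Hs1] : \forall q \near o^',
      `|P q| <= C * `|q| ^+ m.+1 /\ `|Q q| <= C' * `|q| ^+ m.+1.
    by apply: filterS2 HC HC' => q.
  pose T := M / (r ^+ 2) ^+ m; have T0 : 0 < T by rewrite divr_gt0 // exprn_gt0.
  pose CC := C ^+ 2 + C' ^+ 2 + 1; have CC0 : 0 < CC by rewrite ltr_wpDl // addr_ge0 ?sqr_ge0.
  pose s := Num.min (s1 / 2) (Num.min (Num.sqrt (T / CC)) (Num.min (Num.sqrt (pdot p p)) (r / 2))).
  have s0 : 0 < s by rewrite /s !lt_min !sqrtr_gt0 pp (divr_gt0 s10) // (divr_gt0 T0) // (divr_gt0 r0).
  have ss1 : s < s1.
    by apply: le_lt_trans (_ : s <= s1 / 2) _; [rewrite ge_min lexx|exact: half_lt].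
  have sT : s ^+ 2 <= T / CC.
    have TC : 0 <= T / CC by rewrite divr_ge0 // ltW.
    have h : s <= Num.sqrt (T / CC) by rewrite /s !ge_min lexx !orbT.
    by have := ler_sqr_ge0 (ltW s0) h; rewrite sqr_sqrtr.
  have sp : s ^+ 2 <= pdot p p.
    have h : s <= Num.sqrt (pdot p p) by rewrite /s !ge_min lexx !orbT.
    by have := ler_sqr_ge0 (ltW s0) h; rewrite sqr_sqrtr // ltW.
  have sr : s < r.
    by apply: le_lt_trans (_ : s <= r / 2) _; [rewrite /s !ge_min lexx !orbT|exact: half_lt].
  have neq0 q : 0 < pdot q q -> q != 0.
    by apply: contraTneq => ->; rewrite /pdot /= mulr0 addr0 ltxx.
  have bT : A p ^+ 2 + B p ^+ 2 <= T.
    apply: (@holomorphic_max (pdisk eps) A B s r) => //.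
    - move=> q /andP[q1 q2]; apply/pdiskP; split.
        by rewrite /disk /=; apply: le_lt_trans q2 _; rewrite ltrXn2r ?nnegrE // ltW.
      by apply: neq0; apply: lt_le_trans q1; rewrite exprn_gt0.
    - move=> q [qs|qr]; last first.
        have qn : q != 0 by apply: neq0; rewrite qr.
        by rewrite E // qr ler_pM2r ?invr_gt0 ?exprn_gt0 // HM // qr.
      have qn : q != 0 by apply: neq0; rewrite qs exprn_gt0.
      have nq := sqr_normp_le q.
      have qs1 : `|q| < s1.
        apply: le_lt_trans ss1; rewrite -(ler_pXn2r (_ : (0 < 2)%N)) ?nnegrE ?(ltW s0) //.
        by rewrite -qs.
      have [h1 h2] := Hs1 q qn qs1.
      rewrite E // ler_pdivrMr ?exprn_gt0 ?qs ?exprn_gt0 //.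
      have hN : (`|q| ^+ m.+1) ^+ 2 <= s ^+ 2 * (s ^+ 2) ^+ m.
        rewrite exprAC -exprS lerXn2r ?nnegrE ?exprn_ge0 ?(ltW s0) //.
        by rewrite -qs.
      have sq (a b D : R) : `|a| <= D * b -> a ^+ 2 <= D ^+ 2 * b ^+ 2.
        move=> ab; rewrite -exprMn -(real_normK (num_real a)) lerXn2r ?nnegrE //.
        exact: le_trans ab.
      have := lerD (sq _ _ _ h1) (sq _ _ _ h2); rewrite -mulrDl => /le_trans; apply.
      apply: le_trans (_ : CC * (s ^+ 2 * (s ^+ 2) ^+ m) <= _).
        rewrite ler_pM ?addr_ge0 ?sqr_ge0 //.
        by rewrite /CC lerDl.
      rewrite mulrA ler_pM2r ?exprn_gt0 ?exprn_gt0 //.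
      by rewrite mulrC -ler_pdivlMr.
    - by rewrite sp ltW.
  move: bT; rewrite E // ler_pdivrMr ?exprn_gt0 // /T => /le_trans; apply.
  by rewrite (expr_div_n (pdot p p) (r ^+ 2)) [leRHS]mulrA mulrAC.
pose t := pdot p p / r ^+ 2.
(* The ratio is below 1, so letting [m] tend to infinity in [bound] gives 0. *)
have t1 : `|t| < 1 by rewrite ger0_norm ?divr_ge0 ?(ltW pp) ?(ltW r20) // ltr_pdivrMr // mul1r.
have : P p ^+ 2 + Q p ^+ 2 <= 0.
  have lim : (fun m => M * t ^+ m) @ \oo --> M * 0.
    by apply: cvgM; [exact: cvg_cst|exact: cvg_expr].
  rewrite mulr0 in lim.
  rewrite -(cvg_lim (@norm_hausdorff _ _) lim); apply: limr_ge.
    by apply/cvg_ex; exists 0.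
  by apply: nearW => m; exact: bound.
move=> h; have h' : P p ^+ 2 + Q p ^+ 2 == 0 by rewrite eq_le h addr_ge0 ?sqr_ge0.
by move: h'; rewrite paddr_eq0 ?sqr_ge0 // !sqrf_eq0 => /andP[/eqP -> /eqP ->].
Qed.

End MaximumPrinciple.

(** * Perturbations of z^k *)

Section ComplexPairs.
Variable R : realType.
Local Notation C := (R * R)%type.
Local Notation o := (0 : R * R).
Implicit Types a b z w : C.

Definition cmul a b : C := (a.1 * b.1 - a.2 * b.2, a.1 * b.2 + a.2 * b.1).

Definition cis (t : R) : C := (cos t, sin t).

Lemma pair_ext a b : a.1 = b.1 -> a.2 = b.2 -> a = b.
Proof. by case: a b => ? ? [? ?] /= -> ->. Qed.

Lemma cmulA a b z : cmul a (cmul b z) = cmul (cmul a b) z.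
Proof. by apply: pair_ext; rewrite /=; ring. Qed.

Lemma cmulC a b : cmul a b = cmul b a.
Proof. by apply: pair_ext; rewrite /=; ring. Qed.

Lemma cmulDr a b z : cmul a (b + z) = cmul a b + cmul a z.
Proof. by apply: pair_ext; rewrite /=; ring. Qed.

Lemma cmulBr a b z : cmul a (b - z) = cmul a b - cmul a z.
Proof. by apply: pair_ext; rewrite /=; ring. Qed.

Lemma cmul1 a : cmul a (1, 0) = a.
Proof. by apply: pair_ext; rewrite /=; ring. Qed.

Lemma cmulZr (t : R) a b : cmul a (t *: b) = t *: cmul a b.
Proof. by apply: pair_ext; rewrite /= !/GRing.scale /=; ring. Qed.

Lemma norm_cmul_le a b : `|cmul a b| <= 2 * (`|a| * `|b|).
Proof.
have H (x y : R) : `|x| <= `|a| -> `|y| <= `|b| -> `|x * y| <= `|a| * `|b|.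
  by move=> *; rewrite normrM ler_pM.
rewrite normp_le /=; apply/andP; split.
  apply: le_trans (ler_normB _ _) _.
  have := H _ _ (normp1_le a) (normp1_le b); have := H _ _ (normp2_le a) (normp2_le b); lra.
apply: le_trans (ler_normD _ _) _.
have := H _ _ (normp1_le a) (normp2_le b); have := H _ _ (normp2_le a) (normp1_le b); lra.
Qed.

Lemma zpowS n z : zpow n.+1 z = cmul z (zpow n z).
Proof. by []. Qed.

Lemma zpow_cmul n a b : zpow n (cmul a b) = cmul (zpow n a) (zpow n b).
Proof.
elim: n => [|n IH]; first by rewrite /= cmul1.
by rewrite !zpowS IH; apply: pair_ext; rewrite /=; ring.
Qed.

Lemma zpow_scale n (t : R) z : zpow n (t *: z) = t ^+ n *: zpow n z.
Proof.
elim: n => [|n IH]; first by rewrite expr0 scale1r.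
by rewrite !zpowS IH exprS; apply: pair_ext; rewrite /= !/GRing.scale /=; ring.
Qed.

Lemma cisD s t : cis (s + t) = cmul (cis s) (cis t).
Proof. by apply: pair_ext; rewrite /= ?cosD ?sinD; ring. Qed.

Lemma cis0 : cis 0 = (1, 0).
Proof. by rewrite /cis cos0 sin0. Qed.

Lemma zpow_cis n t : zpow n (cis t) = cis (n%:R * t).
Proof.
elim: n => [|n IH]; first by rewrite mul0r cis0.
by rewrite zpowS IH -cisD -natr1; congr cis; ring.
Qed.

Lemma cis_norm_le t : `|cis t| <= 1.
Proof. by rewrite normp_le /= !ler_norml cos_geN1 cos_le1 sin_geN1 sin_le1. Qed.

Lemma cis_norm_ge t : 2^-1 <= `|cis t|.
Proof.
rewrite leNgt normp_lt /=; apply/negP => /andP[h1 h2]; have := cos2Dsin2 t.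
rewrite -(real_normK (num_real (cos t))) -(real_normK (num_real (sin t))).
have := normr_ge0 (cos t); have := normr_ge0 (sin t); nra.
Qed.

Lemma cisN t : cmul (cis (- t)) (cis t) = (1, 0).
Proof. by rewrite -cisD addNr cis0. Qed.

Lemma cis2pi t : cis (t + pi *+ 2) = cis t.
Proof. by rewrite cisD /cis cos2pi sin2pi cmul1. Qed.

Lemma zpow_cont n z : {for z, continuous (zpow n)}.
Proof.
elim: n z => [|n IH] z; first exact: cvg_cst.
rewrite /prop_for /continuous_at.
have c1 : (fun q : C => q.1) @ z --> z.1 by exact: cvg_fst.
have c2 : (fun q : C => q.2) @ z --> z.2 by exact: cvg_snd.
have d1 : (fun q : C => (zpow n q).1) @ z --> (zpow n z).1.
  by apply: (@continuous_comp _ _ _ (zpow n) fst) => //; exact: cvg_fst.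
have d2 : (fun q : C => (zpow n q).2) @ z --> (zpow n z).2.
  by apply: (@continuous_comp _ _ _ (zpow n) snd) => //; exact: cvg_snd.
exact: (cvg_pair (cvgB (cvgM c1 d1) (cvgM c2 d2)) (cvgD (cvgM c1 d2) (cvgM c2 d1))).
Qed.

(** The displacement [|f a - a|] attains its minimum on the compact square, and applying [f] at
    least halves it; so the minimum is 0. *)
Lemma contraction_fixed (f : C -> C) (d : R) : 0 <= d ->
  (forall a, `|a| <= d -> `|f a| <= d) ->
  (forall a b, `|a| <= d -> `|b| <= d -> `|f a - f b| <= 2^-1 * `|a - b|) ->
  exists2 a, `|a| <= d & f a = a.
Proof.
move=> d0 fd fL; pose A := [set a : C | `|a| <= d].
have cA : compact A.
  have -> : A = `[- d, d]%classic `*` `[- d, d]%classic.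
    apply/seteqP; split=> -[x y]; rewrite /A /= normp_le /= !in_itv /= !ler_norml.
      by move=> /andP[].
    by move=> [-> ->].
  by apply: compact_setX; exact: segment_compact.
have cf : {within A, continuous (fun a => `|f a - a|)}.
  apply/subspace_continuousP => x Ax.
  apply/cvgrPdist_lt => e e0; rewrite near_withinE.
  apply/nbhs_ballP; exists (e / 2); rewrite /= ?divr_gt0 // => y; rewrite -ball_normE /= => xy Ay.
  have h := fL x y Ax Ay; apply: le_lt_trans (ler_dist_dist _ _) _.
  have -> : f x - x - (f y - y) = (f x - f y) - (x - y) by rewrite !opprD !opprK addrACA.
  apply: le_lt_trans (ler_normB _ _) _; lra.
have [|a aA am] := compact_EVT_min _ cA cf.
  by exists o; rewrite /A /= normr0.
rewrite inE /A /= in aA; exists a => //.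
have fa := fd a aA; have : f a \in A by rewrite inE.
move=> /am h; have := fL _ _ fa aA; have := normr_ge0 (f a - a).
move=> h1 h2; have : `|f a - a| <= 0 by lra.
by rewrite normr_le0 subr_eq0 => /eqP.
Qed.

End ComplexPairs.

(** * Two points of one fiber at the same height *)

Section FiberCollision.
Variable R : realType.
Local Notation C := (R * R)%type.
Local Notation o := (0 : R * R).

(* Deviation of [1 + zeta -> (1 + zeta)^k] from its linearization, divided by [k] *)
Definition pow_remainder k (w : C) : C := w - k%:R^-1 *: (zpow k (w + (1, 0)) - (1, 0)).

Lemma zpow1 n : zpow n ((1, 0) : C) = (1, 0).
Proof. by elim: n => [//|n IH]; rewrite zpowS IH cmul1. Qed.

(** The complex derivative of the remainder at [w] is [1 - (1 + w)^(k-1)], which vanishes at 0. Its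
    parts are kept below [d / 2] to absorb the factor 2 of [square_lip]. *)
Lemma pow_remainder_lip k (d : R) : (0 < k)%N -> 0 < d ->
  exists2 r, 0 < r & forall a b, `|a| <= r -> `|b| <= r ->
    `|pow_remainder k a - pow_remainder k b| <= d * `|a - b|.
Proof.
move=> k0 d0; have d2 : 0 < d / 2 by rewrite divr_gt0.
have k1 : k%:R != 0 :> R by rewrite pnatr_eq0 -lt0n.
have cz : {for (1, 0) : C, continuous (zpow k.-1)} by exact: zpow_cont.
move/cvgrPdist_le : cz => /(_ _ d2)/nbhs_ballP[r /= r0 Hr].
exists (r / 2); first by rewrite divr_gt0.
have B w : `|w| <= r / 2 -> `|1 - (zpow k.-1 (w + (1, 0))).1| <= d / 2 /\
    `|(zpow k.-1 (w + (1, 0))).2| <= d / 2.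
  move=> wr; have wr' : `|w| < r.
    by apply: le_lt_trans wr _; exact: half_lt.
  have := Hr (w + (1, 0)); rewrite -ball_normE /=.
  rewrite opprD addrCA subrr addr0 normrN zpow1 => /(_ wr').
  by rewrite normp_le /= sub0r normrN => /andP[].
have D1 p i : is_derive p (e R i) (fun q => (pow_remainder k q).1)
    (if i == 0 then 1 - (zpow k.-1 (p + (1, 0))).1 else (zpow k.-1 (p + (1, 0))).2).
  have [a0 a1 _ _] := zpow_derive k (p + (1, 0) : C).
  have c := is_derive_cst0 (k%:R^-1 : R) p (e R i).
  have t j df : is_derive (p + (1, 0) : C) (e R j) (fun q => (zpow k q).1) df ->
      is_derive p (e R j) (fun q => (pow_remainder k q).1) ((j == 0)%:R - k%:R^-1 * df).
    move=> H; have H' := is_derive_translate H.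
    have h := is_derive_subf (is_derive_fst p j) (is_derive_mulf (is_derive_cst0 (k%:R^-1 : R) p (e R j))
       (is_derive_subf H' (is_derive_cst0 (1 : R) p (e R j)))).
    apply: is_derive_eq h _; ring.
  elim/I2_ind: i {c} => /=.
    by apply: is_derive_eq (t _ _ a0) _; rewrite mulrA mulVf // mul1r.
  by apply: is_derive_eq (t _ _ a1) _; rewrite mulrN mulrA mulVf // mul1r sub0r opprK.
have D2 p i : is_derive p (e R i) (fun q => (pow_remainder k q).2)
    (if i == 0 then - (zpow k.-1 (p + (1, 0))).2 else 1 - (zpow k.-1 (p + (1, 0))).1).
  have [_ _ a0 a1] := zpow_derive k (p + (1, 0) : C).
  have t j df : is_derive (p + (1, 0) : C) (e R j) (fun q => (zpow k q).2) df ->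
      is_derive p (e R j) (fun q => (pow_remainder k q).2) ((j == 1)%:R - k%:R^-1 * df).
    move=> H; have H' := is_derive_translate H.
    have h := is_derive_subf (is_derive_snd p j) (is_derive_mulf (is_derive_cst0 (k%:R^-1 : R) p (e R j))
       (is_derive_subf H' (is_derive_cst0 (0 : R) p (e R j)))).
    apply: is_derive_eq h _; ring.
  elim/I2_ind: i => /=.
    by apply: is_derive_eq (t _ _ a0) _; rewrite mulrA mulVf // mul1r sub0r.
  by apply: is_derive_eq (t _ _ a1) _; rewrite mulrA mulVf // mul1r.
move=> a b ar br; rewrite normp_le; apply/andP; split.
  have := @square_lip R (fun q => (pow_remainder k q).1) o (r / 2) (d / 2) _ a b.
  rewrite !subr0 mulrCA mulfV ?pnatr_eq0 // mulr1; apply=> // p; rewrite subr0 => pr i.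
  have [dd ->] := D1 p i; split=> //; have [b1 b2] := B p pr.
  by elim/I2_ind: i {dd}.
have := @square_lip R (fun q => (pow_remainder k q).2) o (r / 2) (d / 2) _ a b.
rewrite !subr0 mulrCA mulfV ?pnatr_eq0 // mulr1; apply=> // p; rewrite subr0 => pr i.
have [dd ->] := D2 p i; split=> //; have [b1 b2] := B p pr.
by elim/I2_ind: i {dd} => //=; rewrite normrN.
Qed.

(** If [v (t + T) - v t] had no zero, it would have constant sign by the intermediate value theorem,
    whereas its values at [0, T, ..., (k-1) T] telescope to 0. *)
Lemma periodic_coincidence (v : R -> R) (k : nat) (T : R) : (0 < k)%N -> continuous v ->
  v (k%:R * T) = v 0 -> exists t, v (t + T) = v t.
Proof.
move=> k0 cv per; apply: contrapT => no.
pose w t := v (t + T) - v t.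
have w0 t : w t != 0.
  by apply/eqP => /eqP; rewrite subr_eq0 => /eqP h; apply: no; exists t.
have cw : continuous w.
  move=> t; apply: cvgB; last exact: cv.
  apply: (@continuous_comp _ _ _ (fun t => t + T) v); last exact: cv.
  by apply: cvgD; [exact: cvg_id|exact: cvg_cst].
have sgn s t : s <= t -> (0 < w s) = (0 < w t).
  move=> st; apply/idP/idP => h; rewrite lt_neqAle eq_sym w0 /= leNgt; apply/negP => h'.
    have [|c _ wc] := @IVT R w s t 0 st (continuous_subspaceT cw).
      by rewrite ge_min (ltW h') orbT le_max (ltW h).
    by have := w0 c; rewrite wc eqxx.
  have [|c _ wc] := @IVT R w s t 0 st (continuous_subspaceT cw).
    by rewrite ge_min (ltW h') le_max (ltW h) orbT.
  by have := w0 c; rewrite wc eqxx.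
have sg t : (0 < w t) = (0 < w 0).
  by case: (leP 0 t) => [/sgn ->|/ltW/sgn ->].
have tel n : \sum_(j < n) w (j%:R * T) = v (n%:R * T) - v 0.
  elim: n => [|n IH]; first by rewrite big_ord0 mul0r subrr.
  rewrite big_ord_recr /= IH /w.
  have -> : n.+1%:R * T = n%:R * T + T by rewrite -natr1; ring.
  by ring.
have := tel k; rewrite per subrr; case: k k0 {per} => // k _; rewrite big_ord_recl /=.
case: (ltrgt0P (w 0)) => h.
- move=> E; have : 0 < w (0 * T) + \sum_(i < k) w ((bump 0 i)%:R * T).
    by rewrite ltr_pwDl ?sumr_ge0 // ?sg // => i _; rewrite ltW // sg.
  by rewrite E ltxx.
- have neg t : w t < 0.
    by rewrite lt_neqAle w0 /= leNgt sg -leNgt ltW.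
  move=> E; have : w (0 * T) + \sum_(i < k) w ((bump 0 i)%:R * T) < 0.
    by rewrite ltr_nwDl // sumr_le0 // => i _; rewrite ltW.
  by rewrite E ltxx.
- by have := w0 0; rewrite h eqxx.
Qed.

Variables (k : nat) (g : C -> C) (u : C -> R) (d1 d2 : 'I_2 -> C -> R).
Hypothesis k2 : (2 <= k)%N.
Hypothesis gO : ordO k.+1 g.
Hypothesis g1 : \forall p \near o^', forall i, is_derive p (e R i) (fun q => (g q).1) (d1 i p).
Hypothesis g2 : \forall p \near o^', forall i, is_derive p (e R i) (fun q => (g q).2) (d2 i p).
Hypothesis d1O : forall i, ordO k (d1 i).
Hypothesis d2O : forall i, ordO k (d2 i).
Hypothesis gc : \forall p \near o^', {for p, continuous g}.
Hypothesis uc : \forall p \near o^', {for p, continuous u}.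

(* For each angle alpha the equation G(z) = s^k e^(i k alpha), G(z) = z^k + g(z), has a unique solution
   z = s e^(i alpha) (1 + zeta) with zeta small, by contraction; it depends continuously on alpha. *)
Lemma fiber_collision (r : R) : 0 < r -> exists p q, [/\ p != q, p != 0 /\ `|p| < r, q != 0 /\ `|q| < r,
  zpow k p + g p = zpow k q + g q & u p = u q].
Proof.
move=> r0; have k0 : (0 < k)%N by exact: ltn_trans k2.
have kR : 0 < k%:R :> R by rewrite ltr0n.
have kn : k%:R != 0 :> R by rewrite gt_eqF.
pose T : R := pi *+ 2 / k%:R.
(* From [k >= 2] the angle [T] lies in []0, pi]]; this is what makes the two points of the fiber
   distinct. *)
have cT : cos T < 1.
  have T0 : 0 < T by rewrite divr_gt0 // pmulrn_lgt0 // pi_gt0.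
  have Tpi : T <= pi.
    rewrite /T ler_pdivrMr // -[leLHS]mulr_natr ler_wpM2l ?ler_nat //.
    by rewrite ltW // pi_gt0.
  rewrite -cos0 ltr_cos // in_itv /= ?lexx ?(ltW T0) ?Tpi //.
  by rewrite ltW // pi_gt0.
(* Measures how far apart [cis (t + T)] and [cis t] are. The relative perturbation [dl] is at most
   [eta / 8], too small to bring the perturbed points together. *)
pose eta := Num.min 1 (1 - cos T); have eta0 : 0 < eta by rewrite lt_min ltr01 subr_gt0.
have q4 : 0 < 4^-1 :> R by rewrite invr_gt0.
have [ra ra0 Hra] := pow_remainder_lip k0 q4.
pose dl := Num.min ra (eta / 8).
have dl0 : 0 < dl by rewrite lt_min ra0 divr_gt0.
have dlra : dl <= ra by rewrite ge_min lexx.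
have dleta : dl <= eta / 8 by rewrite ge_min lexx orbT.
have dl8 : dl <= 8^-1.
  by apply: le_trans dleta _; rewrite ler_pdivrMr // mulVf // ge_min lexx.
have [K K0 HK] : exists2 K : R, 0 <= K & \forall p \near o^',
    [/\ `|g p| <= K * `|p| ^+ k.+1, forall i, `|d1 i p| <= K * `|p| ^+ k &
        forall i, `|d2 i p| <= K * `|p| ^+ k].
  have [[A A0 HA] [B B0 HB] [D D0 HD]] := And3 (ordOP gO) (ordOP (d1O 0)) (ordOP (d1O 1)).
  have [[E E0 HE] [F F0 HF]] := conj (ordOP (d2O 0)) (ordOP (d2O 1)).
  exists (A + B + D + E + F); first by rewrite !addr_ge0.
  apply: filterS3 (filterI HA HB) (filterI HD HE) HF => p [hA hB] [hD hE] hF.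
  have n1 : 0 <= `|p| ^+ k by rewrite exprn_ge0.
  have n2 : 0 <= `|p| ^+ k.+1 by rewrite exprn_ge0.
  have m1 := mulr_ge0 A0 n1; have m2 := mulr_ge0 B0 n1; have m3 := mulr_ge0 D0 n1.
  have m4 := mulr_ge0 E0 n1; have m5 := mulr_ge0 F0 n1.
  have l2 := mulr_ge0 B0 n2; have l3 := mulr_ge0 D0 n2.
  have l4 := mulr_ge0 E0 n2; have l5 := mulr_ge0 F0 n2.
  rewrite !mulrDl; split; first lra.
    by elim/I2_ind; lra.
  by elim/I2_ind; lra.
have /dnbhs0P[r1 r10 Hr1] : \forall p \near o^',
    [/\ [/\ `|g p| <= K * `|p| ^+ k.+1, forall i, `|d1 i p| <= K * `|p| ^+ k &
        forall i, `|d2 i p| <= K * `|p| ^+ k],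
      forall i, is_derive p (e R i) (fun q => (g q).1) (d1 i p),
      forall i, is_derive p (e R i) (fun q => (g q).2) (d2 i p),
      {for p, continuous g} & {for p, continuous u}].
  apply: filterS3 HK (filterI g1 g2) (filterI gc uc) => p ? [? ?] [? ?]; by split.
(* With [8 KK s <= dl], the contribution of [g / s^k] is small enough both for the Lipschitz
   constant [1/4] and for the bound [dl / 2]. *)
pose KK := K * 2 ^+ k * 32 + 1; have KK1 : 0 < KK.
  by rewrite ltr_wpDl // mulr_ge0 // mulr_ge0 // exprn_ge0.
pose s := Num.min (Num.min r r1 / 4) (dl / (8 * KK)).
have mr0 : 0 < Num.min r r1 by rewrite lt_min r0.
have s0 : 0 < s by rewrite lt_min !divr_gt0 // mulr_gt0.
have s2 : 2 * s < Num.min r r1.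
  have : s <= Num.min r r1 / 4 by rewrite ge_min lexx.
  by move: mr0; lra.
have sK : 8 * (KK * s) <= dl.
  have : s <= dl / (8 * KK) by rewrite ge_min lexx orbT.
  by rewrite ler_pdivlMr ?mulr_gt0 //; lra.
pose P (t : R) (w : C) : C := s *: (cmul (cis t) (w + (1, 0))).
(* Dividing [z^k + g(z) = s^k e^(ikt)] at [z = s e^(it) (1 + w)] by [k s^k e^(ikt)] and solving for
   the linear term in [w] turns the equation into [Phi t w = w]. *)
pose Phi t w := pow_remainder k w - (k%:R^-1 * s ^- k) *: cmul (cis (- (k%:R * t))) (g (P t w)).
have PB t w : `|w| <= dl -> `|P t w - s *: cis t| <= s / 4.
  move=> wd; rewrite /P cmulDr cmul1 scalerDr addrK normrZ gtr0_norm // ler_wpM2l ?(ltW s0) //.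
  apply: le_trans (norm_cmul_le _ _) _.
  have := ler_pM (normr_ge0 _) (normr_ge0 _) (cis_norm_le t) (le_trans wd dl8); lra.
(* The square of radius [s / 4] around [s cis t] avoids the origin, because the sup norm of [cis t]
   is at least [1/2]. It is convex, so [square_lip] applies to [g] on it. *)
have PN t p : `|p - s *: cis t| <= s / 4 -> [/\ p != 0, `|p| <= 2 * s & `|p| < Num.min r r1].
  move=> h.
  have h1 : `|s *: cis t| <= s by rewrite normrZ gtr0_norm // ler_piMr ?(ltW s0) // cis_norm_le.
  have h2 : s / 2 <= `|s *: cis t|.
    by rewrite normrZ gtr0_norm // ler_wpM2l ?(ltW s0) // cis_norm_ge.
  have p2 : `|p| <= 2 * s.
    rewrite -(subrK (s *: cis t) p); apply: le_trans (ler_normD _ _) _; lra.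
  split=> //; last exact: le_lt_trans s2.
  apply: contraTneq h => ->; rewrite sub0r normrN -ltNge; lra.
have gLip t p q : `|p - s *: cis t| <= s / 4 -> `|q - s *: cis t| <= s / 4 ->
    `|g p - g q| <= 2 * (K * (2 * s) ^+ k) * `|p - q|.
  have Kb (p' : C) : `|p'| <= 2 * s -> K * `|p'| ^+ k <= K * (2 * s) ^+ k.
    by move=> h; rewrite ler_wpM2l // lerXn2r ?nnegrE // mulr_ge0 ?(ltW s0).
  move=> hp hq; rewrite normp_le; apply/andP; split.
    apply: (@square_lip R (fun q => (g q).1) (s *: cis t) (s / 4)) => // z hz i.
    have [zn z2] := PN t z hz; rewrite lt_min => /andP[_ zr].
    have [[_ b1 _] D1 _ _ _] := Hr1 z zn zr; have [dd ->] := D1 i.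
    by split=> //; apply: le_trans (b1 i) (Kb _ z2).
  apply: (@square_lip R (fun q => (g q).2) (s *: cis t) (s / 4)) => // z hz i.
  have [zn z2] := PN t z hz; rewrite lt_min => /andP[_ zr].
  have [[_ _ b2] _ D2 _ _] := Hr1 z zn zr; have [dd ->] := D2 i.
  by split=> //; apply: le_trans (b2 i) (Kb _ z2).
have sk0 : 0 < s ^+ k by rewrite exprn_gt0.
have cf (x y : R) t (w : C) : `|w| <= y * s ^+ k -> 0 <= y ->
    `|(k%:R^-1 * s ^- k) *: cmul (cis t) w| <= 2 * y.
  move=> wy y0; rewrite normrZ normrM !gtr0_norm ?invr_gt0 //.
  have c2 : `|cmul (cis t) w| <= 2 * (y * s ^+ k).
    apply: le_trans (norm_cmul_le _ _) _; rewrite ler_pM2l //.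
    by rewrite -[leRHS]mul1r ler_pM // cis_norm_le.
  have ki : k%:R^-1 <= 1 :> R by rewrite invf_le1 // ler1n.
  apply: le_trans (_ : 1 * (s ^- k * (2 * (y * s ^+ k))) <= _).
    rewrite -mulrA ler_pM // ?mulr_ge0 ?invr_ge0 ?(ltW kR) ?(ltW sk0) //.
    by rewrite ler_wpM2l // invr_ge0 ltW.
  by rewrite mul1r (mulrA 2) mulrCA mulVf ?mulr1 // gt_eqF.
(* One quarter comes from the remainder of the power map, one quarter from [g]. *)
have PhiL t a b : `|a| <= dl -> `|b| <= dl -> `|Phi t a - Phi t b| <= 2^-1 * `|a - b|.
  move=> ha hb; rewrite /Phi.
  have -> (x y z w : C) : x - y - (z - w) = (x - z) - (y - w) by rewrite !opprD !opprK addrACA.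
  rewrite -scalerBr -cmulBr; apply: le_trans (ler_normB _ _) _.
  have h1 := Hra a b (le_trans ha dlra) (le_trans hb dlra).
  have h2 := gLip t _ _ (PB t a ha) (PB t b hb).
  have h3 : `|P t a - P t b| <= s * (2 * `|a - b|).
    rewrite /P -scalerBr -cmulBr normrZ gtr0_norm // ler_wpM2l ?(ltW s0) //.
    apply: le_trans (norm_cmul_le _ _) _; rewrite ler_pM2l //.
    have -> : a + (1, 0) - (b + (1, 0)) = a - b by rewrite opprD addrACA subrr addr0.
    by rewrite ler_piMl // cis_norm_le.
  pose y := 4 * K * 2 ^+ k * s * `|a - b|.
  have y0 : 0 <= y by rewrite /y !mulr_ge0 ?exprn_ge0 // ltW.
  have h4 : `|g (P t a) - g (P t b)| <= y * s ^+ k.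
    apply: le_trans h2 _; apply: le_trans (_ : 2 * (K * (2 * s) ^+ k) * (s * (2 * `|a - b|)) <= _).
      by rewrite ler_wpM2l // !mulr_ge0 ?exprn_ge0 // mulr_ge0 // ltW.
    by rewrite /y exprMn le_eqVlt; apply/orP; left; apply/eqP; ring.
  have h5 := cf 0 y (- (k%:R * t)) _ h4 y0.
  have h6 : 2 * y <= 4^-1 * `|a - b|.
    have -> : 2 * y = (8 * (K * 2 ^+ k) * s) * `|a - b| by rewrite /y; ring.
    rewrite ler_wpM2r //.
    have : 8 * ((KK - 1) * s) <= dl.
      apply: le_trans sK; rewrite ler_pM2l // ler_wpM2r ?(ltW s0) //; lra.
    rewrite /KK addrK; move: (K * 2 ^+ k) => X; nra.
  lra.
(* [Phi t 0] is at most [dl / 2], as the power remainder vanishes at 0; the contraction adds at most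
   another [dl / 2]. *)
have PhiB t a : `|a| <= dl -> `|Phi t a| <= dl.
  move=> ha; have z0 : `|0 : C| <= dl by rewrite normr0 ltW.
  have h1 := PhiL t a 0 ha z0; rewrite subr0 in h1.
  have q0 : pow_remainder k (0 : C) = 0.
    by rewrite /pow_remainder (add0r (1, 0)) zpow1 subrr scaler0 subr0.
  have PZ := PB t 0 z0; have [pn p2] := PN t _ PZ; rewrite lt_min => /andP[_ pr].
  have [[gb _ _] _ _ _ _] := Hr1 _ pn pr.
  pose y := 2 * K * 2 ^+ k * s.
  have y0 : 0 <= y by rewrite /y !mulr_ge0 ?exprn_ge0 // ltW.
  have h2 : `|g (P t 0)| <= y * s ^+ k.
    apply: le_trans gb _; apply: le_trans (_ : K * (2 * s) ^+ k.+1 <= _).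
      by rewrite ler_wpM2l // lerXn2r ?nnegrE // mulr_ge0 // ltW.
    by rewrite /y exprMn !exprS le_eqVlt; apply/orP; left; apply/eqP; ring.
  have h3 := cf 0 y (- (k%:R * t)) _ h2 y0.
  have h4 : `|Phi t 0| <= 2 * y by rewrite /Phi q0 sub0r normrN.
  have h5 : 2 * y <= dl / 2.
    have : 8 * ((KK - 1) * s) <= dl.
      apply: le_trans sK; rewrite ler_pM2l // ler_wpM2r ?(ltW s0) //; lra.
    rewrite /KK addrK /y; move: (K * 2 ^+ k) (mulrA 2 K (2 ^+ k)) => X <-; nra.
  have := ler_normD (Phi t a - Phi t 0) (Phi t 0); rewrite subrK; lra.
have ex t : exists w, `|w| <= dl /\ Phi t w = w.
  by have [w ? ?] := contraction_fixed (ltW dl0) (PhiB t) (PhiL t); exists w.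
pose ze t := sval (cid (ex t)).
have zeB t : `|ze t| <= dl by exact: (svalP (cid (ex t))).1.
have zeF t : Phi t (ze t) = ze t by exact: (svalP (cid (ex t))).2.
have uniq t w : `|w| <= dl -> Phi t w = w -> w = ze t.
  move=> wb wf; have := PhiL t _ _ wb (zeB t); rewrite wf zeF => h.
  have := normr_ge0 (w - ze t) => h'; have : `|w - ze t| <= 0 by lra.
  by rewrite normr_le0 subr_eq0 => /eqP.
pose z t := P t (ze t).
have zN t := PN t _ (PB t _ (zeB t)).
have G t : zpow k (z t) + g (z t) = s ^+ k *: cis (k%:R * t).
  have := zeF t; rewrite /Phi /pow_remainder -/(z t) => /eqP.
  rewrite -addrA -opprD subr_eq -subr_eq0 opprD addrA subrr sub0r oppr_eq0.
  rewrite -scalerA -scalerDr scaler_eq0 invr_eq0 (negbTE kn) /= addrAC subr_eq0 => /eqP h.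
  have -> : zpow k (z t) = s ^+ k *: cmul (cis (k%:R * t)) (zpow k (ze t + (1, 0))).
    by rewrite /z /P zpow_scale zpow_cmul zpow_cis.
  have -> : g (z t) = s ^+ k *: cmul (cis (k%:R * t)) (s ^- k *: cmul (cis (- (k%:R * t))) (g (z t))).
    by rewrite cmulZr scalerA mulfV ?gt_eqF // scale1r cmulA (cmulC (cis (k%:R * t))) cisN cmulC cmul1.
  by rewrite -scalerDr -cmulDr h cmul1.
have cisc : continuous (@cis R).
  move=> t; exact: (cvg_pair (@continuous_cos R t) (@continuous_sin R t)).
have cmulc (f h : R -> C) t : f @ t --> f t -> h @ t --> h t -> (fun x => cmul (f x) (h x)) @ t --> cmul (f t) (h t).
  move=> cf' ch.
  have f1 : (fun x => (f x).1) @ t --> (f t).1 by apply: cvg_comp cf' _; exact: cvg_fst.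
  have f2 : (fun x => (f x).2) @ t --> (f t).2 by apply: cvg_comp cf' _; exact: cvg_snd.
  have h1 : (fun x => (h x).1) @ t --> (h t).1 by apply: cvg_comp ch _; exact: cvg_fst.
  have h2 : (fun x => (h x).2) @ t --> (h t).2 by apply: cvg_comp ch _; exact: cvg_snd.
  exact: (cvg_pair (cvgB (cvgM f1 h1) (cvgM f2 h2)) (cvgD (cvgM f1 h2) (cvgM f2 h1))).
have Pc w t : (fun x => P x w) @ t --> P t w.
  rewrite /P; apply: cvgZr; apply: cmulc; [exact: cisc|exact: cvg_cst].
have Phic w t : `|w| <= dl -> (fun x => Phi x w) @ t --> Phi t w.
  move=> wd; rewrite /Phi; apply: cvgB; first exact: cvg_cst.
  apply: cvgZr; apply: cmulc.
    have cl : (fun x => - (k%:R * x)) @ t --> - (k%:R * t).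
      by apply: cvgN; apply: cvgM; [exact: cvg_cst|exact: cvg_id].
    exact: cvg_comp cl (cisc _).
  have [pn p2] := PN t _ (PB t w wd); rewrite lt_min => /andP[_ pr].
  have [_ _ _ cg _] := Hr1 _ pn pr.
  apply: cvg_comp (Pc w t) cg.
(* The contraction gives [|ze t - ze x| <= 2 |Phi t (ze t) - Phi x (ze t)|], and [Phi] is continuous
   in the angle. *)
have zec : continuous ze.
  move=> t; apply/cvgrPdist_lt => ep ep0.
  have ep2 : 0 < ep / 2 by rewrite divr_gt0.
  move/cvgrPdist_lt : (Phic (ze t) t (zeB t)) => /(_ _ ep2); apply: filterS => x hx.
  rewrite zeF in hx.
  have h1 := PhiL x _ _ (zeB t) (zeB x); rewrite zeF in h1.
  have := ler_normD (ze t - Phi x (ze t)) (Phi x (ze t) - ze x); rewrite subrKA; lra.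
have zc : continuous z.
  move=> t; rewrite /z /P; apply: cvgZr; apply: cmulc; first exact: cisc.
  by apply: cvgD; [exact: zec|exact: cvg_cst].
have vc : continuous (u \o z).
  move=> t; apply: cvg_comp (zc t) _.
  have [pn p2] := zN t; rewrite lt_min => /andP[_ pr].
  by have [_ _ _ _] := Hr1 _ pn pr.
have kT : k%:R * T = pi *+ 2 by rewrite /T mulrC divfK.
(* Uniqueness of the fixed point makes [ze], hence [z], periodic. A shift by [T] moves along the
   fiber because [k T = 2 pi], and [k] such shifts close up. *)
have zper t : z (t + pi *+ 2) = z t.
  rewrite /z /P cis2pi; congr (_ *: cmul _ (_ + _)); apply: uniq => //.
  rewrite -[RHS]zeF /Phi /P cis2pi.
  have -> // : cis (- (k%:R * (t + pi *+ 2))) = cis (- (k%:R * t)).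
  have H (n : nat) (x : R) : cis (x + n%:R * pi *+ 2) = cis x.
    elim: n => [|n IH]; first by rewrite mul0r mul0rn addr0.
    by rewrite -natr1 mulrDl mul1r mulrnDl addrA cis2pi IH.
  rewrite -(H k (- (k%:R * (t + pi *+ 2)))); congr cis.
  by rewrite mulrDr opprD mulrnAr subrK.
have vper : (u \o z) (k%:R * T) = (u \o z) 0.
  by rewrite /= kT -[pi *+ 2]add0r zper.
have [t vt] := periodic_coincidence k0 vc vper.
have [p1 p2 p3] := zN (t + T); have [q1 q2 q3] := zN t.
exists (z (t + T)), (z t); split=> //.
- apply/eqP => E.
  (* Equality of the two points would bound the chord from [cis t] to [cis (t + T)] by [4 dl],
     against its squared length [2 - 2 cos T]. *)
  have h : cis (t + T) - cis t = cmul (cis t) (ze t) - cmul (cis (t + T)) (ze (t + T)).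
    have sn : s != 0 by rewrite gt_eqF.
    move: E; rewrite /z /P => /(scalerI sn); rewrite !cmulDr !cmul1 => E.
    apply/eqP; rewrite subr_eq addrAC eq_sym subr_eq addrC; apply/eqP.
    by rewrite [LHS]addrC [RHS]addrC.
  have B (x : R) : `|cmul (cis x) (ze x)| <= 2 * dl.
    apply: le_trans (norm_cmul_le _ _) _; rewrite ler_pM2l // -[leRHS]mul1r.
    by rewrite ler_pM // ?cis_norm_le // zeB.
  have n4 : `|cis (t + T) - cis t| <= 4 * dl.
    by rewrite h; apply: le_trans (ler_normB _ _) _; have := B t; have := B (t + T); lra.
  have n5 : `|cis (t + T) - cis t| <= eta / 2 by lra.
  move: n5; rewrite normp_le /= cosD sinD => /andP[m1 m2].
  have e1 : eta <= 1 by rewrite ge_min lexx.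
  have e2 : eta <= 1 - cos T by rewrite ge_min lexx orbT.
  have i1 := cos2Dsin2 t; have i2 := cos2Dsin2 T.
  have sq (x : R) : `|x| <= eta / 2 -> x ^+ 2 <= (eta / 2) ^+ 2.
    by move=> hx; rewrite -(real_normK (num_real x)); exact: ler_sqr_ge0.
  have hX := sq _ m1; have hY := sq _ m2.
  have E2 : (cos t * cos T - sin t * sin T - cos t) ^+ 2 +
      (sin t * cos T + cos t * sin T - sin t) ^+ 2 = 2 - 2 * cos T.
    transitivity ((cos t ^+ 2 + sin t ^+ 2) * (cos T ^+ 2 + sin T ^+ 2 + 1 - 2 * cos T)); first by ring.
    by rewrite i1 i2; ring.
  have := lerD hX hY; rewrite E2 expr2 => hh.
  have e3 : eta * eta <= eta by rewrite ler_piMr // ltW.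
  lra.
- by split=> //; move: p3; rewrite lt_min => /andP[].
- by split=> //; move: q3; rewrite lt_min => /andP[].
- by rewrite !G mulrDr kT cis2pi.
Qed.

End FiberCollision.

(** * Asymptotics at the umbilic point *)

Section Asymptotics.
Variable R : realType.
Local Notation o := (0 : R * R).

Lemma ordOM_le k m n (a f : R * R -> R) : (k <= m + n)%N -> ordO m a -> ordO n f ->
  ordO k (fun p => a p * f p).
Proof. by move=> h A F; exact: ordOW h (ordOM A F). Qed.

Lemma ordOZ_le (W : normedModType R) k m n (a : R * R -> R) (f : R * R -> W) :
  (k <= m + n)%N -> ordO m a -> ordO n f -> ordO k (fun p => a p *: f p).
Proof. by move=> h A F; exact: ordOW h (ordOZ A F). Qed.

Lemma ordO_dot_le k m n (f g : R * R -> 'rV[R]_3) : (k <= m + n)%N -> ordO m f -> ordO n g ->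
  ordO k (fun p => dot (f p) (g p)).
Proof. by move=> h F G; exact: ordOW h (ordO_dot F G). Qed.

Lemma ordO_inv0 (f : R * R -> R) (l : R) : l != 0 -> f @ o^' --> l -> ordO 0 (fun p => (f p)^-1).
Proof. by move=> l0 F; apply: cvg_ordO0; apply: cvgV F. Qed.

(* Landau's [f = Omega(|p|^k)] *)
Definition ordOmega (W : normedModType R) k (f : R * R -> W) :=
  exists2 d : R, 0 < d & \forall p \near o^', d * `|p| ^+ k <= `|f p|.

Lemma ordOmega_sub (W : normedModType R) k (f g : R * R -> W) :
  ordOmega k f -> ordO k.+1 (fun p => g p - f p) -> ordOmega k g.
Proof.
move=> [d d0 H] /ordOP[C C0 G]; exists (d / 2); first by rewrite divr_gt0.
have D0 : 0 < d / (2 * (C + 1)) by rewrite divr_gt0 // mulr_gt0 // ltr_wpDl.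
apply: filterS3 H G (dnbhs0_normlt D0) => p h1 h2 h3.
have C1 : 0 < C + 1 by rewrite ltr_wpDl.
have h4 : C * `|p| <= d / 2.
  apply: le_trans (_ : (C + 1) * `|p| <= _); first by rewrite ler_wpM2r // lerDl.
  by move: h3; rewrite ltr_pdivlMr ?mulr_gt0 // => h3; lra.
have h5 : C * `|p| ^+ k.+1 <= d / 2 * `|p| ^+ k.
  by rewrite exprS mulrA ler_wpM2r // exprn_ge0.
have : `|f p| <= `|g p| + `|g p - f p|.
  by rewrite distrC -{1}(subrK (g p) (f p)) addrC; exact: ler_normD.
lra.
Qed.

Lemma ordOmegaZ (W : normedModType R) k (c : R) (f : R * R -> W) : c != 0 ->
  ordOmega k f -> ordOmega k (fun p => c *: f p).
Proof.
move=> c0 [d d0 H]; have c1 : 0 < `|c| by rewrite normr_gt0.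
exists (`|c| * d); first by rewrite mulr_gt0.
by apply: filterS H => p h; rewrite normrZ -mulrA ler_pM2l.
Qed.

Lemma ordOmega_le (W V : normedModType R) k (C : R) (f : R * R -> W) (g : R * R -> V) :
  0 < C -> (\forall p \near o^', `|f p| <= C * `|g p|) -> ordOmega k f -> ordOmega k g.
Proof.
move=> C0 fg [d d0 H]; exists (d / C); first by rewrite divr_gt0.
apply: filterS2 fg H => p h1 h2.
rewrite mulrAC ler_pdivrMr // (mulrC `|g p|); exact: le_trans h2 h1.
Qed.

Lemma ordO_div_sqr k m (f : R * R -> R) (y : R * R -> 'rV[R]_3) :
  ordOmega k y -> ordO (k + k + m) f -> ordO m (fun p => f p / dot (y p) (y p)).
Proof.
move=> [d d0 H] [C F]; exists (C / d ^+ 2).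
apply: filterS3 H F (dnbhs0_neq R) => p h1 h2 pn.
have pp : 0 < `|p| by rewrite normr_gt0.
have h3 : d ^+ 2 * `|p| ^+ (k + k) <= dot (y p) (y p).
  apply: le_trans (sqr_norm_le_dot _); rewrite exprD -expr2 -exprMn.
  by apply: ler_sqr_ge0 => //; rewrite mulr_ge0 ?exprn_ge0 // ltW.
have h0 : 0 < d ^+ 2 * `|p| ^+ (k + k) by rewrite mulr_gt0 // exprn_gt0.
have y0 : 0 < dot (y p) (y p) by exact: lt_le_trans h3.
rewrite normrM normfV (gtr0_norm y0) ler_pdivrMr //.
apply: le_trans (h2) _; rewrite exprD.
have C0 : 0 <= C * `|p| ^+ m / d ^+ 2.
  rewrite divr_ge0 ?sqr_ge0 //.
  have : 0 <= C * `|p| ^+ (k + k + m) by exact: le_trans (normr_ge0 _) h2.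
  by rewrite exprD mulrCA pmulr_rge0 // exprn_gt0.
apply: le_trans (_ : C * `|p| ^+ m / d ^+ 2 * (d ^+ 2 * `|p| ^+ (k + k)) <= _).
  rewrite le_eqVlt; apply/orP; left; apply/eqP; field; by rewrite gt_eqF.
by rewrite [C / _ * _]mulrAC ler_wpM2l.
Qed.

(** The leading term has Euclidean modulus [|a + i b| |z|^k]; the [/ 2] under the root pays for
    passing to the sup norm. *)
Lemma ordOmega_taylor k a b (P Q : R * R -> R) : (a != 0) || (b != 0) ->
  ordO k.+1 (taylor_re k a b P) -> ordO k.+1 (taylor_im k a b Q) ->
  ordOmega k (fun p => (P p, Q p) : R * R).
Proof.
move=> ab /ordOP[C C0 hP] /ordOP[D D0 hQ].
pose M p : R * R := (a * (zpow k p).1 - b * (zpow k p).2, a * (zpow k p).2 + b * (zpow k p).1).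
have n0 : 0 < a ^+ 2 + b ^+ 2.
  rewrite lt_neqAle addr_ge0 ?sqr_ge0 // andbT eq_sym paddr_eq0 ?sqr_ge0 // !sqrf_eq0.
  by rewrite negb_and.
have s0 : 0 < Num.sqrt ((a ^+ 2 + b ^+ 2) / 2) by rewrite sqrtr_gt0 divr_gt0.
apply: (@ordOmega_sub _ k M).
  exists (Num.sqrt ((a ^+ 2 + b ^+ 2) / 2)) => //; apply: nearW => p.
  rewrite -(ler_pXn2r (_ : (0 < 2)%N)) ?nnegrE ?mulr_ge0 ?exprn_ge0 ?(ltW s0) //.
  rewrite exprMn sqr_sqrtr ?divr_ge0 ?(ltW n0) //.
  have nq : (`|p| ^+ k) ^+ 2 <= pdot p p ^+ k.
    rewrite exprAC lerXn2r ?nnegrE ?sqr_ge0 ?pdot_ge0 //.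
    exact: sqr_normp_le.
  have E : (M p).1 ^+ 2 + (M p).2 ^+ 2 = (a ^+ 2 + b ^+ 2) * pdot p p ^+ k.
    by rewrite -zpow_norm /M /=; ring.
  have h1 : (M p).1 ^+ 2 <= `|M p| ^+ 2.
    by rewrite -(real_normK (num_real (M p).1)); apply: ler_sqr_ge0 => //; exact: normp1_le.
  have h2 : (M p).2 ^+ 2 <= `|M p| ^+ 2.
    by rewrite -(real_normK (num_real (M p).2)); apply: ler_sqr_ge0 => //; exact: normp2_le.
  have := ler_wpM2l (ltW n0) nq; lra.
exists (C + D); apply: filterS2 hP hQ => p h1 h2; rewrite mulrDl normp_le /=.
have e1 : 0 <= C * `|p| ^+ k.+1 by rewrite mulr_ge0 ?exprn_ge0.
have e2 : 0 <= D * `|p| ^+ k.+1 by rewrite mulr_ge0 ?exprn_ge0.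
by apply/andP; split; [move: h1; rewrite /taylor_re|move: h2; rewrite /taylor_im]; lra.
Qed.

Variables (eps : R) (Z Zt : R * R -> 'rV[R]_3) (c : R).
Variables (W : R * R -> 'rV[R]_3) (rho phi : R * R -> R).
Hypothesis e0 : 0 < eps.
Hypothesis mZ : conformal_minimal_immersion (disk eps) Z.
Hypothesis uZ : umbilic Z o.
Hypothesis mZt : conformal_minimal_immersion (pdisk eps) Zt.
Hypothesis S : ribaucour_system (pdisk eps) Z Zt c W rho phi.
Local Notation N := (gauss Z).
Let cZ : conformal_immersion (disk eps) Z := mZ.1.
Let oD : open (disk eps) := @disk_open R eps.
Let oP : open (pdisk eps) := @pdisk_open R eps.
Let Do : disk eps o := disk0 e0.

(** The [i]-th partial derivative of the height function [Z.N(0)], not the height itself. *)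
Definition height i p : R := dot (pd i Z p) (N o).

Lemma height_is_derive i j p : disk eps p ->
  is_derive p (e R j) (height i) (dot (pd j (pd i Z) p) (N o)).
Proof.
move=> Up; apply: is_derive_eq (is_derive_dot (ddZ_is_derive cZ j i Up) (is_derive_cst0 (N o) p (e R j))) _.
by rewrite dot0r addr0.
Qed.

Lemma smooth_height i : smooth (disk eps) (height i).
Proof.
by move=> k; apply: Ck_dot => //; [exact: smooth_pd cZ.1 k|exact: Ck_cst].
Qed.

(** The Cauchy-Riemann equations are the harmonicity of [Z] and the symmetry of its second
    derivatives. *)
Lemma height_holomorphic : holomorphic (disk eps) (height 0) (fun p => - height 1 p).
Proof.
split; first exact: smooth_height.
  by move=> k; exact: CkN oD (smooth_height 1 k).
move=> p Up; rewrite !(is_derive_pd (is_derive_oppf (height_is_derive _ _ Up))).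
rewrite !(is_derive_pd (height_is_derive _ _ Up)) opprK (ddZC oD cZ 1 0) //; split=> //.
apply/eqP; rewrite -subr_eq0 opprK -dotDl.
by rewrite (minimal_harmonic oD cZ mZ.2 Up) dot0l.
Qed.

(** Where [dN = 0] the equation of [riccati_x] reads [dx = - dZ], so [Zt = Z + x] would have zero
    derivative, although it is an immersion. *)
Lemma dgauss_neq0 p : pdisk eps p -> ~ (forall i, pd i N p = 0).
Proof.
move=> Up H; have [c0 _] := S.
have D : is_derive p (e R 0) Zt 0.
  apply: (@near_eq_is_derive _ _ _ (fun q => Z q + riccati_x c W rho q)).
    apply: filterS (open_nbhs_nbhs (conj oP Up)) => q Uq.
    by rewrite (riccati_x_spec S Uq).1.
  apply: is_derive_eq (is_derive_addf (dZ_is_derive cZ 0 (pdisk_disk Up)) ((riccati_x_spec S Up).2 0)) _.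
  by rewrite H !(scaler0, dot0r, mulr0, scale0r, subr0) addrN.
have [l0 Hl] := conformal_dot mZt.1 Up.
have := Hl 0 0; rewrite (is_derive_pd D) dot0l mulr1n => E.
by move: l0; rewrite -E ltxx.
Qed.

(** Flatness makes the pair vanish near the origin. Then [N(0)] is normal to the surface at all
    nearby points, and differentiating [dZ.N(0) = 0] gives [dN = 0] there. *)
Lemma height_not_flat : ~ (forall k, ordO k (height 0) /\ ordO k (fun p => - height 1 p)).
Proof.
move=> fl; have H := flat_holomorphic e0 height_holomorphic fl.
have hz q : disk (eps / 2) q -> forall i, height i q = 0.
  move=> qd; have [->|qn] := eqVneq q o.
    by move=> i; rewrite /height dotC (gauss_dot0 cZ).
  have [h1 h2] := H q qd qn; apply: I2_ind => //.
  by apply/eqP; rewrite -oppr_eq0 h2.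
have e2 : 0 < eps / 2 by rewrite divr_gt0.
have [p pn pd2] := dnbhs0_ex (near_pdisk e2).
have pd2' : disk (eps / 2) p by case: pd2.
have dsub q : disk (eps / 2) q -> disk eps q.
  rewrite /disk /= => h; apply: lt_le_trans h _; rewrite ler_sqr_ge0 // ?(ltW e2) //; lra.
have Up : disk eps p := dsub p pd2'.
have nN : N o = dot (N o) (N p) *: N p.
  have F := gauss_frame cZ Up.
  rewrite {1}(frame_decomp (N o) F) !(dotC (N o) (pd _ Z p)).
  by rewrite -![dot (pd _ Z p) (N o)]/(height _ p) !hz // !mul0r !scale0r !add0r.
have n0 : dot (N o) (N p) != 0.
  apply/eqP => E; have := gauss_unit cZ Do; rewrite nN E scale0r dot0l => /eqP.
  by rewrite eq_sym oner_eq0.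
apply: (@dgauss_neq0 p); first by apply/pdiskP.
move=> j; apply: (tangent_ext cZ Up) => [i|]; last by rewrite (dgauss_normal oD cZ) // dot0l.
rewrite (dgauss_dot oD cZ) // dot0l.
have := is_derive_local (@disk_open _ (eps / 2)) pd2' (fun q qd => hz q qd i)
  (height_is_derive i j Up) (is_derive_cst0 (0 : R) p (e R j)).
rewrite {1}nN dotZr (dotC (pd j (pd i Z) p)) => /eqP; rewrite mulf_eq0 (negbTE n0) /= => /eqP ->.
by rewrite oppr0.
Qed.

(** [k] is the least order of a nonzero derivative: order 0 vanishes since [N(0)] is normal, order 1
    since [dN(0) = 0]. The expansion of the derivative is a separate application of [taylor_ordO],
    since an [O] bound cannot be differentiated. *)
Lemma height_order : exists (k : nat) (a b : R), [/\ (2 <= k)%N, (a != 0) || (b != 0),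
  ordO k.+1 (taylor_re k a b (height 0)) /\ ordO k.+1 (taylor_im k a b (fun p => - height 1 p)) &
  ordO k (taylor_re k.-1 (k%:R * a) (k%:R * b) (pd 0 (height 0))) /\
  ordO k (taylor_im k.-1 (k%:R * a) (k%:R * b) (pd 0 (fun p => - height 1 p)))].
Proof.
have hH := height_holomorphic.
pose z j := (iter j (pd 0) (height 0) o != 0) || (iter j (pd 0) (fun p => - height 1 p) o != 0).
have [ex|nex] := pselect (exists j, z j); last first.
  exfalso; apply: height_not_flat => k.
  have zj j : iter j (pd 0) (height 0) o = 0 /\ iter j (pd 0) (fun p => - height 1 p) o = 0.
    have : ~~ z j by apply/negP => h; apply: nex; exists j.
    by rewrite /z negb_or !negbK => /andP[/eqP -> /eqP ->].
  have [h1 h2] := @taylor_ordO R _ k _ _ oD Do hH (fun j _ => zj j).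
  have [z1 z2] := zj k; rewrite z1 z2 !mul0r in h1 h2.
  split; apply: (ordOW (leqnSn k)).
    by apply: ordO_ext h1 => p; rewrite /taylor_re; ring.
  by apply: ordO_ext h2 => p; rewrite /taylor_im; ring.
have [k zk kmin] := ex_minnP ex.
have zj j : (j < k)%N -> iter j (pd 0) (height 0) o = 0 /\ iter j (pd 0) (fun p => - height 1 p) o = 0.
  move=> jk; have : ~~ z j by apply/negP => /kmin; rewrite leqNgt jk.
  by rewrite /z negb_or !negbK => /andP[/eqP -> /eqP ->].
have k2 : (2 <= k)%N.
  case: k zk {kmin zj} => [|[|k]] //.
    by rewrite /z /= /height !(dotC (pd _ Z o)) !(gauss_dot0 cZ) // oppr0 eqxx.
  rewrite /z /= (is_derive_pd (height_is_derive 0 0 Do)).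
  rewrite (is_derive_pd (is_derive_oppf (height_is_derive 1 0 Do))) !(dotC _ (N o)).
  have hz i j : dot (N o) (pd i (pd j Z) o) = 0.
    apply/eqP; rewrite -oppr_eq0 -(dgauss_dot oD cZ) //.
    by rewrite (umbilic_dgauss e0 mZ uZ) dot0l.
  by rewrite !hz oppr0 eqxx.
pose a := iter k (pd 0) (height 0) o / (k`!)%:R.
pose b := iter k (pd 0) (fun p => - height 1 p) o / (k`!)%:R.
exists k, a, b; split=> //.
- have f0 : (k`!%:R : R) != 0 by rewrite pnatr_eq0 -lt0n fact_gt0.
  by rewrite /a /b !mulf_eq0 !invr_eq0 (negbTE f0) !orbF.
- exact: taylor_ordO oD Do hH zj.
case: k k2 @a @b zj {zk kmin} => // k k2 a b zj.
have [|] := @taylor_ordO R _ k _ _ oD Do (holomorphic_pd oD hH).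
  by move=> j jk; rewrite -!iterSr; exact: zj.
rewrite -!iterSr /=.
have fk : ((k.+1)`!%:R : R) = k.+1%:R * (k`!)%:R by rewrite factS natrM.
have f0 : (k`!%:R : R) != 0 by rewrite pnatr_eq0 -lt0n fact_gt0.
have kn : (k.+1%:R : R) != 0 by rewrite pnatr_eq0.
have e1 (x : R) : x / (k`!)%:R = k.+1%:R * (x / ((k.+1)`!)%:R).
  by rewrite fk; move: kn; move: (k.+1%:R : R) => K Kn; field; rewrite f0 Kn.
by rewrite !(e1 (pd 0 _ o)).
Qed.

End Asymptotics.

(** * Orders of the Gauss map and of [y] at the origin *)

Section GaussExpansion.
Variable R : realType.
Local Notation o := (0 : R * R).
Variables (eps : R) (Z : R * R -> 'rV[R]_3).
Hypothesis e0 : 0 < eps.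
Hypothesis mZ : conformal_minimal_immersion (disk eps) Z.
Local Notation N := (gauss Z).
Let cZ : conformal_immersion (disk eps) Z := mZ.1.
Let oD : open (disk eps) := @disk_open R eps.
Let Do : disk eps o := disk0 e0.
Let sN : smooth (disk eps) N := smooth_gauss oD cZ.
Variables (k : nat) (a b : R).
Hypothesis k2 : (2 <= k)%N.
Hypothesis ab : (a != 0) || (b != 0).
Hypothesis hP : ordO k.+1 (taylor_re k a b (height Z 0)).
Hypothesis hQ : ordO k.+1 (taylor_im k a b (fun p => - height Z 1 p)).
Hypothesis dP : ordO k (taylor_re k.-1 (k%:R * a) (k%:R * b) (pd 0 (height Z 0))).
Hypothesis dQ : ordO k (taylor_im k.-1 (k%:R * a) (k%:R * b) (pd 0 (fun p => - height Z 1 p))).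

Lemma near_disk : \forall p \near o^', disk eps p.
Proof. by apply: filterS (near_pdisk e0) => p; exact: pdisk_disk. Qed.

Lemma taylor_re_bound n (x w : R) (P : R * R -> R) : ordO n (taylor_re n x w P) -> ordO n P.
Proof.
move=> H; have [z1 z2] := @ordO_zpow R n.
apply: (@ordO_ext _ _ _ (fun p => taylor_re n x w P p + (x * (zpow n p).1 - w * (zpow n p).2))).
  by move=> p; rewrite /taylor_re subrK.
by apply: ordOD => //; apply: ordOB; exact: ordOMc.
Qed.

Lemma taylor_im_bound n (x w : R) (P : R * R -> R) : ordO n (taylor_im n x w P) -> ordO n P.
Proof.
move=> H; have [z1 z2] := @ordO_zpow R n.
apply: (@ordO_ext _ _ _ (fun p => taylor_im n x w P p + (x * (zpow n p).2 + w * (zpow n p).1))).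
  by move=> p; rewrite /taylor_im subrK.
by apply: ordOD => //; apply: ordOD; exact: ordOMc.
Qed.

Lemma height_ordO i : ordO k (height Z i).
Proof.
elim/I2_ind: i; first exact: taylor_re_bound (ordOW (leqnSn k) hP).
have := ordON (taylor_im_bound (ordOW (leqnSn k) hQ)).
by apply: ordO_ext => p; rewrite opprK.
Qed.

Lemma pd_height i j p : disk eps p -> pd j (height Z i) p = dot (pd j (pd i Z) p) (N o).
Proof. by move=> Up; apply: is_derive_pd; exact: (height_is_derive mZ i j Up). Qed.

Lemma dheight_ordO i j : ordO k.-1 (fun p => dot (pd j (pd i Z) p) (N o)).
Proof.
have h0 := taylor_re_bound (ordOW (leq_pred k) dP).
have h1 := taylor_im_bound (ordOW (leq_pred k) dQ).
have h00 : ordO k.-1 (fun p => dot (pd 0 (pd 0 Z) p) (N o)).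
  by apply: ordO_near h0; apply: filterS near_disk => p Up; rewrite pd_height.
have h10 : ordO k.-1 (fun p => dot (pd 0 (pd 1 Z) p) (N o)).
  apply: ordO_near (ordON h1); apply: filterS near_disk => p Up.
  by rewrite (is_derive_pd (is_derive_oppf (height_is_derive mZ 1 0 Up))) opprK.
elim/I2_ind: i; elim/I2_ind: j => //.
  apply: ordO_near h10; apply: filterS near_disk => p Up.
  by rewrite (ddZC oD cZ 1 0).
apply: ordO_near (ordON h00); apply: filterS near_disk => p Up.
apply/eqP; rewrite -subr_eq0 -opprD oppr_eq0 -dotDl.
by rewrite (minimal_harmonic oD cZ mZ.2 Up) dot0l.
Qed.

Local Notation D := (fun p => N p - N o).

Lemma dgauss_dot_dZ i p : disk eps p -> dot (D p) (pd i Z p) = - height Z i p.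
Proof. by move=> Up; rewrite dotBl (gauss_dot0 cZ) // sub0r /height dotC. Qed.

Lemma ordO0_pdZ i : ordO 0 (pd i Z).
Proof. exact: (ordO0_pd e0 i cZ.1). Qed.

Lemma ordO0_pdpdZ i j : ordO 0 (pd j (pd i Z)).
Proof.
have s : smooth (disk eps) (pd i Z) by exact: smooth_pd cZ.1.
exact: (ordO0_pd e0 j s).
Qed.

Lemma ordO0_gauss : ordO 0 N.
Proof. by apply: continuous_ordO0; exact: smooth_cont sN Do. Qed.

Lemma ordO0_inv_confactor : ordO 0 (fun p => (confactor Z p)^-1).
Proof.
have ln := confactor_neq0 cZ Do.
have c := continuous_cvg_dnbhs (smooth_cont (smooth_confactor oD cZ) Do).
exact: ordO_inv0 ln c.
Qed.

(** The unit vector [N(0)] in the frame at [p] has tangential components given by [height]. With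
    [n = N.N(0)] this yields [1 - n^2 = (height_0^2 + height_1^2) / confactor], and [1 + n] tends to
    2. *)
Lemma gauss_normal_ordO : ordO (k + k) (fun p => 1 - dot (N p) (N o)).
Proof.
pose n p := dot (N p) (N o).
have n1 : ordO 1 (fun p => n p - 1).
  apply: (@ordO_near _ _ _ (fun p => dot (D p) (N o))).
    by apply: nearW => p; rewrite /n dotBl (gauss_unit cZ Do).
  exact: (@ordO_dot _ 1 0 _ _ (smooth_subordO oD Do sN) (ordO_cst _)).
have cn : (fun p => 1 + n p) @ o^' --> (1 + 1 : R).
  by apply: cvgD; [exact: cvg_cst|exact: cvg_subordO n1].
have i2 : (1 + 1 : R) != 0 by rewrite -mulr2n pnatr_eq0.
have bi := ordO_inv0 i2 cn.
have nz : \forall p \near o^', 1 + n p != 0.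
  have /cvgr0Pnorm_lt/(_ 1 ltr01) := ordO_cvg0 n1; apply: filterS => p h.
  by apply: contraTneq h => h; rewrite -leNgt (_ : n p - 1 = - 2) ?normrN ?ger0_norm //; lra.
apply: (@ordO_near _ _ _ (fun p => ((height Z 0 p * height Z 0 p + height Z 1 p * height Z 1 p)
   * (confactor Z p)^-1) * (1 + n p)^-1)).
  apply: filterS2 nz near_disk => p np Up.
  have F := gauss_frame cZ Up; have E := frame_decomp (N o) F.
  have ln := confactor_neq0 cZ Up.
  have E1 : 1 = (height Z 0 p * height Z 0 p + height Z 1 p * height Z 1 p) / confactor Z p + n p * n p.
    rewrite -(gauss_unit cZ Do) {1}E !dot_lin /height /n !(dotC (N o)); field.
    exact: ln.
  apply: (mulIf np); rewrite mulfVK //.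
  have -> : (1 - dot (N p) (N o)) * (1 + n p) = 1 - n p * n p by rewrite -/(n p); ring.
  by rewrite {1}E1 addrK.
have h i := height_ordO i.
have hh : ordO (k + k) (fun p => height Z 0 p * height Z 0 p + height Z 1 p * height Z 1 p).
  by apply: ordOD; exact: ordOM.
by rewrite -[(k + k)%N]addn0; apply: ordOM bi; rewrite -[(k + k)%N]addn0; apply: ordOM => //; exact: ordO0_inv_confactor.
Qed.

(** Read off the same decomposition of [N(0)]: tangential parts of order [k], normal defect of order
    [2 k]. *)
Lemma gauss_ordO : ordO k D.
Proof.
apply: (@ordO_near _ _ _ (fun p => (1 - dot (N p) (N o)) *: N p
   - (height Z 0 p * (confactor Z p)^-1) *: pd 0 Z p - (height Z 1 p * (confactor Z p)^-1) *: pd 1 Z p)).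
  apply: filterS near_disk => p Up.
  have F := gauss_frame cZ Up; rewrite {2}(frame_decomp (N o) F) /height !(dotC (N o)).
  by rewrite scalerBl scale1r; apply/rowP => j; rewrite !mxE; ring.
have B i : ordO k (fun p => (height Z i p * (confactor Z p)^-1) *: pd i Z p).
  rewrite -[k]addn0; apply: ordOZ (ordO0_pdZ i); rewrite -[k]addn0.
  exact: ordOM (height_ordO i) ordO0_inv_confactor.
apply: ordOB => //; apply: ordOB => //.
apply: ordOZ_le gauss_normal_ordO ordO0_gauss; by rewrite addn0 leq_addr.
Qed.

(** Each [height i] equals [- D . d_i Z], hence is at most a constant times [|D|], and the pair of
    them has exact order [k]. *)
Lemma gauss_ordOmega : ordOmega k D.
Proof.
have O : ordOmega k (fun p => (height Z 0 p, - height Z 1 p) : R * R) by exact: ordOmega_taylor hP hQ.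
have [A A0 hA] := ordOP (ordO0_pdZ 0); have [B B0 hB] := ordOP (ordO0_pdZ 1).
apply: (@ordOmega_le _ _ _ _ (3 * (A + B + 1)) _ _ _ _ O).
  by rewrite mulr_gt0 // ltr_wpDl // addr_ge0.
apply: filterS3 near_disk hA hB => p Up; rewrite expr0 !mulr1 => h1 h2.
have n0 := normr_ge0 (D p).
have H i : `|pd i Z p| <= A + B + 1 -> `|height Z i p| <= 3 * (A + B + 1) * `|D p|.
  move=> h; rewrite -[height Z i p]opprK -(dgauss_dot_dZ i Up) normrN.
  apply: le_trans (norm_dot_le _ _) _; rewrite -mulrA ler_pM2l // mulrC.
  exact: ler_wpM2r.
by rewrite normp_le /= normrN !H //; lra.
Qed.

(** In the frame the components are [- N . ddZ = - N(0) . ddZ - D . ddZ]: the first is a derivative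
    of [height], the second is of order [k]. *)
Lemma dgauss_ordO j : ordO k.-1 (pd j N).
Proof.
apply: (@ordO_near _ _ _ (fun p =>
   (- (dot (pd j (pd 0 Z) p) (N o) + dot (D p) (pd j (pd 0 Z) p)) * (confactor Z p)^-1) *: pd 0 Z p
   + (- (dot (pd j (pd 1 Z) p) (N o) + dot (D p) (pd j (pd 1 Z) p)) * (confactor Z p)^-1) *: pd 1 Z p)).
  apply: filterS near_disk => p Up.
  have F := gauss_frame cZ Up; rewrite [RHS](frame_decomp _ F).
  rewrite (dgauss_normal oD cZ) // scale0r addr0 !(dgauss_dot oD cZ) // !dotBl.
  by rewrite !(dotC (N o)) ![dot (pd j _ p) (N o) + _]addrC !subrK.
have B i : ordO k.-1 (fun p => (- (dot (pd j (pd i Z) p) (N o) + dot (D p) (pd j (pd i Z) p))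
    * (confactor Z p)^-1) *: pd i Z p).
  rewrite -[k.-1]addn0; apply: ordOZ (ordO0_pdZ i); rewrite -[k.-1]addn0.
  apply: ordOM ordO0_inv_confactor; apply: ordON; apply: ordOD; first exact: dheight_ordO.
  by apply: ordO_dot_le gauss_ordO (ordO0_pdpdZ i j); rewrite addn0 leq_pred.
exact: ordOD.
Qed.

(** Replaces the moving tangent vector by the one at the origin. The price is [dN = O(|p|^(k-1))]
    times [O(|p|)], still of order [k], so [dN] can be compared with the derivatives of [height]. *)
Lemma dgauss_dot_frame i j :
  ordO k (fun p => dot (pd j N p) (pd i Z o) + dot (pd j (pd i Z) p) (N o)).
Proof.
apply: (@ordO_near _ _ _ (fun p => - dot (pd j N p) (pd i Z p - pd i Z o) - dot (D p) (pd j (pd i Z) p))).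
  apply: filterS near_disk => p Up.
  rewrite dotBr dotBl (dgauss_dot oD cZ) // (dotC (N o)); ring.
apply: ordOB.
  apply: ordON; apply: (@ordO_dot_le _ k k.-1 1) (dgauss_ordO j) (smooth_subordO oD Do (smooth_pd i cZ.1)).
  by rewrite addn1 prednK // (ltn_trans _ k2).
by apply: ordO_dot_le gauss_ordO (ordO0_pdpdZ i j); rewrite addn0.
Qed.

Variables (Zt : R * R -> 'rV[R]_3) (c : R).
Variables (W : R * R -> 'rV[R]_3) (rho phi : R * R -> R).
Hypothesis S : ribaucour_system (pdisk eps) Z Zt c W rho phi.
Local Notation y := (riccati_y W phi).
Hypothesis y1 : ordO 1 y.

Definition riccati_dy p i : 'rV[R]_3 :=
  - (c / 2) *: pd i N p - dot (y p) (y p) *: pd i Z p + (2 * dot (y p) (pd i Z p)) *: y p.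

Lemma riccati_dy_ordO m i : ordO m y -> ordO (m + m) (fun p => riccati_dy p i + (c / 2) *: pd i N p).
Proof.
move=> ym; apply: (@ordO_ext _ _ _ (fun p => (2 * dot (y p) (pd i Z p)) *: y p - dot (y p) (y p) *: pd i Z p)).
  by move=> p; rewrite /riccati_dy; apply/rowP => j; rewrite !mxE; ring.
apply: ordOB.
  apply: (ordOZ _ ym); apply: ordOMc; rewrite -[m]addn0; exact: (ordO_dot ym (ordO0_pdZ i)).
by rewrite -[(m + m)%N]addn0; apply: ordOZ (ordO0_pdZ i); exact: ordO_dot.
Qed.

(** The differential of this sum contains only the terms of the Riccati equation quadratic in [y];
    integration adds one order. *)
Lemma riccati_remainder m : ordO m y -> ordO (m + m).+1 (fun p => y p + (c / 2) *: D p).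
Proof.
move=> ym; apply: (@ordO_integrate_vec _ _ _ _ (fun i p => riccati_dy p i + (c / 2) *: pd i N p)).
- apply: filterS (near_pdisk e0) => p Up i; have [_ _ _ /(_ i) dy] := riccati_y_spec S Up.
  apply: is_derive_addf dy _.
  have dN := is_derive_subf (dN_is_derive oD cZ i (pdisk_disk Up)) (is_derive_cst0 (N o) p (e R i)).
  apply: is_derive_eq (is_derive_scalef (is_derive_cst0 (c / 2) p (e R i)) dN) _.
  by rewrite scale0r add0r subr0.
- by move=> i; exact: riccati_dy_ordO.
- apply: (@ordO_cvg0 _ _ 0); apply: ordOD => //; apply: ordOZc.
  exact: smooth_subordO oD Do sN.
Qed.

(** Bootstrap from order 1: if [y] has order [m < k], it differs from a multiple of [D], of order
    [k], by a term of order [2 m + 1], so its order increases. *)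
Lemma riccati_y_ordO : ordO k y.
Proof.
suff H m : (1 <= m <= k)%N -> ordO m y by apply: H; rewrite leqnn andbT (ltn_trans _ k2).
elim: m => [//|[|m] IH] /andP[_ mk]; first exact: y1.
have ym : ordO m.+1 y by apply: IH; rewrite /= ltnW.
apply: (@ordO_ext _ _ _ (fun p => (y p + (c / 2) *: D p) - (c / 2) *: D p)).
  by move=> p; rewrite addrK.
apply: ordOB; last by apply: ordOZc; exact: ordOW mk gauss_ordO.
by apply: ordOW (riccati_remainder ym); rewrite addSn !ltnS leq_addr.
Qed.

Lemma riccati_y_ordOmega : ordOmega k y.
Proof.
have [c0 _] := S.
apply: (@ordOmega_sub _ _ _ (fun p => (- (c / 2)) *: D p)).
  by apply: ordOmegaZ gauss_ordOmega; rewrite oppr_eq0 mulf_neq0 // invr_eq0 pnatr_eq0.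
apply: (@ordO_ext _ _ _ (fun p => y p + (c / 2) *: D p)).
  by move=> p; rewrite scaleNr opprK.
by apply: ordOW (riccati_remainder riccati_y_ordO); rewrite ltnS leq_addr.
Qed.

Lemma dy_ordO i : ordO k.-1 (fun p => riccati_dy p i).
Proof.
apply: (@ordO_ext _ _ _ (fun p => (riccati_dy p i + (c / 2) *: pd i N p) - (c / 2) *: pd i N p)).
  by move=> p; rewrite addrK.
apply: ordOB; last by apply: ordOZc; exact: dgauss_ordO.
apply: ordOW (riccati_dy_ordO i riccati_y_ordO).
by rewrite (leq_trans (leq_pred k)) // leq_addr.
Qed.

End GaussExpansion.

(** * Geometry of the end *)

Section Integrals.
Local Open Scope ereal_scope.

Import HBNNSimple.

(** The integral of a nonnegative function is a supremum over the simple functions below it, which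
    grows with the function. It serves to bound the total curvature by a constant integrand. *)
Lemma le_integralT_nonmeasurable d (T : measurableType d) (R : realType)
    (mu : {measure set T -> \bar R}) (f g : T -> \bar R) :
  (forall x, 0 <= f x) -> (forall x, f x <= g x) -> \int[mu]_x f x <= \int[mu]_x g x.
Proof.
move=> f0 fg; have g0 x : 0 <= g x by exact: le_trans (f0 x) (fg x).
rewrite !ge0_integralTE //; apply: le_ereal_sup => _ [h hf <-]; exists h => // x.
exact: le_trans (hf x) (fg x).
Qed.

Lemma bounded_integral_pdisk (R : realType) (r B : R) (f : R * R -> R) : (0 < r)%R ->
  (forall p, pdisk r p -> (0 <= f p <= B)%R) ->
  \int[(@lebesgue_measure R \x @lebesgue_measure R)%E]_(p in pdisk r) (f p)%:E < +oo.
Proof.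
move=> r0 fB; set mu := (X in \int[X]_(_ in _) _).
pose box := (`[- r, r]%classic `*` `[- r, r]%classic)%R : set (R * R).
have mbox : measurable box by apply: measurableX; exact: measurable_itv.
have sub p : pdisk r p -> box p.
  move=> [pr _]; have b (t u : R) : (t ^+ 2 + u ^+ 2 < r ^+ 2 -> - r <= t <= r)%R.
    move=> tu; rewrite -ler_norml -(ler_pXn2r (_ : (0 < 2)%N)) ?nnegrE ?(ltW r0) //.
    by rewrite real_normK ?num_real //; have := sqr_ge0 u; lra.
  rewrite /disk /= /pdot -!expr2 in pr.
  by split; rewrite /= in_itv /=; [exact: b pr|apply: (b _ p.1); rewrite addrC].
rewrite integral_mkcond.
apply: (@le_lt_trans _ _ (\int[mu]_(p in box) (cst `|B|%:E) p)).
  rewrite [leRHS]integral_mkcond; apply: le_integralT_nonmeasurable => p.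
    rewrite /patch; case: ifPn => //; rewrite inE => /fB /andP[h _].
    by rewrite lee_fin.
  rewrite /patch; case: ifPn => [|_]; last by case: ifPn => // _; rewrite lee_fin.
  rewrite inE => pp; rewrite ifT ?inE; last exact: sub.
  by rewrite lee_fin (le_trans _ (ler_norm B)) //; have /andP[] := fB p pp.
pose I0 := (`[- r, r]%classic)%R : set R.
have fin : mu box < +oo.
  have -> : mu box = lebesgue_measure I0 * lebesgue_measure I0.
    by apply: product_measure1E; exact: measurable_itv.
  rewrite /I0 !lebesgue_measure_itv /=; case: ifPn => _; last by rewrite mule0 ltry.
  by rewrite -EFinB -!EFinM ltry.
rewrite integral_cst //; apply: lte_mul_pinfty => //.
Qed.

End Integrals.

(** * Completeness and the curvature density *)

Section EndGeometry.
Variable R : realType.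
Local Notation o := (0 : R * R).
Variables (eps : R) (Zt : R * R -> 'rV[R]_3).

(** One chord suffices: the length is at least the distance from [Zt (g 0)] to [Zt (g t)], which is
    unbounded as [t] tends to 1. *)
Lemma complete_of_blowup : (forall M : R, \forall p \near o^', M <= `|Zt p|) ->
  complete_end eps Zt.
Proof.
move=> bl g gc gU g1; rewrite /curve_length; apply/eqyP => A A0.
pose M := `|Zt (g 0)| + A.
have /dnbhs0P[r r0 Hr] := bl M.
have n1 : \forall t \near (1 : R)^'-, `|g t| < r.
  by move/cvgr0Pnorm_lt : g1 => /(_ r r0).
have n2 : \forall t \near (1 : R)^'-, 0 < t by exact: nbhs_left_gt.
have n3 : \forall t \near (1 : R)^'-, t < 1 by exact: nbhs_left_lt.
have F : \forall t \near (1 : R)^'-, [/\ `|g t| < r, 0 < t & t < 1].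
  by apply: filterS3 n1 n2 n3 => t.
have [t [t1 t2 t3]] := @filter_ex _ _ (at_left_proper_filter (1 : R)) _ F.
have tI : t \in `[0, 1[ by rewrite in_itv /= ltW.
have /pdiskP[_ gn] := gU t tI.
have H := Hr _ gn t1.
apply: (@le_trans _ _ (enorm (Zt (g t) - Zt (g 0)))%:E); last first.
  (* The polygon has a single edge; its vertex sequence is [0, t, t, ...]. *)
  apply: ereal_sup_ubound; exists 1%N, (fun n => if n is 0%N then 0 else t); split.
  - by case=> [|i] [|j] //= _; exact: ltW.
  - by case=> [|i]; rewrite /= in_itv /= ?lexx ?ltr01 ?t3 ?ltW.
  - by rewrite big_nat1.
rewrite lee_fin; apply: (@le_trans _ _ `|Zt (g t) - Zt (g 0)|).
  by have := lerB_dist (Zt (g t)) (Zt (g 0)); rewrite /M in H; lra.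
rewrite /enorm -(ler_pXn2r (_ : (0 < 2)%N)) ?nnegrE ?sqrtr_ge0 //.
by rewrite sqr_sqrtr ?dot_ge0 // sqr_norm_le_dot.
Qed.

Hypothesis cZt : conformal_immersion (pdisk eps) Zt.

(* The density [|K| sqrt (det g)] of the total curvature is the Jacobian of the Gauss map. *)
Lemma curvature_density_le p : pdisk eps p -> forall B : R, 0 <= B ->
  (forall i, `|pd i (gauss Zt) p| <= B) ->
  `|gauss_curvature Zt p| * Num.sqrt (\det (gI Zt p)) <= 18 * B ^+ 2.
Proof.
move=> Up B B0 HB; have ln := confactor_neq0 cZt Up; have [l0 Hl] := conformal_dot cZt Up.
rewrite /gauss_curvature (gIE cZt Up) det_scalar sqrtr_sqr (gtr0_norm l0).
rewrite normrM normfV (ger0_norm (sqr_ge0 _)).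
(* The factor 3 bounds a dot product by sup norms. The determinant consists of two products of such
   entries, whence [18]. *)
have E i j : `|gII Zt p i j| <= 3 * (`|pd i Zt p| * B).
  rewrite mxE /second_form gauss_fun !pdE normrN; apply: le_trans (norm_dot_le _ _) _.
  by rewrite ler_pM2l // ler_wpM2l.
have zl i : `|pd i Zt p| ^+ 2 <= confactor Zt p.
  by apply: le_trans (sqr_norm_le_dot _) _; rewrite Hl eqxx mulr1n.
have P i j i' j' : `|gII Zt p i j * gII Zt p i' j'| <= 9 * (`|pd i Zt p| * `|pd i' Zt p|) * B ^+ 2.
  rewrite normrM; apply: le_trans (ler_pM (normr_ge0 _) (normr_ge0 _) (E i j) (E i' j')) _.
  by rewrite le_eqVlt; apply/orP; left; apply/eqP; ring.
have q : `|pd 0 Zt p| * `|pd 1 Zt p| <= confactor Zt p.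
  have := sqr_ge0 (`|pd 0 Zt p| - `|pd 1 Zt p|); rewrite sqrrB.
  have := zl 0; have := zl 1; lra.
have D : `|\det (gII Zt p)| <= 18 * B ^+ 2 * confactor Zt p.
  rewrite det2E; apply: le_trans (ler_normB _ _) _.
  have := P 0 0 1 1; have := P 0 1 1 0.
  have := ler_wpM2r (sqr_ge0 B) q; lra.
have -> : `|\det (gII Zt p)| / confactor Zt p ^+ 2 * confactor Zt p =
    `|\det (gII Zt p)| / confactor Zt p by field.
by rewrite ler_pdivrMr.
Qed.

End EndGeometry.

(** * Planarity of the end and failure of injectivity *)

Section PlanarEnd.
Variable R : realType.
Local Notation o := (0 : R * R).
Variables (eps : R) (Z Zt : R * R -> 'rV[R]_3) (c : R).
Variables (W : R * R -> 'rV[R]_3) (rho phi : R * R -> R).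
Hypothesis e0 : 0 < eps.
Hypothesis mZ : conformal_minimal_immersion (disk eps) Z.
Hypothesis mZt : conformal_minimal_immersion (pdisk eps) Zt.
Hypothesis S : ribaucour_system (pdisk eps) Z Zt c W rho phi.
Local Notation N := (gauss Z).
Local Notation y := (riccati_y W phi).
Local Notation dy := (riccati_dy Z c W phi).
Let cZ : conformal_immersion (disk eps) Z := mZ.1.
Let oD : open (disk eps) := @disk_open R eps.
Let oP : open (pdisk eps) := @pdisk_open R eps.
Let Do : disk eps o := disk0 e0.
Let sN : smooth (disk eps) N := smooth_gauss oD cZ.
Hypothesis y1 : ordO 1 y.

(** The norm of [y / (y.y)] is at least [1 / (3 |y|)], the factor 3 comparing the Euclidean square
    with the sup norm, and [Z] stays bounded. *)
Lemma blowup (M : R) : \forall p \near o^', M <= `|Zt p|.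
Proof.
have [B B0 HB] : exists2 B : R, 0 <= B & \forall p \near o^', `|Z p| <= B * `|p| ^+ 0.
  by apply: ordOP; apply: continuous_ordO0; exact: (smooth_cont cZ.1 Do).
pose K := `|M| + B + 1; have K0 : 0 < K by rewrite ltr_wpDl // addr_ge0.
have i0 : 0 < (3 * K)^-1 by rewrite invr_gt0 mulr_gt0.
have /cvgr0Pnorm_lt/(_ _ i0) Y := ordO_cvg0 y1.
apply: filterS3 (near_pdisk e0) HB Y => p Up; rewrite expr0 mulr1 => h1 h2.
have [y0 -> _ _] := riccati_y_spec S Up.
have yy0 : 0 < dot (y p) (y p) by rewrite dot_gt0.
have ny : 0 < `|y p| by rewrite normr_gt0.
have h3 : K <= `|(dot (y p) (y p))^-1 *: y p|.
  rewrite normrZ normfV (gtr0_norm yy0) mulrC ler_pdivlMr //.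
  apply: le_trans (ler_wpM2l (ltW K0) (dot_le_sqr_norm (y p))) _.
  have hk : `|y p| * (3 * K) <= 1 by rewrite -ler_pdivlMr ?mulr_gt0 // mul1r ltW.
  have := ler_wpM2r (ltW ny) hk; rewrite mul1r; apply: le_trans.
  by rewrite le_eqVlt; apply/orP; left; apply/eqP; ring.
move: h3; set v := _ *: y p => h3.
have := lerB_dist v (- Z p); rewrite opprK normrN (addrC v) => h4.
have := ler_norm M; rewrite /K in h3; lra.
Qed.

Lemma gauss_Zt_limit : gauss_map Zt p @[p --> o^'] --> N o.
Proof.
have L : (fun p => N p + (2 / c) *: y p) @ o^' --> N o.
  rewrite -[X in _ --> X]addr0; apply: cvgD; first exact: (continuous_cvg_dnbhs (smooth_cont sN Do)).
  exact: (ordO_cvg0 (ordOZc _ y1)).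
apply: cvg_trans L; apply: near_eq_cvg.
by apply: filterS (near_pdisk e0) => p /(riccati_y_spec S)[_ _ ->].
Qed.

Lemma dgauss_Zt i p : pdisk eps p -> pd i (gauss Zt) p = pd i N p + (2 / c) *: dy p i.
Proof.
move=> Up; have [_ _ _ /(_ i) Dy] := riccati_y_spec S Up.
rewrite (@pd_local _ _ (pdisk eps) _ (fun q => N q + (2 / c) *: y q)) //; last first.
  by move=> q Uq; rewrite -gauss_fun; have [_ _ ->] := riccati_y_spec S Uq.
apply: is_derive_pd; apply: is_derive_addf; first exact: (dN_is_derive oD cZ i (pdisk_disk Up)).
Qed.

(** The derivatives of [N + (2 / c) y] are bounded because [dy + (c / 2) dN] is quadratic in [y];
    the density is then bounded on a set of finite area. *)
Lemma finite_curvature : finite_total_curvature eps Zt.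
Proof.
have bN i : ordO 0 (pd i N) by exact: (ordO0_pd e0 i sN).
have b0 i : ordO 0 (fun p => pd i N p + (2 / c) *: dy p i).
  apply: ordOD => //; apply: ordOZc.
  apply: (@ordO_ext _ _ _ (fun p => (dy p i + (c / 2) *: pd i N p) - (c / 2) *: pd i N p)).
    by move=> p; rewrite addrK.
  apply: ordOB; last exact: ordOZc.
  exact: (ordOW (isT : (0 <= 1 + 1)%N) (riccati_dy_ordO e0 mZ c i y1)).
have [B0 B00 H0] := ordOP (b0 0); have [B1 B10 H1] := ordOP (b0 1).
have /dnbhs0P[r r0 Hr] : \forall p \near o^', pdisk eps p /\
    (`|pd 0 N p + (2 / c) *: dy p 0| <= B0 * `|p| ^+ 0 /\
     `|pd 1 N p + (2 / c) *: dy p 1| <= B1 * `|p| ^+ 0).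
  by apply: filterS3 (near_pdisk e0) H0 H1 => p; split.
pose r' := Num.min r eps; have r'0 : 0 < r' by rewrite lt_min r0.
exists r'; split=> //; first by rewrite ge_min lexx orbT.
apply: (@bounded_integral_pdisk _ _ (18 * (B0 + B1) ^+ 2)) => // p Up'.
have pn : p != 0 by case/pdiskP: Up'.
have pr : `|p| < r.
  have h : `|p| ^+ 2 < r' ^+ 2.
    by have [d _] := Up'; apply: le_lt_trans d; exact: sqr_normp_le.
  have : `|p| < r'.
    by rewrite ltNge; apply/negP => h'; have := ler_sqr_ge0 (ltW r'0) h'; rewrite leNgt h.
  by move=> /lt_le_trans; apply; rewrite ge_min lexx.
have [Up [h0 h1]] := Hr p pn pr; rewrite expr0 !mulr1 in h0 h1.
rewrite mulr_ge0 ?sqrtr_ge0 //=; apply: (curvature_density_le mZt.1 Up); first exact: addr_ge0.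
by move=> i; rewrite dgauss_Zt //; elim/I2_ind: i; [move: h0|move: h1]; lra.
Qed.

Variables (k : nat) (a b : R).
Hypothesis k2 : (2 <= k)%N.
Hypothesis ab : (a != 0) || (b != 0).
Hypothesis hP : ordO k.+1 (taylor_re k a b (height Z 0)).
Hypothesis hQ : ordO k.+1 (taylor_im k a b (fun p => - height Z 1 p)).
Hypothesis dP : ordO k (taylor_re k.-1 (k%:R * a) (k%:R * b) (pd 0 (height Z 0))).
Hypothesis dQ : ordO k (taylor_im k.-1 (k%:R * a) (k%:R * b) (pd 0 (fun p => - height Z 1 p))).

Let D p := N p - N o.
Let DO : ordO k D := gauss_ordO e0 mZ hP hQ.
Let yO : ordO k y := riccati_y_ordO e0 mZ k2 hP hQ S y1.
Let yOm : ordOmega k y := riccati_y_ordOmega e0 mZ k2 ab hP hQ S y1.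
Let remO : ordO (k + k).+1 (fun p => y p + (c / 2) *: D p) := riccati_remainder e0 mZ S y1 yO.
Let c0 : c != 0 := S.1.

Lemma height_limit : dot (Zt p) (N o) @[p --> o^'] --> dot (Z o) (N o) + c^-1.
Proof.
pose Q p := y p + (c / 2) *: D p.
(* This is the error in [y.N(0) = (y.y) / c + num]. Substituting [y = Q - (c / 2) D] and
   [D.N(0) = - D.D / 2], which holds on the unit sphere, cancels the [D.D] terms. Every remaining
   term contains [Q], of order [2 k + 1], so [num / (y.y)] tends to 0. *)
pose num p := dot (Q p) (N o) - dot (Q p) (Q p) / c + dot (Q p) (D p).
have numO : ordO (k + k + 1) num.
  rewrite addn1; apply: ordOD.
    apply: ordOB; first by apply: ordO_dot_le remO (ordO_cst _); rewrite addn0.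
    apply: (@ordO_ext _ _ _ (fun p => c^-1 * dot (Q p) (Q p))); first by move=> p; rewrite mulrC.
    by apply: ordOMc; apply: ordO_dot_le remO remO; rewrite leq_addr.
  by apply: ordO_dot_le remO DO; rewrite leq_addr.
have L : (fun p => dot (Z p) (N o) + (c^-1 + num p / dot (y p) (y p))) @ o^' --> dot (Z o) (N o) + c^-1.
  apply: cvgD.
    have cd : {for o, continuous (fun p => dot (Z p) (N o))}.
      have C0 : Ck 0 (disk eps) (fun p => dot (Z p) (N o)).
        by apply: Ck_dot => //; [exact: cZ.1|exact: Ck_cst].
      exact: (Ck_cont C0 Do).
    exact: (continuous_cvg_dnbhs cd).
  rewrite -[X in _ --> X]addr0; apply: cvgD; first exact: cvg_cst.
  exact: (@ordO_cvg0 _ _ 0) (ordO_div_sqr yOm numO).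
apply: cvg_trans L; apply: near_eq_cvg.
apply: filterS (near_pdisk e0) => p Up; have [y0 -> _ _] := riccati_y_spec S Up.
have yy0 : dot (y p) (y p) != 0 by rewrite dot_eq0.
have NN := gauss_unit cZ (pdisk_disk Up); have NN0 := gauss_unit cZ Do.
have DN : dot (D p) (N o) = - dot (D p) (D p) / 2.
  by rewrite /D !dot_lin NN NN0 (dotC (N o)); field.
have -> : dot (Z p + (dot (y p) (y p))^-1 *: y p) (N o) =
    dot (Z p) (N o) + (dot (y p) (y p))^-1 * dot (y p) (N o).
  by move: (y p) => w; rewrite dotDl dotZl.
congr (_ + _).
have -> : num p = dot (y p) (N o) - dot (y p) (y p) / c.
  rewrite /num /Q; move: DN; move: (D p) (y p) => d w DN.
  rewrite !dot_lin DN (dotC d w); field.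
  exact: c0.
by field; rewrite yy0 c0.
Qed.

Let X i := pd i Z o.
Let dl p := Z p - Z o.
Let yy p := dot (y p) (y p).
(** [V] is [(y.y) (Zt - Z o)] and [B] below is [(y.y) |Zt - Z o|^2]; multiplication by [y.y] makes
    both regular at the puncture, where [B] tends to 1. *)
Let V p := y p + yy p *: dl p.
Let B p := 1 + (2 * dot (y p) (dl p) + yy p * dot (dl p) (dl p)).

(* This is [(Zt - Z o) / |Zt - Z o| ^ 2], written through [Zt = Z + y / (y.y)]. *)
Definition inverted_end p := (B p)^-1 *: V p.
Local Notation Y := inverted_end.

(** Inversion is an involution, so [Zt] is recovered from [inverted_end]: equal values of the latter
    give equal values of [Zt]. *)
Lemma inverted_endE p : pdisk eps p -> B p != 0 ->
  Zt p - Z o = (dot (Y p) (Y p))^-1 *: Y p.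
Proof.
move=> Up Bn; have [y0 -> _ _] := riccati_y_spec S Up.
have yy0 : yy p != 0 by rewrite /yy dot_eq0.
have VV : dot (V p) (V p) = yy p * B p.
  rewrite /V /B /yy; move: (y p) (dl p) => w d.
  by rewrite !dot_lin (dotC d w); ring.
have YY : dot (Y p) (Y p) = yy p / B p.
  rewrite /inverted_end; move: VV; move: (V p) (B p) Bn => v w wn VV.
  by rewrite !dot_lin VV; field.
rewrite YY /inverted_end /V /dl -/(yy p); move: (B p) Bn (yy p) yy0 (y p) => w wn t tn v.
apply/rowP => j; rewrite !mxE; field; by rewrite tn wn.
Qed.

Let dV p i := dy p i + ((dot (dy p i) (y p) + dot (y p) (dy p i)) *: dl p + yy p *: pd i Z p).
Let dB p i := 2 * (dot (dy p i) (dl p) + dot (y p) (pd i Z p)) +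
   ((dot (dy p i) (y p) + dot (y p) (dy p i)) * dot (dl p) (dl p) +
    yy p * (dot (pd i Z p) (dl p) + dot (dl p) (pd i Z p))).
Let dY p i := (- dB p i / B p ^+ 2) *: V p + (B p)^-1 *: dV p i.

Lemma inverted_end_derive i p : pdisk eps p -> B p != 0 -> is_derive p (e R i) Y (dY p i).
Proof.
move=> Up Bn; have [_ _ _ /(_ i) Dy] := riccati_y_spec S Up; rewrite -/(dy p i) in Dy.
have Ddl : is_derive p (e R i) dl (pd i Z p).
  by rewrite -[pd i Z p]subr0; apply: is_derive_subf; exact: (dZ_is_derive cZ i (pdisk_disk Up)).
have Dyy := is_derive_dot Dy Dy.
have DV := is_derive_addf Dy (is_derive_scalef Dyy Ddl).
have D2 := is_derive_mulf (is_derive_cst0 (2 : R) p (e R i)) (is_derive_dot Dy Ddl).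
have D3 := is_derive_mulf Dyy (is_derive_dot Ddl Ddl).
have DB : is_derive p (e R i) B (dB p i).
  apply: is_derive_eq (is_derive_addf (is_derive_cst0 (1 : R) p (e R i)) (is_derive_addf D2 D3)) _.
  by rewrite /dB mul0r !add0r.
exact: (is_derive_scalef (is_derive_invf Bn DB) DV).
Qed.

Let k1 : (1 <= k)%N := ltnW k2.
Let dlO : ordO 1 dl := smooth_subordO oD Do cZ.1.
Let ZO i : ordO 0 (pd i Z) := ordO0_pd e0 i cZ.1.
Let dyO i : ordO k.-1 (fun p => dy p i) := dy_ordO e0 mZ k2 hP hQ dP dQ S y1 i.
Let yyO : ordO (k + k) yy := ordO_dot yO yO.

Lemma B_ordO : ordO k (fun p => B p - 1).
Proof.
apply: (@ordO_ext _ _ _ (fun p => 2 * dot (y p) (dl p) + yy p * dot (dl p) (dl p))).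
  by move=> p; rewrite /B [1 + _]addrC addrK.
apply: ordOD; first by apply: ordOMc; apply: ordO_dot_le yO dlO; rewrite leq_addr.
apply: ordOM_le yyO (ordO_dot dlO dlO); by rewrite -addnA leq_addr.
Qed.

Lemma B_limit : B @ o^' --> (1 : R).
Proof. exact: (@cvg_subordO _ _ 0) (ordOW k1 B_ordO). Qed.

Lemma B_neq0 : \forall p \near o^', B p != 0.
Proof.
have /cvgr0Pnorm_lt/(_ 1 ltr01) := @ordO_cvg0 _ _ 0 _ (ordOW k1 B_ordO); apply: filterS => p h.
by apply: contraTneq h => ->; rewrite sub0r normrN normr1 ltxx.
Qed.

Lemma Binv_ordO : ordO 0 (fun p => (B p)^-1).
Proof. exact: (ordO_inv0 (oner_neq0 R) B_limit). Qed.

Lemma V_ordO : ordO k V.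
Proof.
apply: ordOD => //; apply: ordOZ_le yyO dlO; by rewrite -addnA leq_addr.
Qed.

Lemma dyy_ordO i : ordO k (fun p => dot (dy p i) (y p) + dot (y p) (dy p i)).
Proof.
by apply: ordOD; [apply: ordO_dot_le (dyO i) yO; rewrite leq_addl|
                  apply: ordO_dot_le yO (dyO i); rewrite leq_addr].
Qed.

Lemma dB_ordO i : ordO k (fun p => dB p i).
Proof.
have kk : (k <= k.-1 + 1)%N by rewrite addn1 prednK.
have dd := ordO_dot dlO dlO.
apply: ordOD.
  apply: ordOMc; apply: ordOD; first exact: (ordO_dot_le kk (dyO i) dlO).
  by apply: ordO_dot_le yO (ZO i); rewrite addn0.
apply: ordOD; first by apply: ordOM_le (dyy_ordO i) dd; rewrite leq_addr.
apply: (@ordOM_le _ _ (k + k) 0) yyO _; first by rewrite addn0 leq_addr.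
by apply: ordOD; [apply: ordO_dot_le (ZO i) dlO|apply: ordO_dot_le dlO (ZO i)].
Qed.

Lemma dV_sub_ordO i : ordO k (fun p => dV p i - dy p i).
Proof.
apply: (@ordO_ext _ _ _ (fun p => (dot (dy p i) (y p) + dot (y p) (dy p i)) *: dl p + yy p *: pd i Z p)).
  by move=> p; rewrite /dV [dy p i + _]addrC addrK.
apply: ordOD; first by apply: ordOZ_le (dyy_ordO i) dlO; rewrite leq_addr.
by apply: ordOZ_le yyO (ZO i); rewrite addn0 leq_addr.
Qed.

(** Passing from [y] to the inversion about [Z(0)] changes the differential only at order [k], one
    order above that of [dN]. *)
Lemma dY_ordO i : ordO k (fun p => dY p i + (c / 2) *: pd i N p).
Proof.
have dVO : ordO 0 (fun p => dV p i).
  apply: (@ordO_ext _ _ _ (fun p => (dV p i - dy p i) + dy p i)); first by move=> p; rewrite subrK.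
  by apply: ordOD; [exact: (ordOW (leq0n k) (dV_sub_ordO i))|exact: (ordOW (leq0n k.-1) (dyO i))].
apply: (@ordO_near _ _ _ (fun p => (- (dB p i * ((B p)^-1 * (B p)^-1))) *: V p
   - ((B p - 1) * (B p)^-1) *: dV p i + ((dV p i - dy p i) + (dy p i + (c / 2) *: pd i N p)))).
  apply: filterS B_neq0 => p Bn; rewrite /dY.
  move: (dV p i) (dB p i) (V p) (dy p i) (pd i N p) (B p) Bn => u1 u2 u3 u4 u5 w wn.
  by apply/rowP => j; rewrite !mxE; field.
apply: ordOD.
  apply: ordOB.
    apply: (@ordOZ_le _ _ k k k _ _ (leq_addr k k) _ V_ordO); apply: ordON.
    apply: (@ordOM_le _ k k 0 _ _ _ (dB_ordO i) (ordOM Binv_ordO Binv_ordO)).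
    by rewrite addn0.
  apply: (@ordOZ_le _ _ k k 0 _ _ _ _ dVO); first by rewrite addn0.
  by apply: (@ordOM_le _ k k 0 _ _ _ B_ordO Binv_ordO); rewrite addn0.
apply: ordOD; first exact: dV_sub_ordO.
by apply: ordOW (riccati_dy_ordO e0 mZ c i yO); rewrite leq_addr.
Qed.

Lemma Y_ordO : ordO k Y.
Proof. exact: (@ordOZ_le _ _ k 0 k _ _ (leqnn k) Binv_ordO V_ordO). Qed.

(** Tangential coordinates of [Y], scaled so that [dF j], close to [- dN . d_j Z(0)], agrees with
    [d (height j)] up to order [k]. Thus [F 0 - i F 1] has the leading term [(a + i b) z^k] of the
    height derivative. *)
Let F j p := (2 / c) * dot (Y p) (X j).
Let dF j i p := (2 / c) * dot (dY p i) (X j).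

Lemma dF_ordO j i : ordO k (fun p => dF j i p - dot (pd i (pd j Z) p) (N o)).
Proof.
apply: (@ordO_ext _ _ _ (fun p => (2 / c) * dot (dY p i + (c / 2) *: pd i N p) (X j)
    - (dot (pd i N p) (X j) + dot (pd i (pd j Z) p) (N o)))).
  move=> p; rewrite /dF; move: (dY p i) (pd i N p) (pd i (pd j Z) p) (X j) (N o) => u1 u2 u3 u4 u5.
  by rewrite dotDl dotZl; field.
apply: ordOB.
  by apply: ordOMc; apply: ordO_dot_le (dY_ordO i) (ordO_cst _); rewrite addn0.
exact: (dgauss_dot_frame e0 mZ k2 hP hQ dP dQ j i).
Qed.

Lemma F_derive j i p : pdisk eps p -> B p != 0 -> is_derive p (e R i) (F j) (dF j i p).
Proof.
move=> Up Bn; have DY := inverted_end_derive i Up Bn.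
have h := is_derive_dot DY (is_derive_cst0 (X j) p (e R i)).
apply: is_derive_eq (is_derive_mulf (is_derive_cst0 (2 / c) p (e R i)) h) _.
by rewrite /dF dot0r mul0r add0r addr0.
Qed.

Lemma F_ordO j : ordO 1 (F j).
Proof. by apply: ordOMc; apply: ordO_dot_le Y_ordO (ordO_cst _); rewrite addn0. Qed.

Let E1 p := F 0 p - (a * (zpow k p).1 - b * (zpow k p).2).
Let E2 p := - F 1 p - (a * (zpow k p).2 + b * (zpow k p).1).

(** [E1] is the sum of [F 0 - height 0] and the Taylor error of [height 0], and both differentials
    are of order [k]. The conjugate part [E2] is treated in the same way. *)
Lemma E1_derive : exists dE : 'I_2 -> R * R -> R, (forall i, ordO k (dE i)) /\
  \forall p \near o^', forall i, is_derive p (e R i) E1 (dE i p).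
Proof.
pose s p := taylor_re k.-1 (k%:R * a) (k%:R * b) (pd 0 (height Z 0)) p.
pose t p := taylor_im k.-1 (k%:R * a) (k%:R * b) (pd 0 (fun p => - height Z 1 p)) p.
exists (fun i p => (dF 0 i p - dot (pd i (pd 0 Z) p) (N o)) + (if i == 0 then s p else - t p)).
split=> [i|].
  apply: ordOD; first exact: dF_ordO.
  by elim/I2_ind: i => //=; exact: ordON.
apply: filterS2 (near_pdisk e0) B_neq0 => p Up Bn i; have Dp := pdisk_disk Up.
have [t0 t1 _ _] := taylor_derive k a b (height_holomorphic mZ) Dp.
have T : is_derive p (e R i) (taylor_re k a b (height Z 0)) (if i == 0 then s p else - t p).
  by elim/I2_ind: i.
have := is_derive_addf (is_derive_subf (F_derive 0 i Up Bn) (height_is_derive mZ 0 i Dp)) T.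
by congr (is_derive _ _ _ _); apply/funext => q; rewrite /E1 /taylor_re; ring.
Qed.

Lemma E2_derive : exists dE : 'I_2 -> R * R -> R, (forall i, ordO k (dE i)) /\
  \forall p \near o^', forall i, is_derive p (e R i) E2 (dE i p).
Proof.
pose s p := taylor_re k.-1 (k%:R * a) (k%:R * b) (pd 0 (height Z 0)) p.
pose t p := taylor_im k.-1 (k%:R * a) (k%:R * b) (pd 0 (fun p => - height Z 1 p)) p.
exists (fun i p => - (dF 1 i p - dot (pd i (pd 1 Z) p) (N o)) + (if i == 0 then t p else s p)).
split=> [i|].
  apply: ordOD; first by apply: ordON; exact: dF_ordO.
  by elim/I2_ind: i.
apply: filterS2 (near_pdisk e0) B_neq0 => p Up Bn i; have Dp := pdisk_disk Up.
have [_ _ t0 t1] := taylor_derive k a b (height_holomorphic mZ) Dp.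
have T : is_derive p (e R i) (taylor_im k a b (fun p => - height Z 1 p)) (if i == 0 then t p else s p).
  by elim/I2_ind: i.
have := is_derive_addf (is_derive_oppf (is_derive_subf (F_derive 1 i Up Bn) (height_is_derive mZ 1 i Dp))) T.
by congr (is_derive _ _ _ _); apply/funext => q; rewrite /E2 /taylor_im; ring.
Qed.

Lemma E_ordO : ordO k.+1 E1 /\ ordO k.+1 E2.
Proof.
have [z1 z2] := @ordO_zpow R k; have z1' := ordOW k1 z1; have z2' := ordOW k1 z2.
have [dE1 [q1 H1]] := E1_derive; have [dE2 [q2 H2]] := E2_derive.
split.
  apply: ordO_integrate H1 q1 _; apply: (@ordO_cvg0 _ _ 0).
  by apply: ordOB; [exact: F_ordO|apply: ordOB; exact: ordOMc].
apply: ordO_integrate H2 q2 _; apply: (@ordO_cvg0 _ _ 0).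
by apply: ordOB; [apply: ordON; exact: F_ordO|apply: ordOD; exact: ordOMc].
Qed.

Lemma continuous_dot (f g : R * R -> 'rV[R]_3) p : {for p, continuous f} -> {for p, continuous g} ->
  {for p, continuous (fun q => dot (f q) (g q))}.
Proof.
move=> /continuous_coord cf /continuous_coord cg; rewrite /prop_for /continuous_at.
rewrite dotE; under eq_fun do rewrite dotE.
by apply: cvgD; first apply: cvgD; apply: cvgM; [exact: cf|exact: cg|exact: cf|exact: cg|exact: cf|exact: cg].
Qed.

Lemma inverted_end_cont p : pdisk eps p -> B p != 0 -> {for p, continuous Y}.
Proof.
move=> Up Bn; have Dp := pdisk_disk Up.
have cy : {for p, continuous y}.
  apply: near_eq_cont (_ : {for p, continuous (fun q => (c / 2) *: (gauss Zt q - N q))}).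
    apply: filterS (open_nbhs_nbhs (conj oP Up)) => q Uq.
    have [_ _ E _] := riccati_y_spec S Uq; rewrite -gauss_fun E addrC addKr scalerA.
    by rewrite (_ : c / 2 * (2 / c) = 1) ?scale1r //; field.
  apply: cvgZr; apply: cvgB; last exact: (smooth_cont sN Dp).
  exact: (smooth_cont (smooth_gauss oP mZt.1) Up).
have cdl : {for p, continuous dl}.
  by apply: cvgB; [exact: (smooth_cont cZ.1 Dp)|exact: cvg_cst].
have cyy := continuous_dot cy cy.
have cB : {for p, continuous B}.
  apply: cvgD; first exact: cvg_cst.
  apply: cvgD; first by apply: cvgM; [exact: cvg_cst|exact: continuous_dot].
  by apply: cvgM; [exact: cyy|exact: continuous_dot].
apply: cvgZ; first by apply: cvgV; [exact: Bn|exact: cB].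
by apply: cvgD; [exact: cy|apply: cvgZ; [exact: cyy|exact: cdl]].
Qed.

Lemma not_embedded : ~ embedded_end eps Zt.
Proof.
move=> [r [r0 reps inj]].
pose n := a ^+ 2 + b ^+ 2.
have n0 : n != 0.
  by rewrite /n paddr_eq0 ?sqr_ge0 // !sqrf_eq0 negb_and.
(* [ci] is [1 / (a + i b)]; multiplying by it normalizes the leading coefficient, so that
   [zpow k + g] is [ci (F 0 - i F 1)]. *)
pose ci : R * R := (a / n, - b / n).
pose g p := cmul ci (E1 p, E2 p).
have [dE1 [q1 H1]] := E1_derive; have [dE2 [q2 H2]] := E2_derive.
have [e1 e2] := E_ordO.
have gO : ordO k.+1 g.
  have [A A0 hA] := ordOP (ordOB (ordOMc (a / n) e1) (ordOMc (- b / n) e2)).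
  have [A' A'0 hA'] := ordOP (ordOD (ordOMc (a / n) e2) (ordOMc (- b / n) e1)).
  exists (A + A'); apply: filterS2 hA hA' => p h1 h2; rewrite mulrDl normp_le /g /=.
  have m1 : 0 <= A * `|p| ^+ k.+1 by rewrite mulr_ge0 ?exprn_ge0.
  have m2 : 0 <= A' * `|p| ^+ k.+1 by rewrite mulr_ge0 ?exprn_ge0.
  by apply/andP; split; lra.
have dc i p (x : R) (f : R * R -> R) df : is_derive p (e R i) f df ->
    is_derive p (e R i) (fun q => x * f q) (x * df).
  by move=> Df; apply: is_derive_eq (is_derive_mulf (is_derive_cst0 x p (e R i)) Df) _; ring.
have g1 : \forall p \near o^', forall i, is_derive p (e R i) (fun q => (g q).1)
    (a / n * dE1 i p - - b / n * dE2 i p).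
  by apply: filterS2 H1 H2 => p h1 h2 i; apply: is_derive_subf; exact: dc.
have g2 : \forall p \near o^', forall i, is_derive p (e R i) (fun q => (g q).2)
    (a / n * dE2 i p + - b / n * dE1 i p).
  by apply: filterS2 H1 H2 => p h1 h2 i; apply: is_derive_addf; exact: dc.
have Yc p (Up : pdisk eps p) (Bn : B p != 0) := inverted_end_cont Up Bn.
have cst (v : 'rV[R]_3) p : {for p, continuous (fun _ : R * R => v)} by exact: cvg_cst.
have gc : \forall p \near o^', {for p, continuous g}.
  apply: filterS2 (near_pdisk e0) B_neq0 => p Up Bn.
  have cF j : {for p, continuous (F j)}.
    by apply: cvgM; [exact: cvg_cst|exact: (continuous_dot (Yc p Up Bn) (cst _ _))].
  have zc : zpow k @ p --> zpow k p by exact: zpow_cont.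
  have z1 : (fun q => (zpow k q).1) @ p --> (zpow k p).1.
    by apply: cvg_comp zc _; exact: cvg_fst.
  have z2 : (fun q => (zpow k q).2) @ p --> (zpow k p).2.
    by apply: cvg_comp zc _; exact: cvg_snd.
  have mc (x : R) (f : R * R -> R) : f @ p --> f p -> (fun q => x * f q) @ p --> x * f p.
    by move=> cf; apply: cvgM; [exact: cvg_cst|exact: cf].
  have cE1 : E1 @ p --> E1 p.
    by apply: cvgB; [exact: cF|apply: cvgB; exact: mc].
  have cE2 : E2 @ p --> E2 p.
    by apply: cvgB; [apply: cvgN; exact: cF|apply: cvgD; exact: mc].
  exact: (cvg_pair (cvgB (mc _ _ cE1) (mc _ _ cE2)) (cvgD (mc _ _ cE2) (mc _ _ cE1))).
(* The third coordinate of [Y]: the fiber argument matches it in addition to the two tangential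
   ones. *)
pose u p := dot (Y p) (N o).
have uc : \forall p \near o^', {for p, continuous u}.
  apply: filterS2 (near_pdisk e0) B_neq0 => p Up Bn.
  exact: (continuous_dot (Yc p Up Bn) (cst _ _)).
have /dnbhs0P[r1 r10 Hr1] : \forall p \near o^', pdisk eps p /\ B p != 0.
  by apply: filterS2 (near_pdisk e0) B_neq0 => p.
have /dnbhs0P[r2 r20 Hr2] := near_pdisk r0.
have m0 : 0 < Num.min r1 r2 by rewrite lt_min r10.
have q1' i : ordO k (fun p => a / n * dE1 i p - - b / n * dE2 i p) by apply: ordOB; exact: ordOMc.
have q2' i : ordO k (fun p => a / n * dE2 i p + - b / n * dE1 i p) by apply: ordOD; exact: ordOMc.
have [p [q [pq [p0 pr] [q0 qr] Gpq upq]]] := fiber_collision k2 gO g1 g2 q1' q2' gc uc m0.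
move: pr qr; rewrite !lt_min => /andP[pr1 pr2] /andP[qr1 qr2].
have [[Up Bp] [Uq Bq]] := conj (Hr1 p p0 pr1) (Hr1 q q0 qr1).
have GE z : zpow k z + g z = cmul ci (F 0 z, - F 1 z).
  rewrite /g /ci /E1 /E2; move: (F 0 z) (F 1 z) (zpow k z) n0 => x1 x2 w; rewrite /n => n0.
  by apply: pair_ext; rewrite /=; field; exact: n0.
have FF : F 0 p = F 0 q /\ F 1 p = F 1 q.
  move: Gpq; rewrite !GE; move: (F 0 p) (F 1 p) (F 0 q) (F 1 q) => x1 x2 x3 x4.
  move=> /(congr1 (cmul (a, b))); rewrite !cmulA.
  have -> : cmul (a, b) ci = (1, 0).
    by move: n0; rewrite /ci /n => n0; apply: pair_ext; rewrite /=; field; exact: n0.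
  by rewrite !(cmulC (1, 0)) !cmul1 => -[-> /oppr_inj ->].
have c2 : 2 / c != 0 by rewrite mulf_neq0 ?invr_eq0 // pnatr_eq0.
(* All three components in the orthogonal frame at the origin coincide. *)
have YE : Y p = Y q.
  apply: (frame_ext (gauss_frame cZ Do)); last exact: upq.
    by apply: (mulfI c2); exact: FF.1.
  by apply: (mulfI c2); exact: FF.2.
have ZE : Zt p = Zt q.
  apply: (addIr (- Z o)); rewrite (inverted_endE Up Bp) (inverted_endE Uq Bq).
  by rewrite YE.
move/eqP: pq; apply; apply: inj => //; rewrite inE; [exact: Hr2|exact: Hr2].
Qed.

End PlanarEnd.

Lemma riccati_y_vanishes (R : realType) (W : R * R -> 'rV[R]_3) (phi : R * R -> R) (phi0 : R) :
  phi0 != 0 -> ordO 1 W -> ordO 1 (fun p => phi p - phi0) -> ordO 1 (riccati_y W phi).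
Proof.
move=> p0 hW hp.
have L : (fun p => 2 * phi p) @ (0 : R * R)^' --> 2 * phi0.
  by apply: cvgM; [exact: cvg_cst|exact: cvg_subordO hp].
have n0 : 2 * phi0 != 0 by rewrite mulf_neq0 // pnatr_eq0.
exact: (@ordOZ_le _ _ 1 0 1 _ _ (leqnn 1) (ordON (ordO_inv0 n0 L)) hW).
Qed.

Theorem theorem3p6 (R : realType) (eps : R) (Z Zt : R * R -> 'rV[R]_3) :
  0 < eps ->
  conformal_minimal_immersion (disk eps) Z ->
  (forall p : R * R, pdisk eps p -> ~ umbilic Z p) ->
  umbilic Z (0 : R * R) ->
  minimal_end eps Zt ->
  ribaucour_integrable (pdisk eps) Z Zt ->
  complete_end eps Zt /\ planar_end eps Zt /\ ~ embedded_end eps Zt.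
Proof.
move=> e0 mZ _ uZ [mZt noext] [_ _ [tau [_ _ rd]]].
have oP := @pdisk_open R eps.
have cZ : conformal_immersion (pdisk eps) Z.
  have [sZ cf] := mZ.1; split=> [k|p Up]; last exact: cf (pdisk_disk Up).
  by apply: Ck_sub (sZ k) => p Up; exact: pdisk_disk Up.
have [c [W [rho [phi S]]]] := ribaucour_data_system oP cZ rd.
have [W0 [rho0 [phi0 [hW hr hp WW nz]]]] := system_limits e0 mZ.1 S.
have r0 : rho0 = 0.
  by apply: contrapT => /eqP r0; apply: noext; exact: (smooth_extension e0 mZ uZ mZt S hW hr r0).
have p0 : phi0 != 0 by case: nz; rewrite ?r0 ?eqxx.
have W00 : W0 = 0 by apply/eqP; rewrite -dot_eq0 WW r0 mulr0 mul0r.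
have hW' : ordO 1 W by apply: ordO_ext hW => p; rewrite W00 subr0.
have y1 := riccati_y_vanishes p0 hW' hp.
have [k [a [b [k2 ab [hP hQ] [dP dQ]]]]] := height_order e0 mZ uZ mZt S.
split; first by apply: complete_of_blowup => M; exact: (blowup e0 mZ S y1).
split; last exact: (not_embedded e0 mZ mZt S y1 k2 ab hP hQ dP dQ).
split; first exact: (finite_curvature e0 mZ mZt S y1).
exists (gauss Z 0), (dot (Z 0) (gauss Z 0) + c^-1); split.
  exact: (gauss_Zt_limit e0 mZ S y1).
exact: (height_limit e0 mZ S y1 k2 ab hP hQ).
Qed.
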